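(* Let $X$ satisfy the standing assumptions in the context with $\alpha<2$, and suppose there is a function $\phi$, regularly varying at infinity of index $-\alpha$, and constants $a_1,a_2>0$ such that \[ \mathbf P(X\in x+\Delta)\le\frac{\phi(|x|)}{|x|^d}=:g(|x|)\quad (x\in\mathbb R^d),\qquad a_1\phi(t)\le\mathbf P(|X|>t)\le a_2\phi(t)\quad(t>0). \] Then there is a constant $C_0$ such that for all $n\ge1$ and $x,y\in\mathbb H^+$, \[ p_n(x,y)\le C_0\,g(|x-y|)\,H(y_1+1)\,V(x_1+1). \]
   Context: $X=(X_1,\dots,X_d)$ random vector in $\mathbb R^d$, i.i.d. copies $X(k)$, $S(n)=X(1)+\dots+X(n)$. $\mathbb H^+=\{x:x_1>0\}$, $\mathbb H^-=\mathbb R^d\setminus\mathbb H^+$, $\Delta=[0,1)^d$. For $x_1\ge0$, $\tau_x=\min\{n\ge1:x_1+S_1(n)\le0\}$, $\tau=\tau_0$; $p_n(x,y)=\mathbf P(x+S(n)\in y+\Delta,\tau_x>n)$. $\tau^+=\min\{k\ge1:S_1(k)>0\}$, $\chi^+=S_1(\tau^+)$, $\chi^-=-S_1(\tau)$, $(\chi^\pm_k)$ i.i.d. copies; $H(u)=\mathbf 1\{u>0\}+\sum_{k\ge1}\mathbf P(\chi^+_1+\dots+\chi^+_k<u)$, $V(u)=\mathbf 1\{u\ge0\}+\sum_{k\ge1}\mathbf P(\chi^-_1+\dots+\chi^-_k\le u)$. Standing assumptions: with $c_n=\inf\{u\ge0:u^{-2}\int_{-u}^u t^2\mathbf P(|X|\in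 dt)\le1/n\}$, $S(n)/c_n$ converges in distribution to a multivariate stable law of index $\alpha$ (no centering), with spectral measure $\sigma$ on $\mathbb S^{d-1}$ satisfying $\sigma(\mathbb S^{d-1}\cap\mathbb H^\pm)>0$; $X_1$ is in the domain of attraction of a one-dimensional stable law with admissible $(\alpha,\beta)$, $S_1$ oscillates, and $\mathbf P(S_1(n)>0)\to\rho\in(0,1)$. *)

(* Defs.v *)
From HB Require Import structures.
From mathcomp Require Import all_boot all_order all_algebra.
From mathcomp Require Import all_classical all_reals all_analysis.
Set Implicit Arguments. Unset Strict Implicit. Unset Printing Implicit Defensive.
Import Order.TTheory GRing.Theory Num.Theory.
Import numFieldNormedType.Exports.
Local Open Scope classical_set_scope.
Local Open Scope ring_scope.

(* Points of R^D are represented as D.-tuples (these carry the product =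
   Borel sigma-algebra of MathComp-Analysis).  The dimension is D = d.+1 >= 1
   and the "first coordinate" x_1 is [tnth x ord0]. *)
Section vectors.
Variables (R : realType) (D : nat).
Definition vzero : D.-tuple R := [tuple (0 : R) | i < D].
Definition vadd (x y : D.-tuple R) : D.-tuple R := [tuple tnth x i + tnth y i | i < D].
Definition vsub (x y : D.-tuple R) : D.-tuple R := [tuple tnth x i - tnth y i | i < D].
Definition vscale (a : R) (x : D.-tuple R) : D.-tuple R := [tuple a * tnth x i | i < D].
Definition vdot (x y : D.-tuple R) : R := \sum_(i < D) tnth x i * tnth y i.
Definition enorm (x : D.-tuple R) : R := Num.sqrt (vdot x x).
Definition in_box (z y : D.-tuple R) : Prop :=
  forall i, tnth y i <= tnth z i < tnth y i + 1.
Definition vcontinuous (f : D.-tuple R -> R) : Prop :=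
  forall x (e : R), 0 < e -> exists2 del : R, 0 < del &
    forall y, enorm (vsub y x) < del -> `|f y - f x| < e.
Definition vbounded (f : D.-tuple R -> R) : Prop :=
  exists M : R, forall x, `|f x| <= M.
End vectors.

Section random_walk.
Variables (R : realType) (d : nat) (d0 : measure_display) (T : measurableType d0).
Variable (P : probability T R).
(* X k is the (k+1)-th copy X(k+1); S n = X(1) + ... + X(n) *)
Variable (X : nat -> T -> (d.+1).-tuple R).

Definition S (n : nat) (w : T) : (d.+1).-tuple R :=
  \big[@vadd R d.+1/vzero R d.+1]_(k < n) X k w.
Definition S1 (n : nat) (w : T) : R := tnth (S n w) ord0.

Definition iid_vectors : Prop :=
  [/\ forall k, measurable_fun [set: T] (X k),
      forall k (A : set ((d.+1).-tuple R)), measurable A ->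
        P (X k @^-1` A) = P (X 0 @^-1` A) &
      forall (s : seq nat) (A : nat -> set ((d.+1).-tuple R)), uniq s ->
        (forall k, measurable (A k)) ->
        P (\bigcap_(k in [set k | k \in s]) (X k @^-1` A k)) =
        \big[*%E/1%E]_(k <- s) P (X k @^-1` A k)].

(* p_n(x,y) = P(x + S(n) in y + Delta, tau_x > n),
   tau_x = min{m >= 1 : x_1 + S_1(m) <= 0} *)
Definition pn (n : nat) (x y : (d.+1).-tuple R) : \bar R :=
  P [set w | in_box (vadd x (S n w)) y /\
             forall m, (1 <= m <= n)%N -> 0 < tnth x ord0 + S1 m w].

Definition ladder_plus (w : T) : pred nat := fun m => (0 < m)%N && (0 < S1 m w).
Definition ladder_minus (w : T) : pred nat := fun m => (0 < m)%N && (S1 m w <= 0).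
Definition chi_plus (w : T) : R :=
  match pselect (exists m, ladder_plus w m) with
  | left h => S1 (ex_minn h) w | right _ => 0 end.
Definition chi_minus (w : T) : R :=
  match pselect (exists m, ladder_minus w m) with
  | left h => - S1 (ex_minn h) w | right _ => 0 end.

(* Fplus k u = P(chi^+_1 + ... + chi^+_k < u), (chi^+_j) i.i.d. copies of chi^+
   (k-fold convolution of the law of chi^+ on {tau^+ < oo}) *)
Fixpoint Fplus (k : nat) (u : R) : \bar R :=
  match k with
  | 0 => ((0 < u)%R%:R)%:E
  | k'.+1 => (\int[P]_(w in [set w | exists m, ladder_plus w m])
                Fplus k' (u - chi_plus w))%E
  end.
(* Fminus k u = P(chi^-_1 + ... + chi^-_k <= u) *)
Fixpoint Fminus (k : nat) (u : R) : \bar R :=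
  match k with
  | 0 => ((0 <= u)%R%:R)%:E
  | k'.+1 => (\int[P]_(w in [set w | exists m, ladder_minus w m])
                Fminus k' (u - chi_minus w))%E
  end.
Definition Hren (u : R) : \bar R := (\sum_(0 <= k <oo) Fplus k u)%E.
Definition Vren (u : R) : \bar R := (\sum_(0 <= k <oo) Fminus k u)%E.

Definition oscillates : Prop :=
  P [set w | forall (M : R) (N : nat),
       (exists2 n, (N <= n)%N & M < S1 n w) /\
       (exists2 n, (N <= n)%N & S1 n w < - M)] = 1%E.
End random_walk.

Section stable.
Variable (R : realType).

(* Multivariate stable law on R^D of index alpha in (0,2) with spectral
   measure sig (a finite measure on the unit sphere) and shift b, given by its
   characteristic function (Samorodnitsky-Taqqu, Thm 2.3.1):
   E e^{i<t,Y>} = exp(-A(t) + i B(t)). *)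
Definition stab_A (D : nat) (alpha : R) (sig : {measure set (D.-tuple R) -> \bar R})
  (t : D.-tuple R) : R :=
  Rintegral sig setT (fun s => `|vdot t s| `^ alpha).
Definition stab_B (D : nat) (alpha : R) (sig : {measure set (D.-tuple R) -> \bar R})
  (b t : D.-tuple R) : R :=
  (if alpha == 1 then
     - (2 / pi) * Rintegral sig setT (fun s => vdot t s * ln `|vdot t s|)
   else tan (pi * alpha / 2) *
     Rintegral sig setT (fun s => Num.sg (vdot t s) * `|vdot t s| `^ alpha))
  + vdot t b.
Definition stable_law (D : nat) (alpha : R)
  (sig : {measure set (D.-tuple R) -> \bar R}) (b : D.-tuple R)
  (mu : probability (D.-tuple R) R) : Prop :=
  [/\ (sig setT < +oo)%E,
      sig (~` [set s | enorm s = 1]) = 0%E &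
      forall t : D.-tuple R,
        (\int[mu]_x (cos (vdot t x))%:E =
           (expR (- stab_A alpha sig t) * cos (stab_B alpha sig b t))%:E)%E /\
        (\int[mu]_x (sin (vdot t x))%:E =
           (expR (- stab_A alpha sig t) * sin (stab_B alpha sig b t))%:E)%E].

(* One-dimensional stable law with parameters (alpha, beta):
   E e^{itY} = exp(-g|t|^alpha (1 - i beta sgn(t) tan(pi alpha/2)) + i del t), alpha <> 1,
   E e^{itY} = exp(-g|t| (1 + i beta (2/pi) sgn(t) ln|t|) + i del t), alpha = 1. *)
Definition stable1_B (alpha beta g del t : R) : R :=
  (if alpha == 1 then - g * beta * (2 / pi) * (t * ln `|t|)
   else g * beta * Num.sg t * `|t| `^ alpha * tan (pi * alpha / 2)) + del * t.
Definition stable_law1 (alpha beta : R) (nu : probability R R) : Prop :=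
  exists g del : R, 0 < g /\ forall t : R,
    (\int[nu]_x (cos (t * x))%:E =
       (expR (- (g * `|t| `^ alpha)) * cos (stable1_B alpha beta g del t))%:E)%E /\
    (\int[nu]_x (sin (t * x))%:E =
       (expR (- (g * `|t| `^ alpha)) * sin (stable1_B alpha beta g del t))%:E)%E.

Definition admissible (alpha beta : R) : Prop :=
  [\/ (0 < alpha < 1) /\ `|beta| < 1, alpha = 1 /\ beta = 0,
      (1 < alpha < 2) /\ `|beta| <= 1 | alpha = 2 /\ beta = 0].

Definition regularly_varying (phi : R -> R) (r : R) : Prop :=
  [/\ measurable_fun [set t : R | 0 < t] phi,
      forall t, 0 < t -> 0 < phi t &
      forall l : R, 0 < l ->
        (fun t => phi (l * t) / phi t) @ +oo --> l `^ r].
End stable.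

Section assumptions.
Variables (R : realType) (d : nat) (d0 : measure_display) (T : measurableType d0).
Variables (P : probability T R) (X : nat -> T -> (d.+1).-tuple R).

Definition multi_stable_domain (alpha : R) : Prop :=
  exists c : nat -> R, (forall n, 0 < c n) /\
  exists (mu : probability ((d.+1).-tuple R) R)
         (sig : {measure set ((d.+1).-tuple R) -> \bar R}) (b : (d.+1).-tuple R),
  [/\ stable_law alpha sig b mu,
      (0 < sig [set s | enorm s = 1%R /\ (0 < tnth s ord0)%R])%E,
      (0 < sig [set s | enorm s = 1%R /\ (tnth s ord0 <= 0)%R])%E &
      forall f : (d.+1).-tuple R -> R, vcontinuous f -> vbounded f ->
        (fun n => \int[P]_w (f (vscale (c n)^-1 (S X n w)))%:E)%E @ \oo -->
        (\int[mu]_x (f x)%:E)%E].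

Definition stable_domain1 (alpha beta : R) : Prop :=
  exists a b : nat -> R, (forall n, 0 < a n) /\
  exists nu : probability R R, stable_law1 alpha beta nu /\
    forall f : R -> R, continuous f -> (exists M : R, forall x, `|f x| <= M) ->
      (fun n => \int[P]_w (f ((S1 X n w - b n) / a n))%:E)%E @ \oo -->
      (\int[nu]_x (f x)%:E)%E.

Definition standing_assumptions (alpha : R) : Prop :=
  [/\ iid_vectors P X, 0 < alpha <= 2, multi_stable_domain alpha,
      exists beta, admissible alpha beta /\ stable_domain1 alpha beta &
      oscillates P X] /\
      exists rho : R, 0 < rho < 1 /\
        (fun n => P [set w | (0 < S1 X n w)%R]) @ \oo --> rho%:E.
End assumptions.

(* g(t) = phi(t)/t^D, with g(0) = +oo (as phi(0)/0) *)
Definition gfun (R : realType) (D : nat) (phi : R -> R) (t : R) : \bar R :=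
  if t == 0 then +oo%E else (phi t / t ^+ D)%:E.

(* Main.v *)
Require Import Defs.
From HB Require Import structures.
From mathcomp Require Import all_boot all_order all_algebra.
From mathcomp Require Import all_classical all_reals all_analysis.
From mathcomp Require Import measurable_realfun ring lra zify.
Set Implicit Arguments. Unset Strict Implicit. Unset Printing Implicit Defensive.
Import Order.TTheory GRing.Theory Num.Theory.
Import numFieldNormedType.Exports.
Local Open Scope classical_set_scope.
Local Open Scope ring_scope.

(* A local large deviation of the walk to distance r = |x - y| is caused by one
   big jump.  If a jump of size comparable to r occurs at step k, its local law
   contributes at most C g(r), while the part before k has to stay in the
   half-space from x and, after time reversal, the part after k has to stay in
   it from y.  Splitting both parts at the last minimum of the first coordinate
   bounds their survival probabilities by convolutions of renewal masses with
   survival probabilities from the boundary, and summing over k leaves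
   V(x_1 + 1) H(y_1 + 1), because the boundary survival probabilities of S_1
   and -S_1 have convolution at most one.  Without a big jump one half of the
   path covers the distance r/4 by jumps of size at most r/(4N); this costs a
   large power of n P(|X| > r), which beats the missing local factor supplied
   by a concentration bound for the sum of a third or a quarter of the steps.
   For n P(|X| > r) >= 1 that concentration bound suffices.
   The stable limit enters only through the absence of centering, i.e. through
   |E[X; |X| <= t]| <= C t P(|X| > t), and the limit of P(S_1(n) > 0) only
   through its being neither 0 nor 1. *)

(** * Independent sequences *)

(** The scale of the walk at time [n] is read off the law of one step: it is a power [2 ^ J] for
    which [n * tail (2 ^ J)] is of order one. The survival probabilities of S_1 and -S_1 are
    controlled jointly: the minimum over a time interval is attained at a single distinguished time,
    so their partial sums up to [n] multiply to at most 2n + 1. A lower bound for one such sum is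
    thereby an upper bound for the other, which allows inequalities uniform in [n]. The walk is
    moved to the space of step sequences, where shifts and reversals of time are reindexings and
    independence is read off the sets of steps on which events depend. Statements about the first
    coordinate carry a boolean selecting S_1 or -S_1 with complementary treatment of ties, so each
    is proved once and time reversal exchanges the two cases. The restriction alpha < 2 enters
    through the truncated second moment, of order at most t ^ 2 P(|X| > t). Together with the bound
    on the truncated mean it makes Chebyshev's inequality sharp enough to give P(|S(n)| > t) of
    order at most n P(|X| > t), the only large deviation estimate on which the rest is built. *)

Section sequence_space.
Context (dE : measure_display) (E : measurableType dE).

(** Only coordinates in [I] below [n] are constrained, so two cylinders can be brought to a common
    length and their intersection is again a cylinder. *)
Definition cylinder (I : pred nat) (n : nat) (A : nat -> set E) : set (nat -> E) :=
  [set w | forall k, (k < n)%N -> I k -> A k (w k)].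

Definition cylinders (I : pred nat) : set (set (nat -> E)) :=
  [set B | exists n A, (forall k, measurable (A k)) /\ B = cylinder I n A].

(* Every [Om I] is the same type of sequences; only its sigma-algebra, generated
   by the coordinates in [I], depends on [I].  Measurability in [Om I] thus says
   that an event is determined by the steps in [I]. *)
Definition Om (I : pred nat) := g_sigma_algebraType (cylinders I).

Lemma cylindersI I : setI_closed (cylinders I).
Proof.
move=> _ _ [n1 [A1 [mA1 ->]]] [n2 [A2 [mA2 ->]]].
exists (maxn n1 n2), (fun k => (if (k < n1)%N then A1 k else setT) `&`
                               (if (k < n2)%N then A2 k else setT)); split.
  by move=> k; apply: measurableI; case: ifP.
apply/seteqP; split => [w [h1 h2] k _ Ik|w h]; last first.
  split=> k kn Ik.
    by have [] := h k (leq_trans kn (leq_maxl _ _)) Ik; rewrite kn.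
  by have [] := h k (leq_trans kn (leq_maxr _ _)) Ik; rewrite kn.
by split; case: ifP => // kn; [exact: h1|exact: h2].
Qed.

Lemma cylindersT I : cylinders I setT.
Proof.
exists 0%N, (fun=> setT); split => //.
by apply/seteqP; split => w.
Qed.

Lemma measurable_coord (I : pred nat) k : I k ->
  measurable_fun setT (fun w : Om I => w k).
Proof.
move=> Ik _ A mA; rewrite setTI; apply: sub_sigma_algebra.
exists k.+1, (fun j => if j == k then A else setT); split.
  by move=> j; case: ifP.
apply/seteqP; split => [w /= Aw j jk Ij|w /= h].
  by case: eqP => // ->.
by have := h k (ltnSn k) Ik; rewrite eqxx.
Qed.

Lemma measurable_id_Om (I J : pred nat) : {subset J <= I} ->
  measurable_fun setT (id : Om I -> Om J).
Proof.
move=> JI; apply: (@measurability _ _ (Om I) (Om J) _ _ (cylinders J)) => //.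
move=> _ [_ [n [A [mA ->]]] <-]; apply: sub_sigma_algebra.
exists n, (fun k => if J k then A k else setT); split.
  by move=> k; case: ifP.
rewrite setTI; apply/seteqP; split => [w h k kn Ik|w h k kn Jk].
  by case: ifP => // Jk; exact: h.
by have := h k kn (JI _ Jk); rewrite Jk.
Qed.

Lemma measurable_into_Om d1 (T1 : measurableType d1) (I : pred nat)
    (f : T1 -> nat -> E) :
  (forall k, I k -> measurable_fun setT (fun x => f x k)) ->
  measurable_fun setT (f : T1 -> Om I).
Proof.
move=> mf; apply: (@measurability _ _ T1 (Om I) _ _ (cylinders I)) => //.
move=> _ [_ [n [A [mA ->]]] <-]; rewrite setTI.
have -> : f @^-1` cylinder I n A =
    \bigcap_(k in [set k | (k < n)%N && I k]) ((fun x => f x k) @^-1` A k).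
  apply/seteqP; split => [x h k /= /andP[kn Ik]|x h k kn Ik]; first exact: h.
  by apply: (h k); rewrite /= kn.
apply: bigcap_measurableType => k /= /andP[_ Ik].
by rewrite -[X in measurable X]setTI; exact: mf.
Qed.

End sequence_space.

Section iid.
Context (R : realType) (dE : measure_display) (E : measurableType dE).
Variables (mu : probability (@Om _ E predT) R) (nu : probability E R).

Definition Pr (A : set (nat -> E)) : R := fine (mu A).

(** This formula determines [mu], because the full cylinders form a pi-system generating the
    sigma-algebra of [Om predT]. *)
Definition iid_law := forall n (A : nat -> set E), (forall k, measurable (A k)) ->
  mu (cylinder predT n A) = (\prod_(k < n) fine (nu (A k)))%:E.

Hypothesis mu_iid : iid_law.

Local Notation Om I := (@Om _ E I).

Lemma measurable_OmT (I : pred nat) (A : set (Om I)) :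
  measurable A -> measurable (A : set (Om predT)).
Proof.
move=> mA; have := @measurable_id_Om _ E predT I (fun _ _ => isT) measurableT A mA.
by rewrite setTI.
Qed.

Lemma measurable_OmW (I J : pred nat) (A : set (Om I)) : {subset I <= J} ->
  measurable A -> measurable (A : set (Om J)).
Proof.
move=> IJ mA; have := @measurable_id_Om _ E J I IJ measurableT A mA.
by rewrite setTI.
Qed.

Lemma Pr_fin (A : set (Om predT)) : measurable A -> mu A = (Pr A)%:E.
Proof. by move=> mA; rewrite /Pr fineK// fin_num_measure. Qed.

Lemma iid_cylinders (I J : pred nat) n (A B : nat -> set E) :
  (forall k, measurable (A k)) -> (forall k, measurable (B k)) ->
  (forall k, I k -> ~~ J k) ->
  (mu (cylinder I n A `&` cylinder J n B) =
    mu (cylinder I n A) * mu (cylinder J n B))%E.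
Proof.
move=> mA mB IJ.
have cE K (C : nat -> set E) : cylinder K n C =
    cylinder predT n (fun k => if K k then C k else setT).
  apply/seteqP; split => [w h k kn _|w h k kn Kk].
    by case: ifP => // Kk; exact: h.
  by have := h k kn isT; rewrite Kk.
have mm K (C : nat -> set E) : (forall k, measurable (C k)) ->
    forall k, measurable (if K k then C k else setT).
  by move=> mC k; case: ifP.
have -> : cylinder I n A `&` cylinder J n B = cylinder predT n
   (fun k => (if I k then A k else setT) `&` (if J k then B k else setT)).
  rewrite (cE I) (cE J); apply/seteqP; split => [w [h1 h2] k kn _|w h].
    by split; [exact: h1|exact: h2].
  by split => k kn _; case: (h k kn isT).
rewrite mu_iid; last by move=> k; apply: measurableI; exact: mm.
rewrite (cE I) (cE J) !mu_iid; [|exact: mm|exact: mm].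
rewrite -EFinM -big_split/=; congr (_%:E); apply: eq_bigr => k _.
case: ifP => [Ik|_].
  by rewrite (negbTE (IJ _ Ik)) setIT probability_setT mulr1.
by rewrite setTI probability_setT mul1r.
Qed.

Lemma cylinder_widen I n m (A : nat -> set E) : (n <= m)%N ->
  cylinder I n A = cylinder I m (fun k => if (k < n)%N then A k else setT).
Proof.
move=> nm; apply/seteqP; split => [w h k km Ik|w h k kn Ik].
  by case: ifP => // kn; exact: h.
by have := h k (leq_trans kn nm) Ik; rewrite kn.
Qed.

Lemma indep_cylinders (I J : pred nat) (A : set (nat -> E)) (B : set (nat -> E)) :
  (forall k, I k -> ~~ J k) ->
  cylinders I A -> cylinders J B -> (mu (A `&` B) = mu A * mu B)%E.
Proof.
move=> IJ [n1 [A1 [mA1 ->]]] [n2 [A2 [mA2 ->]]].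
rewrite (cylinder_widen I A1 (leq_maxl n1 n2)) (cylinder_widen J A2 (leq_maxr n1 n2)).
by apply: iid_cylinders => // k; case: ifP.
Qed.

Lemma cylinders_measurable I (A : set (nat -> E)) :
  cylinders I A -> measurable (A : set (Om predT)).
Proof.
move=> cA; apply: (@measurable_OmT I); exact: sub_sigma_algebra.
Qed.

(** Both sides are finite measures in [A] that agree on a generating pi-system. [indep] applies this
    twice, once for each factor. *)
Lemma indep_cylinders_measurable (I : pred nat) (B : set (Om predT)) : measurable B ->
  (forall A, cylinders I A -> mu (A `&` B) = mu A * mu B)%E ->
  forall A : set (Om I), measurable A -> (mu (A `&` B) = mu A * mu B)%E.
Proof.
move=> mB h A mA.
have B0 : 0 <= Pr B by rewrite fine_ge0.
pose m1 := mrestr mu mB.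
pose m2 := mscale (NngNum B0) mu.
have := @g_sigma_algebra_measure_unique _ R (Om predT) (cylinders I)
  (@cylinders_measurable I) (fun=> setT) (fun=> @cylindersT _ E I).
move=> /(_ _ m1 m2) H.
have HA : m1 A = m2 A.
  apply: H => //.
  - by apply/seteqP; split => // x _; exists 0%N.
  - exact: cylindersI.
  - move=> C cC.
    transitivity (mu (C `&` B)); first by [].
    transitivity ((Pr B)%:E * mu C)%E; last by [].
    by rewrite -Pr_fin// muleC -h.
  - move=> _; apply: (@le_lt_trans _ _ (mu (setT `&` B))); first by [].
    by rewrite setTI -ge0_fin_numE// fin_num_measure.
have {}HA : (mu (A `&` B) = (Pr B)%:E * mu A)%E := HA.
by rewrite HA muleC (Pr_fin mB).
Qed.

Lemma indep (I J : pred nat) (A : set (Om I)) (B : set (Om J)) :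
  (forall k, I k -> ~~ J k) -> measurable A -> measurable B ->
  (mu (A `&` B) = mu A * mu B)%E.
Proof.
move=> IJ mA mB.
apply: (indep_cylinders_measurable _ _ mA) => [|C cC]; first exact: measurable_OmT mB.
rewrite setIC muleC; apply: (indep_cylinders_measurable _ _ mB) => [|D cD].
  exact: cylinders_measurable cC.
by rewrite setIC muleC; exact: indep_cylinders cC cD.
Qed.

Lemma Pr_indep (I J : pred nat) (A : set (Om I)) (B : set (Om J)) :
  (forall k, I k -> ~~ J k) -> measurable A -> measurable B ->
  Pr (A `&` B) = Pr A * Pr B.
Proof.
move=> IJ mA mB; rewrite /Pr (indep IJ)// fineM// fin_num_measure//.
  exact: measurable_OmT mA.
exact: measurable_OmT mB.
Qed.

Section decouple.
Variables (I J : pred nat) (f : Om I * Om J -> \bar R).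
Hypotheses (IJ : forall k, I k -> ~~ J k)
  (mf : measurable_fun setT f)
  (f0 : forall x, (0 <= f x)%E).

Let idI : Om predT -> Om I := id.
Let idJ : Om predT -> Om J := id.
Let midI : measurable_fun setT idI.
Proof. by apply: measurable_id_Om. Qed.
Let midJ : measurable_fun setT idJ.
Proof. by apply: measurable_id_Om. Qed.
Let dg : Om predT -> Om I * Om J := fun w => (w, w).
Let mdg : measurable_fun setT dg.
Proof. exact: measurable_fun_pair. Qed.

HB.instance Definition _ := isMeasurableFun.Build _ _ _ _ idI midI.
HB.instance Definition _ := isMeasurableFun.Build _ _ _ _ idJ midJ.
HB.instance Definition _ := isMeasurableFun.Build _ _ _ _ dg mdg.

(* By independence the coordinates in [I] and in [J] may be read off two
   independent copies of the sequence. *)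
Lemma decouple :
  (\int[mu]_w f (w, w) = \int[mu]_w \int[mu]_w' f (w, w'))%E.
Proof.
pose mI : probability (Om I) R := distribution mu idI.
pose mJ : probability (Om J) R := distribution mu idJ.
have -> : (\int[mu]_w f (w, w) = \int[distribution mu dg]_x f x)%E.
  by rewrite ge0_integral_distribution.
have eqm (A : set (Om I * Om J)) : measurable A -> (distribution mu dg A = (mI \x mJ) A)%E.
  move=> mA; apply/esym.
  apply: (@product_measure_unique _ _ _ _ R mI mJ (distribution mu dg)) => //.
  by move=> A1 A2 mA1 mA2; exact: (indep IJ mA1 mA2).
rewrite (@eq_measure_integral _ _ _ setT (mI \x mJ)%E) => //; last first.
  by move=> A mA _; exact: eqm.
rewrite fubini_tonelli1//.
rewrite ge0_integral_distribution//=; last 2 first.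
- exact: measurable_fun_fubini_tonelli_F.
- by move=> x; exact: integral_ge0.
apply: eq_integral => w _ /=.
rewrite /fubini_F ge0_integral_distribution//=.
by apply: measurableT_comp => //; exact: pair1_measurable.
Qed.

Lemma measurable_fun_decouple :
  measurable_fun [set: Om predT] (fun w => \int[mu]_w' f (w, w'))%E.
Proof.
pose mJ : probability (Om J) R := distribution mu idJ.
have H : measurable_fun [set: Om I] (fun w => \int[mJ]_w' f (w, w'))%E.
  exact: measurable_fun_fubini_tonelli_F.
have {}H : measurable_fun [set: Om I] (fun w => \int[mu]_w' f (w, w'))%E.
  apply: eq_measurable_fun H => w _; rewrite ge0_integral_distribution//=.
  by apply: measurableT_comp => //; exact: pair1_measurable.
exact: (measurableT_comp H midI).
Qed.

End decouple.

Section reindexing.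
Variables (phi : nat -> nat) (phi_inj : injective phi).

Definition reind (w : nat -> E) : nat -> E := fun k => w (phi k).

Lemma measurable_reind (I J : pred nat) : (forall k, I k -> J (phi k)) ->
  measurable_fun setT (reind : Om J -> Om I).
Proof.
move=> IJ; apply: measurable_into_Om => k Ik; apply: measurable_coord; exact: IJ.
Qed.

(** The pullback constrains coordinate [j] by the intersection of the [A k] with [phi k = j].
    Injectivity leaves at most one such [k], so the product over [j] regroups into the product over
    [k]. Shifts and reversals are both instances of [phi]. *)
Lemma reind_cylinder n (A : nat -> set E) : (forall k, measurable (A k)) ->
  mu (reind @^-1` cylinder predT n A) = mu (cylinder predT n A).
Proof.
move=> mA.
pose A' j := \bigcap_(k in [set k | (k < n)%N /\ phi k = j]) A k.
pose N := (\max_(k < n) phi k).+1.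
have -> : reind @^-1` cylinder predT n A = cylinder predT N A'.
  apply/seteqP; split => [w h j _ _ k [kn <-]|w h k kn _]; first exact: h.
  apply: (h (phi k)) => //; rewrite ltnS.
  exact: (@leq_bigmax _ (fun i : 'I_n => phi i) (Ordinal kn)).
rewrite !mu_iid//; last by move=> k; apply: bigcap_measurableType.
have nuA' j : fine (nu (A' j)) = \prod_(k < n | phi k == j) fine (nu (A k)).
  have [[k /eqP kj]|H] := pselect (exists k : 'I_n, phi k == j).
    rewrite (big_pred1 k); last first.
      by move=> i /=; rewrite -kj (inj_eq phi_inj).
    congr (fine (nu _)); apply/seteqP; split => [x h|x Ax i [_ ij]].
      by apply: (h k); split.
    by have -> : i = k by apply: phi_inj; rewrite ij.
  rewrite big_pred0; last first.
    by move=> i; apply/negP => ij; apply: H; exists i.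
  have -> : A' j = setT; last by rewrite probability_setT.
  apply/seteqP; split => // x _ k [kn kj]; exfalso; apply: H.
  by exists (Ordinal kn); rewrite kj.
under eq_bigr do rewrite nuA'.
rewrite (exchange_big_dep predT)//=; congr (_%:E); apply: eq_bigr => k _.
have kN : (phi k < N)%N by rewrite ltnS; exact: (@leq_bigmax _ (fun i : 'I_n => phi i) k).
by rewrite (big_pred1 (Ordinal kN))// => i; rewrite eq_sym.
Qed.

Let mreind : measurable_fun setT (reind : Om predT -> Om predT).
Proof. exact: measurable_reind. Qed.

HB.instance Definition _ := isMeasurableFun.Build _ _ _ _
  (reind : Om predT -> Om predT) mreind.

Lemma mu_reind (A : set (Om predT)) : measurable A -> mu (reind @^-1` A) = mu A.
Proof.
move=> mA.
have H := @g_sigma_algebra_measure_unique _ R (Om predT) (@cylinders _ E predT)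
  (@cylinders_measurable predT) (fun=> setT) (fun=> @cylindersT _ E predT)
  _ (distribution mu (reind : Om predT -> Om predT)) mu.
apply: H => //.
- by apply/seteqP; split => // x _; exists 0%N.
- exact: cylindersI.
- by move=> _ [n [B [mB ->]]]; exact: reind_cylinder.
- by move=> _; rewrite -ge0_fin_numE// fin_num_measure.
Qed.

Lemma Pr_reind (A : set (Om predT)) : measurable A -> Pr (reind @^-1` A) = Pr A.
Proof. by move=> mA; rewrite /Pr mu_reind. Qed.

Lemma integral_reind (f : Om predT -> \bar R) : measurable_fun setT f ->
  (forall x, 0 <= f x)%E -> (\int[mu]_w f (reind w) = \int[mu]_w f w)%E.
Proof.
move=> mf f0.
transitivity (\int[distribution mu (reind : Om predT -> Om predT)]_x f x)%E.
  by rewrite ge0_integral_distribution.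
by apply: eq_measure_integral => A mA _; exact: mu_reind.
Qed.

End reindexing.

End iid.

(** * Measurability of events given by formulas *)

Section measurable_predicates.
Context (d : measure_display) (T : measurableType d) (R : realType).
Implicit Types f g : T -> R.

Lemma mset_lt f g : measurable_fun setT f -> measurable_fun setT g ->
  measurable [set w | f w < g w].
Proof.
move=> mf mg; have -> : [set w | f w < g w] = (g \- f) @^-1` `]0, +oo[.
  by apply/seteqP; split => w /=; rewrite in_itv/= andbT subr_gt0.
by rewrite -[X in measurable X]setTI; apply: measurable_funB.
Qed.

Lemma mset_le f g : measurable_fun setT f -> measurable_fun setT g ->
  measurable [set w | f w <= g w].
Proof.
move=> mf mg; have -> : [set w | f w <= g w] = (g \- f) @^-1` `[0, +oo[.
  by apply/seteqP; split => w /=; rewrite in_itv/= andbT subr_ge0.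
by rewrite -[X in measurable X]setTI; apply: measurable_funB.
Qed.

Lemma mset_and (A B : set T) : measurable A -> measurable B ->
  measurable [set w | A w /\ B w].
Proof. exact: measurableI. Qed.

Lemma mset_not (A : set T) : measurable A -> measurable [set w | ~ A w].
Proof. exact: measurableC. Qed.

Lemma mset_imp (P : Prop) (A : set T) : (P -> measurable A) ->
  measurable [set w | P -> A w].
Proof.
move=> mA; have [p|np] := pselect P.
  have -> : [set w | P -> A w] = A by apply/seteqP; split => w h; [exact: h|move=> _; exact: h].
  exact: mA.
have -> : [set w | P -> A w] = setT by apply/seteqP; split => [//|w _ p]; case: (np p).
exact: measurableT.
Qed.

Lemma mset_andp (P : Prop) (A : set T) : (P -> measurable A) ->
  measurable [set w | P /\ A w].
Proof.
move=> mA; have [p|np] := pselect P.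
  have -> : [set w | P /\ A w] = A by apply/seteqP; split => w // [].
  exact: mA.
have -> : [set w | P /\ A w] = set0 by apply/seteqP; split => [w [p]|//]; case: (np p).
exact: measurable0.
Qed.

Lemma mset_forall (A : nat -> set T) : (forall k, measurable (A k)) ->
  measurable [set w | forall k, A k w].
Proof.
move=> mA; have -> : [set w | forall k, A k w] = \bigcap_k A k.
  by apply/seteqP; split => w h // k; exact: h.
exact: bigcap_measurableType.
Qed.

Lemma mset_forall_fin (I : finType) (A : I -> set T) : (forall k, measurable (A k)) ->
  measurable [set w | forall k, A k w].
Proof.
move=> mA; have -> : [set w | forall k, A k w] = \bigcap_(k in [set: I]) A k.
  by apply/seteqP; split => w h // k; exact: h.
apply: fin_bigcap_measurable => //; exact: finite_finset.
Qed.

Lemma mset_exists (A : nat -> set T) : (forall k, measurable (A k)) ->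
  measurable [set w | exists k, A k w].
Proof.
move=> mA; have -> : [set w | exists k, A k w] = \bigcup_k A k.
  by apply/seteqP; split => w [k]; exists k.
exact: bigcup_measurable.
Qed.

Lemma mset_cst (P : Prop) : measurable [set w : T | P].
Proof.
have [p|np] := pselect P.
  have -> : [set w : T | P] = setT by apply/seteqP; split.
  exact: measurableT.
have -> : [set w : T | P] = set0 by apply/seteqP; split => [w p|//]; case: (np p).
exact: measurable0.
Qed.

End measurable_predicates.

(** * Elementary probability bounds on sequences *)

Section probability_on_sequences.
Context (R : realType) (dE : measure_display) (E : measurableType dE).
Variables (mu : probability (@Om _ E predT) R).
Local Notation Om I := (@Om _ E I).
Local Notation Pr := (Pr mu).
Implicit Types A B : set (Om predT).

Lemma Pr_ge0 (A : set (nat -> E)) : 0 <= Pr A.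
Proof. exact: fine_ge0. Qed.

Lemma PrT : Pr setT = 1.
Proof. by rewrite -[Pr _]/(fine _) probability_setT. Qed.

Lemma Pr0 : Pr set0 = 0.
Proof. by rewrite -[Pr _]/(fine _) measure0. Qed.

Lemma le_Pr A B : measurable A -> measurable B -> A `<=` B -> Pr A <= Pr B.
Proof.
move=> mA mB AB; rewrite -lee_fin -!Pr_fin//.
by apply: le_measure => //; rewrite inE.
Qed.

Lemma Pr_le1 A : measurable A -> Pr A <= 1.
Proof. by move=> mA; rewrite -PrT; apply: le_Pr. Qed.

Lemma PrC A : measurable A -> Pr (~` A) = 1 - Pr A.
Proof.
move=> mA; apply: EFin_inj; rewrite -Pr_fin; last exact: measurableC.
by rewrite EFinB -Pr_fin// probability_setC.
Qed.

Lemma Pr_setU A B : measurable A -> measurable B ->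
  Pr (A `|` B) <= Pr A + Pr B.
Proof.
move=> mA mB; rewrite -lee_fin EFinD -!Pr_fin//; last exact: measurableU.
exact: measureU2.
Qed.

Lemma Pr_le2 A B C : measurable A -> measurable B -> measurable C ->
  (forall w, A w -> B w \/ C w) -> Pr A <= Pr B + Pr C.
Proof.
move=> mA mB mC ABC; apply: le_trans (Pr_setU mB mC).
by apply: le_Pr => //; exact: measurableU.
Qed.

Lemma Pr_le_sum n A (B : nat -> set (Om predT)) : measurable A ->
  (forall k, (k < n)%N -> measurable (B k)) ->
  (forall w, A w -> exists2 k, (k < n)%N & B k w) ->
  Pr A <= \sum_(k < n) Pr (B k).
Proof.
elim: n A => [|n IH] A mA mB AB.
  rewrite big_ord0 (_ : A = set0) ?Pr0//.
  by apply/seteqP; split => // w /AB[].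
rewrite big_ord_recr/=.
apply: (@le_trans _ _ (Pr (A `\` B n) + Pr (B n))).
  apply: Pr_le2 => //; [apply: measurableD => //|..]; try exact: mB.
  by move=> w Aw; have [Bw|nBw] := pselect (B n w); [right|left].
rewrite lerD2r; apply: IH => [|k kn|w [Aw nBw]].
- by apply: measurableD => //; exact: mB.
- by apply: mB; exact: ltnW.
- have [k] := AB w Aw; rewrite ltnS leq_eqVlt => /orP[/eqP -> //|kn Bk].
  by exists k.
Qed.

Lemma Pr_le_sum_fin (I : finType) A (B : I -> set (Om predT)) : measurable A ->
  (forall k, measurable (B k)) -> (forall w, A w -> exists k, B k w) ->
  Pr A <= \sum_k Pr (B k).
Proof.
move=> mA mB AB.
case: (fintype.pickP (@predT I)) => [x0 _|I0]; last first.
  rewrite big_pred0 // (_ : A = set0) ?Pr0//.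
  by apply/seteqP; split => // w /AB[k]; have := I0 k.
rewrite -big_enum (big_nth x0) big_mkord.
apply: (@Pr_le_sum _ _ (fun k => B (nth x0 (enum I) k))) => // w /AB[k Bk].
by exists (index k (enum I)); rewrite ?index_mem ?mem_enum ?nth_index ?mem_enum.
Qed.

Lemma Pr_disjoint_sum n A (B : nat -> set (Om predT)) : measurable A ->
  (forall k, (k < n)%N -> measurable (B k)) ->
  (forall k, (k < n)%N -> B k `<=` A) ->
  (forall j k w, (j < k < n)%N -> B j w -> B k w -> False) ->
  \sum_(k < n) Pr (B k) <= Pr A.
Proof.
elim: n A => [|n IH] A mA mB BA dB; first by rewrite big_ord0 Pr_ge0.
rewrite big_ord_recr/=.
apply: (@le_trans _ _ (Pr (A `\` B n) + Pr (B n))).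
  rewrite lerD2r; apply: IH => [|k kn|k kn w Bw|j k w /andP[jk kn]].
  - by apply: measurableD => //; exact: mB.
  - by apply: mB; exact: ltnW.
  - split; first by apply: (BA k) => //; exact: ltnW.
    by apply: (dB k n w) => //; rewrite kn /=.
  - by apply: dB; rewrite jk ltnW.
rewrite -lee_fin EFinD -!Pr_fin//; [|exact: mB|by apply: measurableD => //; exact: mB].
rewrite -measureU//; last 3 first.
- by apply: measurableD => //; exact: mB.
- exact: mB.
- by apply/seteqP; split => // w [[]].
apply: le_measure; rewrite ?inE//.
  by apply: measurableU; [apply: measurableD => //|]; exact: mB.
by move=> w [[]|/BA] //; apply.
Qed.

Variable nu : probability E R.
Hypothesis mu_iid : iid_law mu nu.

(** Fubini over two independent blocks: once the steps in [I] are frozen in [A], those in [J] meet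
    the section of [C] with probability at most [q]. *)
Lemma Pr_decouple_le (I J : pred nat) (A : set (Om I)) (C : set (Om I * Om J))
    (B : set (Om predT)) (q : R) :
  (forall k, I k -> ~~ J k) -> measurable A -> measurable C -> measurable B ->
  (forall w, B w -> A w /\ C (w, w)) ->
  (forall w, A w -> Pr [set w' | C (w, w')] <= q) ->
  Pr B <= Pr A * q.
Proof.
move=> IJ mA mC mB BAC Cq.
pose AC : set (Om I * Om J) := [set p | A p.1] `&` C.
have mAC : measurable AC.
  apply: measurableI => //; rewrite -[X in measurable X]setTI.
  by apply: (@measurable_fst _ _ (Om I) (Om J)) => //.
have mA' := measurable_OmT mA.
have secE (w : Om I) : [set w' | AC (w, w')] = xsection AC w.
  by apply/seteqP; split => w' /=; rewrite xsectionE.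
have msec (w : Om I) : measurable ([set w' | AC (w, w')] : set (Om predT)).
  rewrite secE; apply: (@measurable_OmT _ _ J); exact: measurable_xsection.
rewrite -lee_fin EFinM -!Pr_fin//.
pose f : Om I * Om J -> \bar R := EFin \o \1_AC.
have mf : measurable_fun setT f by exact/measurable_EFinP.
have f0 x : (0 <= f x)%E by rewrite lee_fin.
have mD : measurable ((fun w => (w, w)) @^-1` AC : set (Om predT)).
  have mI : measurable_fun setT (id : Om predT -> Om I) by exact: measurable_id_Om.
  have mJ : measurable_fun setT (id : Om predT -> Om J) by exact: measurable_id_Om.
  have mdg : measurable_fun setT ((fun w => (w, w)) : Om predT -> Om I * Om J).
    exact: (measurable_fun_pair mI mJ).
  by rewrite -[X in measurable X]setTI; exact: mdg.
have inn w : (\int[mu]_w' f (w, w') = mu [set w' | AC (w, w')])%E.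
  have -> : (\int[mu]_w' f (w, w') =
    \int[mu]_w' (\1_([set w' | AC (w, w')] : set (Om predT)) w')%:E)%E by [].
  by rewrite integral_indic// setIT.
have E1 : (mu ((fun w => (w, w)) @^-1` AC) = \int[mu]_w \int[mu]_w' f (w, w'))%E.
  rewrite -(decouple mu_iid IJ mf f0).
  have -> : (\int[mu]_w f (w, w) =
    \int[mu]_w (\1_((fun w => (w, w)) @^-1` AC : set (Om predT)) w)%:E)%E by [].
  by rewrite integral_indic// setIT.
(* For empty [A] the constant [q] might be negative; a point of [A] forces [q] to dominate a
   probability. *)
have [A0|/set0P[w0 Aw0]] := eqVneq A set0.
  have -> : B = set0 by apply/seteqP; split => // w /BAC[]; rewrite A0.
  by rewrite A0 !measure0 mul0e.
have q0 : 0 <= q by apply: le_trans (Cq _ Aw0); exact: Pr_ge0.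
pose A1 : set (Om predT) := A.
apply: (@le_trans _ _ (mu ((fun w => (w, w)) @^-1` AC))).
  by apply: le_measure; rewrite ?inE// => w /BAC[].
rewrite E1.
apply: (@le_trans _ _ (\int[mu]_(w in setT) (q%:E * (\1_A1 w)%:E))%E); last first.
  rewrite ge0_integralZl_EFin//; last exact/measurable_EFinP.
  by rewrite integral_indic// setIT muleC.
apply: ge0_le_integral => //.
- by move=> w _; apply: integral_ge0 => w' _; exact: f0.
- exact: measurable_fun_decouple.
- by apply: emeasurable_funM => //; exact/measurable_EFinP.
move=> w _; rewrite inn indicE; case: (boolP (w \in A1)) => [|wA] /=.
  rewrite inE => Aw; rewrite mule1 Pr_fin ?lee_fin//.
  have := Cq w Aw; congr (Pr _ <= _).
  by apply/seteqP; split => w' //= [].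
rewrite mule0 (_ : [set w' | _] = set0) ?measure0//.
apply/seteqP; split => // w' [/= Aw _].
by move: wA; rewrite notin_setE; apply.
Qed.

(** For use at the first ladder epoch, where the condition on the later steps depends on the height
    reached by the earlier ones. *)
Lemma mu_decouple (I J : pred nat) (C : set (Om I * Om J)) :
  (forall k, I k -> ~~ J k) -> measurable C ->
  measurable ([set w | C (w, w)] : set (Om predT)) /\
  measurable_fun [set: Om predT] (fun w => mu [set w' | C (w, w')]) /\
  mu [set w | C (w, w)] = (\int[mu]_w mu [set w' | C (w, w')])%E.
Proof.
move=> IJ mC.
have secE (w : Om I) : [set w' | C (w, w')] = xsection C w.
  by apply/seteqP; split => w' /=; rewrite xsectionE.
have msec (w : Om I) : measurable ([set w' | C (w, w')] : set (Om predT)).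
  rewrite secE; apply: (@measurable_OmT _ _ J); exact: measurable_xsection.
pose f : Om I * Om J -> \bar R := EFin \o \1_C.
have mf : measurable_fun setT f by exact/measurable_EFinP.
have f0 x : (0 <= f x)%E by rewrite lee_fin.
have mD : measurable ((fun w => (w, w)) @^-1` C : set (Om predT)).
  have mI : measurable_fun setT (id : Om predT -> Om I) by exact: measurable_id_Om.
  have mJ : measurable_fun setT (id : Om predT -> Om J) by exact: measurable_id_Om.
  have mdg : measurable_fun setT ((fun w => (w, w)) : Om predT -> Om I * Om J).
    exact: (measurable_fun_pair mI mJ).
  by rewrite -[X in measurable X]setTI; exact: mdg.
have inn w : (\int[mu]_w' f (w, w') = mu [set w' | C (w, w')])%E.
  have -> : (\int[mu]_w' f (w, w') =
    \int[mu]_w' (\1_([set w' | C (w, w')] : set (Om predT)) w')%:E)%E by [].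
  by rewrite integral_indic// setIT.
split; first exact: mD.
split.
  have -> : (fun w => mu [set w' | C (w, w')]) = (fun w => \int[mu]_w' f (w, w'))%E.
    by apply/funext => w; rewrite inn.
  exact: measurable_fun_decouple.
under eq_integral do rewrite -inn.
rewrite -(decouple mu_iid IJ mf f0).
have -> : (\int[mu]_w f (w, w) =
  \int[mu]_w (\1_((fun w => (w, w)) @^-1` C : set (Om predT)) w)%:E)%E by [].
by rewrite integral_indic// setIT.
Qed.

End probability_on_sequences.

(** * Fluctuation theory of the first coordinate *)

Section walk_functionals.
Variables (R : realType) (d : nat).
Local Notation E := ((d.+1).-tuple R).
Implicit Types (w : nat -> E) (s : bool).

Definition inc (i : 'I_d.+1) (a b : nat) w : R := \sum_(a <= k < b) tnth (w k) i.

(** The l1 norm makes triangle inequalities termwise in the coordinates; it differs from [enorm] by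
    a factor at most [d.+1]. *)
Definition norm1 (e : E) : R := \sum_i `|tnth e i|.

Definition ninc (a b : nat) w : R := \sum_i `|inc i a b w|.

(* [s = true] is the walk S_1 with the strict order, [s = false] the walk
   -S_1 with the weak order: [cmp (~~ s) (- v) = ~~ cmp s v]. *)
Definition hinc s (a b : nat) w : R := if s then inc ord0 a b w else - inc ord0 a b w.

Definition cmp s (v : R) : bool := if s then 0 < v else 0 <= v.

Lemma inc_cat i a b c w : (a <= b <= c)%N -> inc i a c w = inc i a b w + inc i b c w.
Proof. by move=> /andP[ab bc]; rewrite /inc (big_cat_nat ab bc). Qed.

Lemma inc_nil i a w : inc i a a w = 0.
Proof. by rewrite /inc big_geq. Qed.

Lemma inc1 i a w : inc i a a.+1 w = tnth (w a) i.
Proof. by rewrite /inc big_nat1. Qed.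

Lemma ninc1 a w : ninc a a.+1 w = norm1 (w a).
Proof. by rewrite /ninc; apply: eq_bigr => i _; rewrite inc1. Qed.

Lemma ninc_nil a w : ninc a a w = 0.
Proof. by rewrite /ninc big1// => i _; rewrite inc_nil normr0. Qed.

Lemma ninc_triangle a b c w : (a <= b <= c)%N -> ninc a c w <= ninc a b w + ninc b c w.
Proof.
move=> abc; rewrite -big_split/=; apply: ler_sum => i _.
by rewrite (inc_cat _ _ abc) ler_normD.
Qed.

Lemma ninc_tail a b c w : (a <= b <= c)%N -> ninc b c w <= ninc a c w + ninc a b w.
Proof.
move=> abc; rewrite -big_split/=; apply: ler_sum => i _.
rewrite (inc_cat _ _ abc); have := ler_normB (inc i a b w + inc i b c w) (inc i a b w).
by rewrite [X in `|X| <= _]addrC addKr.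
Qed.

Lemma inc_le_ninc i a b w : `|inc i a b w| <= ninc a b w.
Proof. by rewrite /ninc (bigD1 i)//= lerDl sumr_ge0. Qed.

Lemma hinc_le_ninc s a b w : `|hinc s a b w| <= ninc a b w.
Proof. by rewrite /hinc; case: s; rewrite ?normrN inc_le_ninc. Qed.

Lemma hinc_cat s a b c w : (a <= b <= c)%N -> hinc s a c w = hinc s a b w + hinc s b c w.
Proof. by move=> abc; rewrite /hinc; case: s; rewrite (inc_cat _ _ abc)// opprD. Qed.

Lemma hinc_nil s a w : hinc s a a w = 0.
Proof. by rewrite /hinc inc_nil oppr0; case: s. Qed.

Lemma hincN s a b w : hinc (~~ s) a b w = - hinc s a b w.
Proof. by rewrite /hinc; case: s => //=; rewrite opprK. Qed.

Lemma cmpN s v : cmp (~~ s) (- v) = ~~ cmp s v.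
Proof. by rewrite /cmp; case: s => /=; rewrite ?oppr_ge0 ?oppr_gt0 ?ltNge ?leNgt ?negbK. Qed.

Definition stay s (u : R) n : set (nat -> E) :=
  [set w | forall j, (0 < j <= n)%N -> 0 < u + hinc s 0 j w].
(** [rcd s k] and [pos s k n] together mark [k] as the time of the minimum over [0, n]: the last
    minimum of S_1 for [s = true], the first minimum of -S_1 for [s = false]. Time reversal calls
    for these complementary tie rules. *)
Definition pos s (a b : nat) : set (nat -> E) :=
  [set w | forall j, (a < j <= b)%N -> cmp s (hinc s a j w)].
Definition rcd s k : set (nat -> E) :=
  [set w | forall j, (j < k)%N -> ~~ cmp s (hinc s j k w)].

(** Induction on [n]: the new time either satisfies [cmp] relative to the old minimum, which then
    persists, or becomes the minimum itself. *)
Lemma last_argmin s n w : exists2 k, (k <= n)%N & rcd s k w /\ pos s k n w.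
Proof.
elim: n => [|n [k kn [rk pk]]].
  by exists 0%N => //; split => j //; lia.
have [ck|ck] := boolP (cmp s (hinc s k n.+1 w)).
  exists k; first exact: leqW.
  split => // j /andP[kj]; rewrite leq_eqVlt => /orP[/eqP -> //|jn].
  by apply: pk; rewrite kj.
exists n.+1 => //; split; last by move=> j; lia.
move=> j jn; have [jk|kj|->] // := ltngtP j k.
  rewrite (@hinc_cat _ _ k); last lia.
  move: ck (rk j jk); rewrite /cmp; case: (s); rewrite -?leNgt -?ltNge.
    by move=> *; lra.
  by move=> *; lra.
move: ck; have /pk : (k < j <= n)%N by lia.
rewrite (@hinc_cat _ k j n.+1); last lia.
rewrite /cmp; case: (s); rewrite -?leNgt -?ltNge; move=> *; lra.
Qed.

Lemma argmin_unique s n j k w : (j < k <= n)%N -> pos s j n w -> rcd s k w -> False.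
Proof.
move=> /andP[jk kn] pj rk; have := rk j jk.
by rewrite pj// jk.
Qed.

Section measurability.
Variable I : pred nat.
Local Notation OmI := (@Om _ E I).

Lemma measurable_tnth_coord i k : I k -> measurable_fun setT (fun w : OmI => tnth (w k) i).
Proof.
move=> Ik; apply: (measurableT_comp (measurable_tnth i)).
exact: measurable_coord.
Qed.

Lemma measurable_inc i a b : (forall k, (a <= k < b)%N -> I k) ->
  measurable_fun setT (fun w : OmI => inc i a b w).
Proof.
move=> abI; have -> : (fun w : OmI => inc i a b w) =
    (fun w => \sum_(a <= k < b) (if (a <= k < b)%N then tnth (w k) i else 0)).
  by apply/funext => w; apply: eq_big_nat => k ->.
apply: measurable_sum => k.
have [/abI Ik|_] := boolP (a <= k < b)%N; last exact: measurable_cst.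
exact: measurable_tnth_coord.
Qed.

Lemma measurable_ninc a b : (forall k, (a <= k < b)%N -> I k) ->
  measurable_fun setT (fun w : OmI => ninc a b w).
Proof.
move=> abI; rewrite /ninc; apply: measurable_sum => i.
by apply: measurableT_comp => //; exact: measurable_inc.
Qed.

Lemma measurable_norm1 k : I k -> measurable_fun setT (fun w : OmI => norm1 (w k)).
Proof.
move=> Ik; rewrite /norm1; apply: measurable_sum => i.
by apply: measurableT_comp => //; exact: measurable_tnth_coord.
Qed.

Lemma measurable_hinc s a b : (forall k, (a <= k < b)%N -> I k) ->
  measurable_fun setT (fun w : OmI => hinc s a b w).
Proof.
move=> abI; rewrite /hinc; case: s; first exact: measurable_inc.
by apply: measurableT_comp => //; exact: measurable_inc.
Qed.

Lemma mset_cmp s (f : OmI -> R) : measurable_fun setT f -> measurable [set w | cmp s (f w)].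
Proof. by move=> mf; rewrite /cmp; case: s; [apply: mset_lt|apply: mset_le]. Qed.

Lemma mset_cmpN s (f : OmI -> R) : measurable_fun setT f ->
  measurable [set w | ~~ cmp s (f w)].
Proof.
move=> mf; have -> : [set w | ~~ cmp s (f w)] = ~` [set w | cmp s (f w)].
  by apply/seteqP; split => w /negP.
by apply: measurableC; exact: mset_cmp.
Qed.

Lemma measurable_stay s u n : (forall k, (k < n)%N -> I k) ->
  measurable (stay s u n : set OmI).
Proof.
move=> nI; apply: mset_forall => j; apply: mset_imp => jn.
apply: mset_lt => //; apply: measurable_funD => //.
by apply: measurable_hinc => k kj; apply: nI; lia.
Qed.

Lemma measurable_pos s a b : (forall k, (a <= k < b)%N -> I k) ->
  measurable (pos s a b : set OmI).
Proof.
move=> abI; apply: mset_forall => j; apply: mset_imp => jn.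
by apply: mset_cmp; apply: measurable_hinc => k kj; apply: abI; lia.
Qed.

Lemma measurable_rcd s k : (forall j, (j < k)%N -> I j) ->
  measurable (rcd s k : set OmI).
Proof.
move=> kI; apply: mset_forall => j; apply: mset_imp => jn.
by apply: mset_cmpN; apply: measurable_hinc => m mj; apply: kI; lia.
Qed.

End measurability.

(** Fixing the indices from [n] on makes the reversal of the first [n] steps an injection of all
    indices, hence an instance of [reind]. *)
Definition revn (n k : nat) : nat := if (k < n)%N then (n - k.+1)%N else k.

Lemma revn_inj n : injective (revn n).
Proof. by move=> j k; rewrite /revn; do 2 case: ifP; lia. Qed.

Lemma addn_inj m : injective (addn m).
Proof. exact: addnI. Qed.

Lemma inc_shift i a b m w : inc i a b (reind (addn m) w) = inc i (m + a) (m + b) w.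
Proof.
rewrite /inc /reind addnC (addnC m b) big_addn addnK.
by apply: eq_bigr => k _; rewrite addnC.
Qed.

Lemma inc_rev i a b n w : (a <= b <= n)%N ->
  inc i a b (reind (revn n) w) = inc i (n - b) (n - a) w.
Proof.
move=> /andP[ab bn]; rewrite /inc big_nat_rev/= -{1}[a]add0n big_addn.
rewrite -{1}[(n - b)%N]add0n big_addn.
have -> : (n - a - (n - b) = b - a)%N by lia.
apply: eq_big_nat => k kab; rewrite /reind /revn ifT; last lia.
by congr (tnth (w _) i); lia.
Qed.

End walk_functionals.

Section fluctuation.
Variables (R : realType) (d : nat).
Local Notation E := ((d.+1).-tuple R).
Local Notation OmT := (@Om _ E predT).
Variables (mu : probability OmT R) (nu : probability E R).
Hypothesis mu_iid : iid_law mu nu.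
Local Notation Pr := (Pr mu).

Definition surv s u n : R := Pr (stay s u n).
Definition surv0 s n : R := Pr (pos s 0 n).
(** The mass at time [k] of the renewal measure of the descending ladder process of [hinc s],
    restricted to depths below [u]. *)
Definition renew s u k : R := Pr [set w | rcd s k w /\ 0 < u + hinc s 0 k w].

Lemma Pr_pos s a b : (a <= b)%N -> Pr (pos s a b) = surv0 s (b - a).
Proof.
move=> ab; rewrite /surv0 -[RHS](Pr_reind mu_iid (@addn_inj a)); last exact: measurable_pos.
congr (Pr _); apply/seteqP; split => w h j jb.
  by rewrite /hinc !inc_shift addn0; apply: h; lia.
have := h (j - a)%N; rewrite /hinc !inc_shift addn0 subnKC; last lia.
by apply; lia.
Qed.

(** Duality: reversing the first [k] steps turns increments ending at [k] into increments from the
    origin, and [cmpN] turns the failure of [cmp s] into [cmp (~~ s)] for the opposite walk. *)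
Lemma Pr_rcd s k : Pr (rcd s k) = surv0 (~~ s) k.
Proof.
rewrite /surv0 -[RHS](Pr_reind mu_iid (@revn_inj k)); last exact: measurable_pos.
congr (Pr _); apply/seteqP; split => w h j jk.
  have -> : hinc (~~ s) 0 j (reind (revn k) w) = - hinc s (k - j) k w.
    by rewrite hincN /hinc !inc_rev ?subn0//; lia.
  by rewrite cmpN; apply: h; lia.
have := h (k - j)%N; rewrite hincN.
have -> : hinc s 0 (k - j) (reind (revn k) w) = hinc s j k w.
  by rewrite /hinc inc_rev ?subn0 ?subKn//; lia.
by rewrite cmpN; apply; lia.
Qed.

Lemma surv_ge0 s u n : 0 <= surv s u n. Proof. exact: Pr_ge0. Qed.
Lemma surv0_ge0 s n : 0 <= surv0 s n. Proof. exact: Pr_ge0. Qed.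
Lemma renew_ge0 s u n : 0 <= renew s u n. Proof. exact: Pr_ge0. Qed.

Lemma measurable_renew (I : pred nat) s u k : (forall j, (j < k)%N -> I j) ->
  measurable ([set w | rcd s k w /\ 0 < u + hinc s 0 k w] : set (@Om _ E I)).
Proof.
move=> kI; apply: mset_and; first exact: measurable_rcd.
apply: mset_lt => //; apply: measurable_funD => //; apply: measurable_hinc => j jk.
by apply: kI.
Qed.

Lemma surv_le s u m n : (m <= n)%N -> surv s u n <= surv s u m.
Proof.
move=> mn; apply: le_Pr; [exact: measurable_stay|exact: measurable_stay|].
by move=> w h j jm; apply: h; lia.
Qed.

Lemma surv0_le s m n : (m <= n)%N -> surv0 s n <= surv0 s m.
Proof.
move=> mn; apply: le_Pr; [exact: measurable_pos|exact: measurable_pos|].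
by move=> w h j jm; apply: h; lia.
Qed.

Lemma surv0_0 s : surv0 s 0 = 1.
Proof.
rewrite /surv0 -[RHS](PrT mu); congr (Pr _); apply/seteqP; split => // w _ j; lia.
Qed.

(* Split at the last minimum of the walk. *)
Lemma surv_renewal s u n : 0 < u ->
  surv s u n <= \sum_(k < n.+1) renew s u k * surv0 s (n - k).
Proof.
move=> u0.
have E1 (k : nat) : (k <= n)%N -> renew s u k * surv0 s (n - k) =
    Pr ([set w | rcd s k w /\ 0 < u + hinc s 0 k w] `&` pos s k n).
  move=> kn; rewrite (Pr_indep mu_iid (I := fun j => (j < k)%N) (J := fun j => (k <= j)%N)).
  - by rewrite Pr_pos.
  - by move=> j /=; lia.
  - exact: measurable_renew.
  - by apply: measurable_pos => j /andP[].
under eq_bigr => k _ do rewrite (E1 _ (leq_ord k)).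
apply: (@Pr_le_sum _ _ _ _ _ _ (fun k => [set w | rcd s k w /\ 0 < u + hinc s 0 k w] `&` pos s k n)).
- exact: measurable_stay.
- move=> k kn; apply: measurableI; first exact: measurable_renew.
  exact: measurable_pos.
move=> w h; have [k kn [rk pk]] := last_argmin s n w.
exists k => //; split => //; split => //.
have [->|k0] := posnP k; first by rewrite hinc_nil addr0.
by apply: h; rewrite k0.
Qed.

Lemma argmin_split s n (k : nat) : (k <= n)%N ->
  surv0 (~~ s) k * surv0 s (n - k) = Pr (rcd s k `&` pos s k n).
Proof.
move=> kn; rewrite (Pr_indep mu_iid (I := fun j => (j < k)%N) (J := fun j => (k <= j)%N)).
- by rewrite Pr_pos// Pr_rcd.
- by move=> j /=; lia.
- exact: measurable_rcd.
- by apply: measurable_pos => j /andP[].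
Qed.

(* The last minimum over [0, n] is attained at exactly one time. *)
Lemma argmin_sum s n : \sum_(k < n.+1) surv0 (~~ s) k * surv0 s (n - k) <= 1.
Proof.
under eq_bigr => k _ do rewrite (argmin_split _ (leq_ord k)).
rewrite -(PrT mu); apply: (@Pr_disjoint_sum _ _ _ _ _ _ (fun k => rcd s k `&` pos s k n)) => //.
- move=> k _; apply: measurableI; [exact: measurable_rcd|exact: measurable_pos].
- move=> j k w /andP[jk kn] [_ pj] [rk _]; apply: (argmin_unique _ pj rk).
  by rewrite jk -ltnS.
Qed.

End fluctuation.

(** * Convolutions of nonnegative sequences *)

Section convolution.
Variable R : realFieldType.
Implicit Types a b U W : nat -> R.

Lemma sum_shift (f : nat -> R) k N : (k <= N)%N ->
  \sum_(m < N) (if (k <= m)%N then f (m - k)%N else 0) = \sum_(j < N - k) f j.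
Proof.
move=> kN; rewrite -(big_mkord predT (fun m => if (k <= m)%N then f (m - k)%N else 0)).
rewrite (big_cat_nat (leq0n k) kN)/= [X in X + _]big_nat_cond big1 ?add0r; last first.
  by move=> m; rewrite andbT => mk; rewrite ifF//; lia.
rewrite -{1}[k]add0n big_addn big_mkord; apply: eq_bigr => j _.
by rewrite leq_addl addnK.
Qed.

Lemma sum_widen (f : nat -> R) n N : (n <= N)%N ->
  \sum_(m < n) f m = \sum_(m < N) (if (m < n)%N then f m else 0).
Proof. by move=> nN; rewrite -big_mkcond/= (big_ord_widen N f nN). Qed.

Lemma conv_sum U a N :
  \sum_(m < N) \sum_(k < m.+1) U k * a (m - k)%N =
  \sum_(k < N) U k * \sum_(j < N - k) a j.
Proof.
transitivity (\sum_(m < N) \sum_(k < N) (if (k <= m)%N then U k * a (m - k)%N else 0)).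
  apply: eq_bigr => m _; exact: (sum_widen (fun k => U k * a (m - k)%N)).
rewrite exchange_big/=; apply: eq_bigr => k _.
rewrite -(sum_shift a (ltnW (ltn_ord k))) mulr_sumr; apply: eq_bigr => m _.
by case: ifP => //; rewrite mulr0.
Qed.

Lemma sum_le_sum (f : nat -> R) m n : (forall k, 0 <= f k) -> (m <= n)%N ->
  \sum_(k < m) f k <= \sum_(k < n) f k.
Proof.
move=> f0 mn; rewrite (sum_widen f mn); apply: ler_sum => k _.
by case: ifP.
Qed.

Lemma conv_sum_le U a N : (forall k, 0 <= U k) -> (forall k, 0 <= a k) ->
  \sum_(m < N) \sum_(k < m.+1) U k * a (m - k)%N <=
  (\sum_(k < N) U k) * (\sum_(k < N) a k).
Proof.
move=> U0 a0; rewrite conv_sum mulr_suml; apply: ler_sum => k _.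
by rewrite ler_wpM2l// sum_le_sum// leq_subr.
Qed.

(** Two indices at most [n] have sum at most [2 n], so every term of the product of partial sums
    occurs in the convolution up to [2 n]. *)
Lemma conv_sum_ge U a n : (forall k, 0 <= U k) -> (forall k, 0 <= a k) ->
  (\sum_(k < n.+1) U k) * (\sum_(k < n.+1) a k) <=
  \sum_(m < n.*2.+1) \sum_(k < m.+1) U k * a (m - k)%N.
Proof.
move=> U0 a0; rewrite conv_sum mulr_suml.
apply: (@le_trans _ _ (\sum_(k < n.+1) U k * \sum_(j < n.*2.+1 - k) a j)).
  apply: ler_sum => k _; rewrite ler_wpM2l// sum_le_sum//.
  by have := ltn_ord k; lia.
apply: (@sum_le_sum (fun k => U k * \sum_(j < n.*2.+1 - k) a j)); last lia.
by move=> k; rewrite mulr_ge0// sumr_ge0.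
Qed.

(** After exchanging sums with [i] and [j] fixed, the sum over [k] is the convolution of [a] and [b]
    at [n - i - j], or empty; either way it is at most one. *)
Lemma conv4_le U W a b n :
  (forall k, 0 <= U k) -> (forall k, 0 <= W k) ->
  (forall k, 0 <= a k) -> (forall k, 0 <= b k) ->
  (forall m, \sum_(k < m.+1) a k * b (m - k)%N <= 1) ->
  \sum_(k < n.+1) (\sum_(i < k.+1) U i * a (k - i)%N) *
                  (\sum_(j < (n - k).+1) W j * b (n - k - j)%N) <=
  (\sum_(k < n.+1) U k) * (\sum_(k < n.+1) W k).
Proof.
move=> U0 W0 a0 b0 ab1.
pose F i j k := if (i <= k)%N && (j <= n - k)%N then a (k - i)%N * b (n - k - j)%N else 0.
have inner i j : (i <= n)%N -> (j <= n)%N -> \sum_(k < n.+1) F i j k <= 1.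
  move=> ile jle.
  pose G l := if (l + i + j <= n)%N then a l * b (n - i - j - l)%N else 0.
  have -> : \sum_(k < n.+1) F i j k = \sum_(l < n.+1 - i) G l.
    rewrite -(sum_shift G (leqW ile)); apply: eq_bigr => k _; rewrite /F /G.
    case: leqP => //= ik; have := ltn_ord k; rewrite ltnS => kn.
    have -> : (k - i + i + j <= n)%N = (j <= n - k)%N by lia.
    by case: leqP => // jk; congr (_ * b _); lia.
  have [ijn|ijn] := leqP (i + j) n; last first.
    rewrite big1 ?ler01// => l _; rewrite /G ifF//; lia.
  apply: le_trans (ab1 (n - i - j)%N).
  rewrite (@sum_widen (fun k => a k * b (n - i - j - k)%N) _ (n.+1 - i)%N); last lia.
  apply: ler_sum => l _; rewrite /G.
  by have -> : (l + i + j <= n)%N = (l < (n - i - j).+1)%N by lia.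
have E1 k : (k <= n)%N -> (\sum_(i < k.+1) U i * a (k - i)%N) *
    (\sum_(j < (n - k).+1) W j * b (n - k - j)%N) =
    \sum_(i < n.+1) \sum_(j < n.+1) U i * W j * F i j k.
  move=> kn; rewrite (@sum_widen (fun i => U i * a (k - i)%N) _ n.+1)//.
  rewrite (@sum_widen (fun j => W j * b (n - k - j)%N) _ n.+1); last lia.
  rewrite mulr_suml; apply: eq_bigr => i _; rewrite mulr_sumr; apply: eq_bigr => j _.
  rewrite /F !ltnS; case: ifP => _ /=; last by rewrite mul0r mulr0.
  by case: ifP => _; rewrite ?mulr0//; ring.
under eq_bigr => k _ do rewrite (E1 _ (leq_ord k)).
rewrite exchange_big/= mulr_suml; apply: ler_sum => i _.
rewrite exchange_big/= mulr_sumr; apply: ler_sum => j _.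
rewrite -mulr_sumr ler_piMr ?mulr_ge0//.
by apply: inner; exact: leq_ord.
Qed.

End convolution.

(** * Survival probabilities and renewal sums *)

Section survival_bounds.
Variables (R : realType) (d : nat).
Local Notation E := ((d.+1).-tuple R).
Local Notation OmT := (@Om _ E predT).
Variables (mu : probability OmT R) (nu : probability E R).
Hypothesis mu_iid : iid_law mu nu.
Local Notation Pr := (Pr mu).
Local Notation surv := (surv mu).
Local Notation surv0 := (surv0 mu).

Definition renewal s u n : R := \sum_(k < n.+1) renew mu s u k.
Definition surv_sum s n : R := \sum_(k < n.+1) surv0 s k.

Lemma renewal_ge0 s u n : 0 <= renewal s u n.
Proof. by apply: sumr_ge0 => k _; exact: renew_ge0. Qed.

Lemma renewal_ge1 s u n : 0 < u -> 1 <= renewal s u n.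
Proof.
move=> u0; rewrite /renewal big_ord_recl/=.
have -> : renew mu s u 0 = 1.
  rewrite /renew -[RHS](PrT mu); congr (Pr _); apply/seteqP; split => // w _.
  by split; [move=> j; lia|rewrite hinc_nil addr0].
by rewrite lerDl sumr_ge0// => k _; exact: renew_ge0.
Qed.

Lemma renewal_le s u m n : (m <= n)%N -> renewal s u m <= renewal s u n.
Proof. by move=> mn; apply: sum_le_sum => // k; exact: renew_ge0. Qed.

Lemma surv_sum_ge1 s n : 1 <= surv_sum s n.
Proof.
rewrite /surv_sum big_ord_recl/= surv0_0 lerDl sumr_ge0// => k _; exact: surv0_ge0.
Qed.

Lemma surv_sum_le s m n : (m <= n)%N -> surv_sum s m <= surv_sum s n.
Proof. by move=> mn; apply: sum_le_sum => // k; exact: surv0_ge0. Qed.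

(** [surv] decreases in time, so [n.+1] times its last value is at most its sum, and the sum of the
    renewal convolutions is at most the product of the sums. *)
Lemma surv_renewal_le s u n : 0 < u ->
  n.+1%:R * surv s u n <= renewal s u n * surv_sum s n.
Proof.
move=> u0; apply: le_trans (conv_sum_le n.+1 (renew_ge0 mu s u) (surv0_ge0 mu s)).
apply: (@le_trans _ _ (\sum_(m < n.+1) surv s u m)).
  rewrite mulr_natl -[in leLHS](card_ord n.+1) -sumr_const; apply: ler_sum => m _.
  by apply: surv_le; exact: leq_ord.
by apply: ler_sum => m _; exact: (surv_renewal mu_iid).
Qed.

Lemma argmin_sum_sym s n : \sum_(k < n.+1) surv0 s k * surv0 (~~ s) (n - k) <= 1.
Proof. by rewrite -{1}[s]negbK; exact: (argmin_sum mu_iid). Qed.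

(** The product is at most the sum over m <= 2n of the convolutions at [m], each of which is at most
    one because the minimum over [0, m] has a single distinguished time. *)
Lemma surv_sum_prod s n : surv_sum s n * surv_sum (~~ s) n <= n.*2.+1%:R.
Proof.
apply: le_trans (conv_sum_ge n (surv0_ge0 mu s) (surv0_ge0 mu (~~ s))) _.
apply: (@le_trans _ _ (\sum_(m < n.*2.+1) (1:R))).
  by apply: ler_sum => m _; exact: argmin_sum_sym.
by rewrite sumr_const card_ord.
Qed.

Lemma surv_conv s u z n : 0 < u -> 0 < z ->
  \sum_(k < n.+1) surv s u k * surv (~~ s) z (n - k) <=
  renewal s u n * renewal (~~ s) z n.
Proof.
move=> u0 z0.
apply: le_trans (conv4_le n (renew_ge0 mu s u) (renew_ge0 mu (~~ s) z)
  (surv0_ge0 mu s) (surv0_ge0 mu (~~ s)) (argmin_sum_sym s)).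
apply: ler_sum => k _; apply: ler_pM; rewrite ?surv_ge0//; exact: (surv_renewal mu_iid).
Qed.

End survival_bounds.

(** * Chebyshev's inequality for bounded functions of the steps *)

Section chebyshev.
Context (R : realType) (dE : measure_display) (E : measurableType dE).
Local Notation OmT := (@Om _ E predT).
Variables (mu : probability OmT R) (nu : probability E R).
Hypothesis mu_iid : iid_law mu nu.
Local Notation Pr := (Pr mu).

Variables (Y : E -> R) (K v : R).
Hypotheses (mY : measurable_fun setT Y) (YK : forall e, `|Y e| <= K).
Hypothesis (Yv : (\int[mu]_w ((Y (w 0%N)) ^+ 2)%:E <= v%:E)%E).

Definition mean : R := \int[mu]_w Y (w 0%N).

Let mY0 (I : pred nat) k : I k -> measurable_fun setT (fun w : @Om _ E I => Y (w k)).
Proof. by move=> Ik; apply: measurableT_comp => //; exact: measurable_coord. Qed.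

Lemma bounded_integrable (f : OmT -> R) (C : R) : measurable_fun setT f ->
  (forall w, `|f w| <= C) -> mu.-integrable setT (EFin \o f).
Proof.
move=> mf fC; apply: (@le_integrable _ _ _ mu setT measurableT _ (cst C%:E)).
- exact/measurable_EFinP.
- by move=> w _ /=; rewrite lee_fin (le_trans (fC w))// ler_norm.
- by apply: finite_measure_integrable_cst.
Qed.

Lemma integral_cstr (r : R) : (\int[mu]_w r%:E = r%:E)%E.
Proof.
rewrite integral_cst// [X in (_ * X)%E](_ : _ = 1%E) ?mule1//.
exact: probability_setT.
Qed.

(** The cross term vanishes and the variance of [Y] is at most its second moment; [c] will be the
    deviation accumulated by the earlier steps. *)
Lemma integral_sqr_shift (c : R) :
  (\int[mu]_w ((c + (Y (w 0%N) - mean)) ^+ 2)%:E <= (c ^+ 2 + v)%:E)%E.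
Proof.
have iY : mu.-integrable setT (EFin \o (fun w => Y (w 0%N))).
  by apply: (@bounded_integrable _ K) => //; exact: mY0.
have iY2 : mu.-integrable setT (EFin \o (fun w => (Y (w 0%N)) ^+ 2)).
  apply: (@bounded_integrable _ (K ^+ 2)) => [|w].
    by apply: measurable_funX; exact: mY0.
  by rewrite normrX ler_sqr ?nnegrE// (le_trans _ (YK (w 0%N))).
have i1 : mu.-integrable setT (EFin \o (fun w => 2 * (c - mean) * Y (w 0%N))).
  apply: (@bounded_integrable _ (`|2 * (c - mean)| * K)) => [|w].
    by apply: measurable_funM => //; exact: mY0.
  by rewrite normrM ler_wpM2l.
have i0 : mu.-integrable setT (EFin \o (fun w => (c - mean) ^+ 2)).
  by apply: (@bounded_integrable _ `|(c - mean) ^+ 2|) => //.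
have i01 : mu.-integrable setT (EFin \o (fun w => (c - mean) ^+ 2 + 2 * (c - mean) * Y (w 0%N))).
  rewrite (_ : EFin \o _ = (EFin \o (fun w => (c - mean) ^+ 2)) \+ (EFin \o (fun w => 2 * (c - mean) * Y (w 0%N)))).
    exact: integrableD.
  by apply/funext => w.
have -> : (\int[mu]_w ((c + (Y (w 0%N) - mean)) ^+ 2)%:E =
   \int[mu]_w (((c - mean) ^+ 2 + 2 * (c - mean) * Y (w 0%N))%:E + ((Y (w 0%N)) ^+ 2)%:E))%E.
  by apply: eq_integral => w _; rewrite -EFinD; congr (_%:E); ring.
rewrite integralD//.
have -> : (\int[mu]_w ((c - mean) ^+ 2 + 2 * (c - mean) * Y (w 0%N))%:E =
   \int[mu]_w (((c - mean) ^+ 2)%:E + (2 * (c - mean) * Y (w 0%N))%:E))%E.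
  by apply: eq_integral => w _; rewrite -EFinD.
rewrite integralD//.
have -> : (\int[mu]_w (2 * (c - mean) * Y (w 0%N))%:E = (2 * (c - mean) * mean)%:E)%E.
  under eq_integral do rewrite EFinM.
  rewrite integralZl//.
  rewrite [X in (_ * X)%E](_ : _ = mean%:E) ?EFinM//.
  by rewrite /mean /Rintegral fineK//; exact: integrable_fin_num.
rewrite integral_cstr.
apply: (@le_trans _ _ (((c - mean) ^+ 2)%:E + (2 * (c - mean) * mean)%:E + v%:E)%E).
  by rewrite leeD2l.
by rewrite -!EFinD lee_fin; nra.
Qed.

Let dev n w := \sum_(0 <= k < n) (Y (w k) - mean).

Let mdev (I : pred nat) n : (forall k, (k < n)%N -> I k) ->
  measurable_fun setT (fun w : @Om _ E I => dev n w).
Proof.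
move=> nI; rewrite /dev.
have -> : (fun w : @Om _ E I => \sum_(0 <= k < n) (Y (w k) - mean)) =
    (fun w => \sum_(0 <= k < n) (if (k < n)%N then (Y (w k) - mean) else 0)).
  by apply/funext => w; apply: eq_big_nat => k /= ->.
apply: measurable_sum => k.
have [kn|_] := boolP (k < n)%N; last exact: measurable_cst.
by apply: measurable_funB => //; apply: mY0; exact: nI.
Qed.

(** Induction on [n]: decoupling freezes the deviation of the first [n] steps, and a shift brings
    the next step to index 0, where [integral_sqr_shift] applies. *)
Lemma integral_dev_sqr n : (\int[mu]_w ((dev n w) ^+ 2)%:E <= (n%:R * v)%:E)%E.
Proof.
have v0 : 0 <= v.
  rewrite -lee_fin; apply: le_trans Yv; apply: integral_ge0 => w _.
  by rewrite lee_fin sqr_ge0.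
elim: n => [|n IH].
  rewrite mul0r (eq_integral (cst 0%E)) ?integral0// => w _.
  by rewrite /dev big_geq// expr0n.
pose I : pred nat := fun k => (k < n)%N.
pose J : pred nat := fun k => (n <= k)%N.
pose f (p : @Om _ E I * @Om _ E J) : \bar R := ((dev n p.1 + (Y (p.2 n) - mean)) ^+ 2)%:E.
have mf : measurable_fun setT f.
  apply/measurable_EFinP; apply: measurable_funX; apply: measurable_funD.
    exact: (measurableT_comp (@mdev I n (fun k kn => kn)) measurable_fst).
  apply: measurable_funB => //.
  exact: (measurableT_comp (@mY0 J n (leqnn n)) measurable_snd).
have f0 x : (0 <= f x)%E by rewrite lee_fin sqr_ge0.
have -> : (\int[mu]_w ((dev n.+1 w) ^+ 2)%:E = \int[mu]_w f (w, w))%E.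
  by apply: eq_integral => w _; rewrite /dev big_nat_recr.
rewrite (decouple mu_iid _ mf f0); last by move=> k; rewrite /I /J; lia.
apply: (@le_trans _ _ (\int[mu]_w (((dev n w) ^+ 2)%:E + v%:E))%E).
  apply: ge0_le_integral => //.
  - by move=> w _; apply: integral_ge0.
  - by apply: (measurable_fun_decouple _ mf).
  - apply: emeasurable_funD => //; apply/measurable_EFinP; apply: measurable_funX.
    exact: mdev.
  move=> w _; rewrite -EFinD; apply: le_trans (integral_sqr_shift (dev n w)).
  pose g (w' : OmT) : \bar R := ((dev n w + (Y (w' 0%N) - mean)) ^+ 2)%:E.
  have mg : measurable_fun setT g.
    apply/measurable_EFinP; apply: measurable_funX; apply: measurable_funD => //.
    by apply: measurable_funB => //; exact: mY0.
  have g0 x : (0 <= g x)%E by rewrite lee_fin sqr_ge0.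
  rewrite -[X in (_ <= X)%E]/(\int[mu]_w' g w')%E -(integral_reind mu_iid (@addn_inj n) mg g0).
  rewrite le_eqVlt; apply/orP; left; apply/eqP; apply: eq_integral => w' _.
  by rewrite /g /f /reind addn0.
rewrite ge0_integralD//; last 2 first.
- by move=> w _; rewrite lee_fin sqr_ge0.
- by apply/measurable_EFinP; apply: measurable_funX; exact: mdev.
rewrite integral_cstr -natr1 mulrDl mul1r EFinD.
by rewrite leeD2r.
Qed.

Lemma chebyshev_iid n (s : R) : 0 < s ->
  Pr [set w | s <= `|\sum_(0 <= k < n) Y (w k) - n%:R * mean| ] <= n%:R * v / s ^+ 2.
Proof.
move=> s0.
have devE w : dev n w = \sum_(0 <= k < n) Y (w k) - n%:R * mean.
  by rewrite /dev sumrB sumr_const_nat subn0 mulr_natl.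
pose A : set OmT := [set w | s <= `|\sum_(0 <= k < n) Y (w k) - n%:R * mean| ].
have mA : measurable A.
  apply: mset_le => //; apply: measurableT_comp => //.
  have -> : (fun w : OmT => \sum_(0 <= k < n) Y (w k) - n%:R * mean) = (fun w => dev n w).
    by apply/funext => w; rewrite devE.
  exact: mdev.
rewrite ler_pdivlMr ?exprn_gt0// -lee_fin; apply: le_trans (integral_dev_sqr n).
rewrite EFinM -/A -Pr_fin//.
have -> : (mu A * (s ^+ 2)%:E = \int[mu]_w ((s ^+ 2)%:E * (\1_A w)%:E))%E.
  rewrite ge0_integralZl_EFin ?sqr_ge0//; last exact/measurable_EFinP.
  by rewrite integral_indic// setIT muleC.
apply: ge0_le_integral => //.
- by move=> w _; rewrite -EFinM lee_fin mulr_ge0 ?sqr_ge0.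
- by apply: emeasurable_funM => //; exact/measurable_EFinP.
- by apply/measurable_EFinP; apply: measurable_funX; exact: mdev.
move=> w _; rewrite -EFinM lee_fin indicE; case: (boolP (w \in A)) => [|_].
  rewrite inE /A /= mulr1 -devE => sd.
  by rewrite -[leRHS]real_normK ?num_real// ler_sqr ?nnegrE// ltW.
by rewrite mulr0 sqr_ge0.
Qed.

End chebyshev.

(** * Large deviations without localization *)

Section tail.
Variables (R : realType) (d : nat).
Local Notation E := ((d.+1).-tuple R).
Local Notation OmT := (@Om _ E predT).
Variables (mu : probability OmT R) (nu : probability E R).
Hypothesis mu_iid : iid_law mu nu.
Local Notation Pr := (Pr mu).

Definition tail (t : R) : R := Pr [set w | t < norm1 (w 0%N)].

Definition trunc (i : 'I_d.+1) (t : R) (e : E) : R := if norm1 e <= t then tnth e i else 0.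

Lemma tail_ge0 t : 0 <= tail t. Proof. exact: Pr_ge0. Qed.

Lemma measurable_jump (I : pred nat) k (t : R) : I k ->
  measurable ([set w | t < norm1 (w k)] : set (@Om _ E I)).
Proof. by move=> Ik; apply: mset_lt => //; exact: measurable_norm1. Qed.

Lemma measurable_nojump (I : pred nat) k (t : R) : I k ->
  measurable ([set w | norm1 (w k) <= t] : set (@Om _ E I)).
Proof. by move=> Ik; apply: mset_le => //; exact: measurable_norm1. Qed.

Lemma tail_le s t : s <= t -> tail t <= tail s.
Proof.
move=> st; apply: le_Pr; [exact: measurable_jump|exact: measurable_jump|].
by move=> w /=; exact: le_lt_trans.
Qed.

Lemma tail_le1 t : tail t <= 1.
Proof. by apply: Pr_le1; exact: measurable_jump. Qed.

Lemma Pr_jump k t : Pr [set w | t < norm1 (w k)] = tail t.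
Proof.
rewrite /tail -[RHS](Pr_reind mu_iid (@addn_inj k)); last exact: measurable_jump.
by congr (Pr _); apply/seteqP; split => w; rewrite /reind /= addn0.
Qed.

Lemma norm1_coord (e : E) i : `|tnth e i| <= norm1 e.
Proof. by rewrite /norm1 (bigD1 i)//= lerDl sumr_ge0. Qed.

Lemma norm1_ge0 (e : E) : 0 <= norm1 e.
Proof. by apply: sumr_ge0. Qed.

Lemma measurable_trunc i t : measurable_fun setT (trunc i t).
Proof.
have mn : measurable_fun setT (@norm1 R d).
  rewrite /norm1; apply: measurable_sum => j.
  by apply: measurableT_comp => //; exact: measurable_tnth.
rewrite /trunc; apply: measurable_fun_ifT => //; last exact: measurable_tnth.
exact: measurable_fun_ler.
Qed.

Lemma trunc_le i t e : 0 <= t -> `|trunc i t e| <= t.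
Proof.
move=> t0; rewrite /trunc; case: ifP => [et|_]; last by rewrite normr0.
exact: le_trans (norm1_coord e i) et.
Qed.

Definition passage_at k x : set (nat -> E) :=
  [set w | x <= ninc 0 k w /\ forall j, (j < k)%N -> ninc 0 j w < x].

Lemma first_passage m x w k : (k <= m)%N -> x <= ninc 0 k w ->
  exists2 k', (k' <= k)%N & passage_at k' x w.
Proof.
move=> km xk; pose p j := x <= ninc 0 j w.
have ex : exists j, p j by exists k.
case: (ex_minnP ex) => k' pk' mink'; exists k'; first exact: mink'.
split => // j jk'; rewrite ltNge; apply/negP => pj.
by have := mink' j pj; rewrite leqNgt jk'.
Qed.

Lemma passage_at_disjoint j k x w : (j < k)%N -> passage_at j x w -> passage_at k x w -> False.
Proof. by move=> jk [xj _] [_ /(_ j jk)]; rewrite ltNge xj. Qed.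

Lemma measurable_passage_at (I : pred nat) k x : (forall j, (j < k)%N -> I j) ->
  measurable (passage_at k x : set (@Om _ E I)).
Proof.
move=> kI; apply: mset_and; first by apply: mset_le => //; exact: measurable_ninc.
apply: mset_forall => j; apply: mset_imp => jk; apply: mset_lt => //.
by apply: measurable_ninc => i ij; apply: kI; lia.
Qed.

Definition exceed a b x : set (nat -> E) :=
  [set w | exists k, (a <= k <= b)%N /\ x <= ninc a k w].

Lemma measurable_exceed (I : pred nat) a b x : (forall j, (a <= j < b)%N -> I j) ->
  measurable (exceed a b x : set (@Om _ E I)).
Proof.
move=> kI; apply: mset_exists => k.
apply: mset_andp => kab.
by apply: mset_le => //; apply: measurable_ninc => j ij; apply: kI; lia.
Qed.

Lemma ninc_shift a b m (w : nat -> E) : ninc a b (reind (addn m) w) = ninc (m + a) (m + b) w.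
Proof. by rewrite /ninc; apply: eq_bigr => i _; rewrite inc_shift. Qed.

Lemma Pr_exceed a b x : (a <= b)%N -> Pr (exceed a b x) = Pr (exceed 0 (b - a) x).
Proof.
move=> ab; rewrite -[RHS](Pr_reind mu_iid (@addn_inj a)); last exact: measurable_exceed.
congr (Pr _); apply/seteqP; split => w [k [kab xk]].
  exists (k - a)%N; rewrite ninc_shift addn0 subnKC; last lia.
  by split => //; lia.
by exists (a + k)%N; move: xk; rewrite ninc_shift addn0; split => //; lia.
Qed.

Lemma Pr_ninc a b x : (a <= b)%N ->
  Pr [set w | x <= ninc a b w] = Pr [set w | x <= ninc 0 (b - a) w].
Proof.
move=> ab; rewrite -[RHS](Pr_reind mu_iid (@addn_inj a)); last first.
  by apply: mset_le => //; exact: measurable_ninc.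
by congr (Pr _); apply/seteqP; split => w; rewrite /= ninc_shift addn0 subnKC.
Qed.

Lemma exceed_le m n x : (m <= n)%N -> Pr (exceed 0 m x) <= Pr (exceed 0 n x).
Proof.
move=> mn; apply: le_Pr; [exact: measurable_exceed|exact: measurable_exceed|].
by move=> w [k [km xk]]; exists k; split => //; lia.
Qed.

(** * Excursions made of small jumps *)

Section chain.
Variables (s : bool) (u : R).

(** Positivity is required strictly before [k], so the step that reaches the level is free in the
    first coordinate; [th] bounds all jumps, that step included. *)
Definition excur m x th : set (nat -> E) :=
  [set w | exists k, (k <= m)%N /\ [/\ x <= ninc 0 k w,
    (forall j, (0 < j < k)%N -> 0 < u + hinc s 0 j w) &
    (forall j, (j < k)%N -> norm1 (w j) <= th)]].

Definition excur0 m x : set (nat -> E) :=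
  [set w | exists k, (k <= m)%N /\ (x <= ninc 0 k w /\
    (forall j, (0 < j < k)%N -> 0 < u + hinc s 0 j w))].

Lemma measurable_excur0 (I : pred nat) m x : (forall j, (j < m)%N -> I j) ->
  measurable (excur0 m x : set (@Om _ E I)).
Proof.
move=> mI; apply: mset_exists => k.
apply: mset_andp => km.
apply: mset_and.
  by apply: mset_le => //; apply: measurable_ninc => j ij; apply: mI; lia.
apply: mset_forall => j; apply: mset_imp => jk; apply: mset_lt => //.
by apply: measurable_funD => //; apply: measurable_hinc => i ij; apply: mI; lia.
Qed.

Let pre k x th : set (nat -> E) :=
  [set w | passage_at k x w /\ ((forall j, (0 < j < k)%N -> 0 < u + hinc s 0 j w) /\
    (forall j, (j < k)%N -> norm1 (w j) <= th))].

Let measurable_pre (I : pred nat) k x th : (forall j, (j < k)%N -> I j) ->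
  measurable (pre k x th : set (@Om _ E I)).
Proof.
move=> kI; apply: mset_and; first exact: measurable_passage_at.
apply: mset_and.
  apply: mset_forall => j; apply: mset_imp => jk; apply: mset_lt => //.
  by apply: measurable_funD => //; apply: measurable_hinc => i ij; apply: kI; lia.
apply: mset_forall => j; apply: mset_imp => jk; apply: measurable_nojump.
exact: kI.
Qed.

(** Stopping at the first passage preserves all constraints, and first passages at distinct times
    are disjoint events. *)
Let excurE m x th : excur m x th =
  [set w | exists k, (k <= m)%N /\ pre k x th w].
Proof.
apply/seteqP; split => w [k [km]].
  move=> [xk st nj]; have [k' k'k fpk'] := first_passage km xk.
  exists k'; split; first exact: leq_trans km.
  by split => //; split => j jk; [apply: st|apply: nj]; lia.
by move=> [[xk _] [st nj]]; exists k; split.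
Qed.

Lemma measurable_excur (I : pred nat) m x th : (forall j, (j < m)%N -> I j) ->
  measurable (excur m x th : set (@Om _ E I)).
Proof.
move=> mI; rewrite excurE; apply: mset_exists => k.
apply: mset_andp => km.
by apply: measurable_pre => j jk; apply: mI; lia.
Qed.

(* Strong Markov property at the first passage over level [x]: since jumps are
   at most [th], the overshoot is at most [th]. *)
Lemma excur_step m x eta th : 0 < x -> 0 <= eta -> 0 <= th ->
  Pr (excur m (x + eta + th) th) <= Pr (excur m x th) * Pr (exceed 0 m eta).
Proof.
move=> x0 eta0 th0.
pose B k := exceed k m eta.
apply: (@le_trans _ _ (\sum_(k < m.+1) Pr (pre k x th `&` B k))).
  apply: (@Pr_le_sum _ _ _ _ _ _ (fun k => pre k x th `&` B k)).
  - exact: measurable_excur.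
  - move=> k _; apply: measurableI; first exact: measurable_pre.
    exact: measurable_exceed.
  move=> w [k1 [k1m [xk1 st nj]]].
  have xk1' : x <= ninc 0 k1 w by apply: le_trans xk1; rewrite -addrA lerDl addr_ge0.
  have [k0 k01 fpk0] := first_passage k1m xk1'.
  exists k0; first lia.
  split.
    by split => //; split => j jk; [apply: st|apply: nj]; lia.
  exists k1; split; first lia.
  case: k0 k01 fpk0 => [|k0] k01 [xk0 fpk0].
    by move: xk0; rewrite ninc_nil leNgt x0.
  have := fpk0 k0 (ltnSn _); have := nj k0 k01.
  have : ninc 0 k0.+1 w <= ninc 0 k0 w + norm1 (w k0).
    by rewrite -ninc1; apply: ninc_triangle; lia.
  have : ninc 0 k1 w <= ninc 0 k0.+1 w + ninc k0.+1 k1 w.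
    by apply: ninc_triangle; lia.
  lra.
have E1 (k : 'I_m.+1) : Pr (pre k x th `&` B k) <= Pr (pre k x th) * Pr (exceed 0 m eta).
  rewrite (Pr_indep mu_iid (I := fun j => (j < k)%N) (J := fun j => (k <= j)%N)).
  - rewrite ler_wpM2l ?Pr_ge0// /B Pr_exceed ?leq_ord//.
    by apply: exceed_le; rewrite leq_subr.
  - by move=> j /=; lia.
  - exact: measurable_pre.
  - by apply: measurable_exceed => j /andP[].
apply: (@le_trans _ _ (\sum_(k < m.+1) Pr (pre k x th) * Pr (exceed 0 m eta))).
  by apply: ler_sum => k _; exact: E1.
rewrite -mulr_suml ler_wpM2r ?Pr_ge0//.
apply: (@Pr_disjoint_sum _ _ _ _ _ _ (fun k => pre k x th)).
- exact: measurable_excur.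
- by move=> k _; exact: measurable_pre.
- by move=> k km w pk; rewrite excurE; exists k.
- by move=> j k w /andP[jk _] [fj _] [fk _]; exact: (passage_at_disjoint jk fj fk).
Qed.

(** Each further [2 * eta] of distance, half of it progress and half overshoot, costs one factor
    [Pr (exceed 0 m eta)]. The positivity constraint is kept only up to the first level [eta]. *)
Lemma excur_chain m eta p : 0 < eta ->
  Pr (excur m (p.*2.+1%:R * eta) eta) <= Pr (excur0 m eta) * Pr (exceed 0 m eta) ^+ p.
Proof.
move=> eta0; elim: p => [|p IH].
  rewrite mul1r expr0 mulr1; apply: le_Pr; [exact: measurable_excur|exact: measurable_excur0|].
  by move=> w [k [km [xk st _]]]; exists k.
rewrite exprSr mulrA; apply: le_trans (ler_wpM2r (Pr_ge0 _ _) IH).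
have -> : p.+1.*2.+1%:R * eta = p.*2.+1%:R * eta + eta + eta.
  by rewrite doubleS -!natr1; ring.
by apply: excur_step; rewrite ?mulr_gt0// ltW.
Qed.

End chain.

(** * Large deviations from truncated moments *)

Section moment_hypotheses.
Variables (cF C3 C5 : R).
Hypotheses (cF_ge1 : 1 <= cF)
  (tail_gt0 : forall t, 0 < tail t)
  (tail_double : forall t, 1 <= t -> tail t <= cF * tail (2 * t))
  (C3_gt0 : 0 < C3) (C5_gt0 : 0 < C5)
  (trunc_sqr : forall i t, 1 <= t ->
     (\int[mu]_w ((trunc i t (w 0%N)) ^+ 2)%:E <= (C3 * t ^+ 2 * tail t)%:E)%E)
  (trunc_mean : forall i t, 1 <= t -> `|mean mu (trunc i t)| <= C5 * t * tail t).

Let D : R := d.+1%:R.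

Lemma truncated_deviation n t x : 1 <= t -> 0 < x ->
  Pr [set w | exists i : 'I_d.+1,
      x <= `|\sum_(0 <= k < n) trunc i t (w k) - n%:R * mean mu (trunc i t)|] <=
  D * (n%:R * (C3 * t ^+ 2 * tail t) / x ^+ 2).
Proof.
move=> t1 x0.
have t0 : 0 <= t by apply: le_trans t1.
have mB (i : 'I_d.+1) : measurable ([set w |
    x <= `|\sum_(0 <= k < n) trunc i t (w k) - n%:R * mean mu (trunc i t)|] : set OmT).
  apply: mset_le => //; apply: measurableT_comp => //; apply: measurable_funB => //.
  apply: measurable_sum => k; apply: (measurableT_comp (measurable_trunc i t)).
  exact: measurable_coord.
apply: (@le_trans _ _ (\sum_(i < d.+1) Pr [set w |
    x <= `|\sum_(0 <= k < n) trunc i t (w k) - n%:R * mean mu (trunc i t)|])).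
  apply: Pr_le_sum_fin => //.
  rewrite (_ : [set w | _] = \bigcup_(i in [set: 'I_d.+1]) [set w |
    x <= `|\sum_(0 <= k < n) trunc i t (w k) - n%:R * mean mu (trunc i t)|]).
    by apply: fin_bigcup_measurable => //; exact: finite_finset.
  by apply/seteqP; split => w [i]; [exists i|exists i].
apply: (@le_trans _ _ (\sum_(i < d.+1) (n%:R * (C3 * t ^+ 2 * tail t) / x ^+ 2))).
  apply: ler_sum => i _; apply: (chebyshev_iid mu_iid (K := t)) => //.
  - exact: measurable_trunc.
  - by move=> e; exact: trunc_le.
  - exact: trunc_sqr.
by rewrite sumr_const card_ord -[leLHS]mulr_natl.
Qed.

Lemma Pr_exists_jump n t :
  Pr [set w | exists k, (k < n)%N /\ t < norm1 (w k)] <= n%:R * tail t.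
Proof.
apply: (@le_trans _ _ (\sum_(k < n) Pr [set w | t < norm1 (w k)])).
  apply: (@Pr_le_sum _ _ _ _ _ _ (fun k => [set w | t < norm1 (w k)])).
  - apply: mset_exists => k; apply: mset_and; first exact: mset_cst.
    exact: measurable_jump.
  - by move=> k _; exact: measurable_jump.
  - by move=> w [k [kn tk]]; exists k.
under eq_bigr => k _ do rewrite Pr_jump.
by rewrite sumr_const card_ord mulr_natl.
Qed.

Lemma sum_trunc_inc n i t w : (forall k, (k < n)%N -> norm1 (w k) <= t) ->
  \sum_(0 <= k < n) trunc i t (w k) = inc i 0 n w.
Proof. by move=> h; apply: eq_big_nat => k /= kn; rewrite /trunc h. Qed.

(** If [n * tail s] is not small, the constant makes the bound trivial. Otherwise the truncated
    means add up to at most [s / (2 * D)] per coordinate, and reaching [s] takes either a jump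
    beyond [s] or a deviation of [s / (2 * D)] in some truncated coordinate. *)
Lemma ninc_tail_le : exists2 C, 0 < C & forall n s, 1 <= s ->
  Pr [set w | s <= ninc 0 n w] <= C * (n%:R * tail s).
Proof.
have D0 : 0 < D by rewrite ltr0n.
exists (2 * D * C5 + (1 + D * (C3 * (2 * D) ^+ 2))).
  by rewrite addr_gt0// ?mulr_gt0// addr_gt0// !mulr_gt0// exprn_gt0// mulr_gt0.
move=> n s s1; have s0 : 0 < s by apply: lt_le_trans s1.
have T0 := tail_gt0 s.
have nT0 : 0 <= n%:R * tail s by rewrite mulr_ge0// ltW.
have mS : measurable ([set w | s <= ninc 0 n w] : set OmT).
  by apply: mset_le => //; exact: measurable_ninc.
have [big|small] := leP 1 (2 * D * C5 * (n%:R * tail s)).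
  apply: le_trans (Pr_le1 mu mS) _; rewrite mulrDl; apply: le_trans big _.
  rewrite lerDl mulr_ge0// addr_ge0// mulr_ge0 ?(ltW D0)// mulr_ge0 ?(ltW C3_gt0)//.
  by rewrite exprn_ge0// mulr_ge0// ltW.
have x0 : 0 < s / (2 * D) by rewrite divr_gt0// mulr_gt0.
apply: (@le_trans _ _ (n%:R * tail s + D * (n%:R * (C3 * s ^+ 2 * tail s) / (s / (2 * D)) ^+ 2))).
  apply: le_trans (lerD (Pr_exists_jump n s) (truncated_deviation n s1 x0)).
  apply: Pr_le2 => //.
  - apply: mset_exists => k; apply: mset_and; first exact: mset_cst.
    exact: measurable_jump.
  - rewrite (_ : [set w | _] = \bigcup_(i in [set: 'I_d.+1]) [set w | s / (2 * D) <=
       `|\sum_(0 <= k < n) trunc i s (w k) - n%:R * mean mu (trunc i s)|]).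
      apply: fin_bigcup_measurable => [|i _]; first exact: finite_finset.
      apply: mset_le => //; apply: measurableT_comp => //; apply: measurable_funB => //.
      apply: measurable_sum => k; apply: (measurableT_comp (measurable_trunc i s)).
      exact: measurable_coord.
    by apply/seteqP; split => w [i]; [exists i|exists i].
  move=> w /= sw; have [|nj] := pselect (exists k, (k < n)%N /\ s < norm1 (w k)); first by left.
  right; apply: contrapT => ni.
  have nj' k : (k < n)%N -> norm1 (w k) <= s.
    by move=> kn; rewrite leNgt; apply/negP => sk; apply: nj; exists k.
  have : ninc 0 n w < \sum_(i < d.+1) (s / D).
    apply: ltr_sum => [|i _]; first by apply/hasP; exists ord0; rewrite ?mem_index_enum.
    have : `|inc i 0 n w - n%:R * mean mu (trunc i s)| < s / (2 * D).
      rewrite ltNge; apply/negP => h; apply: ni; exists i.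
      by rewrite (sum_trunc_inc _ nj').
    have : `|n%:R * mean mu (trunc i s)| <= s / (2 * D).
      rewrite normrM normr_nat.
      apply: (@le_trans _ _ (n%:R * (C5 * s * tail s))).
        by rewrite ler_wpM2l// trunc_mean.
      rewrite ler_pdivlMr ?mulr_gt0//; nra.
    have := ler_normD (inc i 0 n w - n%:R * mean mu (trunc i s)) (n%:R * mean mu (trunc i s)).
    rewrite subrK.
    have -> : s / D = s / (2 * D) + s / (2 * D) by field; rewrite gt_eqF.
    move: (s / (2 * D)) => y h1 h2 h3.
    by apply: le_lt_trans h1 _; rewrite ltr_leD.
  rewrite sumr_const card_ord -mulr_natr divfK ?gt_eqF// => /lt_le_trans /(_ sw).
  by rewrite ltxx.
apply: (@le_trans _ _ ((1 + D * (C3 * (2 * D) ^+ 2)) * (n%:R * tail s))).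
  rewrite le_eqVlt; apply/orP; left; apply/eqP.
  by field; rewrite !gt_eqF.
by rewrite ler_wpM2r// lerDr !mulr_ge0// ltW.
Qed.

(** Ottaviani's argument: if [n * tail (s / 2)] is small, then after the first passage over [s] the
    remaining increment stays below [s / 2] with probability at least one half, so the endpoint is
    beyond [s / 2]. The constant [(tail 2)^-1] covers s < 2, where [s / 2] may drop below 1. *)
Lemma exceed_tail_le : exists2 C, 0 < C & forall n s, 1 <= s ->
  Pr (exceed 0 n s) <= C * (n%:R * tail s).
Proof.
have [C C0 HC] := ninc_tail_le.
exists ((tail 2)^-1 + 2 * C * cF).
  by rewrite addr_gt0 ?invr_gt0// !mulr_gt0// (lt_le_trans ltr01).
move=> n s s1; have s0 : 0 < s by apply: lt_le_trans s1.
have T0 := tail_gt0 s.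
have nT0 : 0 <= n%:R * tail s by rewrite mulr_ge0// ltW.
have cF0 : 0 < cF by apply: lt_le_trans cF_ge1.
have C'0 : 0 <= 2 * C * cF by rewrite !mulr_ge0// ltW.
rewrite mulrDl.
have mE : measurable (exceed 0 n s : set OmT) by exact: measurable_exceed.
have [->|n0] := posnP n.
  rewrite mul0r !mulr0 addr0 (_ : exceed 0 0 s = set0) ?Pr0//.
  apply/seteqP; split => // w [[|k] [//= _]].
  by rewrite ninc_nil leNgt s0.
have [s2|s2] := ltP s 2.
  apply: le_trans (Pr_le1 mu mE) _.
  apply: ler_wpDr; first exact: mulr_ge0.
  have T20 := tail_gt0 2.
  rewrite ler_pdivlMl// mulr1; apply: (@le_trans _ _ (tail s)); first exact: tail_le (ltW s2).
  by rewrite ler_peMl ?(ltW T0)// ler1n.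
apply: (@le_trans _ _ (2 * C * cF * (n%:R * tail s))); last first.
  by apply: ler_wpDl => //; rewrite mulr_ge0// invr_ge0 ltW.
have h1 : 1 <= s / 2 by rewrite ler_pdivlMr// mul1r.
have Td : tail (s / 2) <= cF * tail s.
  by apply: le_trans (tail_double h1) _; rewrite mulrC mulrCA divff ?mulr1// mulrC.
have [big|small] := leP (1 / 2) (C * (n%:R * tail (s / 2))).
  apply: le_trans (Pr_le1 mu mE) _.
  have : C * (n%:R * tail (s / 2)) <= C * (n%:R * (cF * tail s)).
    by rewrite ler_pM2l// ler_wpM2l.
  lra.
pose B k : set (nat -> E) := [set w | ~ (s / 2 <= ninc k n w)].
have mB (I : pred nat) k : (forall j, (k <= j < n)%N -> I j) -> measurable (B k : set (@Om _ E I)).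
  move=> kI; apply: mset_not; apply: mset_le => //; exact: measurable_ninc.
have PB k : (k <= n)%N -> 1 / 2 <= Pr (B k).
  move=> kn; rewrite /B (_ : [set w | _] = ~` [set w | s / 2 <= ninc k n w])//.
  rewrite PrC; last by apply: mset_le => //; exact: measurable_ninc.
  rewrite Pr_ninc//; have := HC (n - k)%N _ h1.
  have : C * ((n - k)%:R * tail (s / 2)) <= C * (n%:R * tail (s / 2)).
    by rewrite ler_pM2l// ler_pM2r// ler_nat leq_subr.
  lra.
have step1 : Pr (exceed 0 n s) <= \sum_(k < n.+1) Pr (passage_at k s).
  apply: (@Pr_le_sum _ _ _ _ _ _ (fun k => passage_at k s)) => // [k _|w [k [kn sk]]].
    exact: measurable_passage_at.
  have [k' k'k fk] := first_passage kn sk; exists k' => //.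
  by rewrite ltnS (leq_trans k'k).
have step2 : \sum_(k < n.+1) Pr (passage_at k s `&` B k) <= Pr [set w | s / 2 <= ninc 0 n w].
  apply: (@Pr_disjoint_sum _ _ _ _ _ _ (fun k => passage_at k s `&` B k)).
  - by apply: mset_le => //; exact: measurable_ninc.
  - by move=> k _; apply: measurableI; [exact: measurable_passage_at|exact: mB].
  - move=> k kn w [[sk _] /negP]; rewrite -ltNge /= => Bk.
    have : ninc 0 k w <= ninc 0 n w + ninc k n w.
      rewrite -big_split; apply: ler_sum => i _ /=.
      rewrite (@inc_cat _ _ i 0 k n w) ?leq0n//.
      have := ler_normB (inc i 0 k w + inc i k n w) (inc i k n w).
      by rewrite addrK.
    lra.
  - by move=> j k w /andP[jk _] [fj _] [fk _]; exact: (passage_at_disjoint jk fj fk).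
have step3 : \sum_(k < n.+1) Pr (passage_at k s) <= 2 * \sum_(k < n.+1) Pr (passage_at k s `&` B k).
  rewrite mulr_sumr; apply: ler_sum => k _.
  rewrite [X in _ <= _ * X](Pr_indep mu_iid (I := fun j => (j < k)%N) (J := fun j => (k <= j)%N)).
  - rewrite mulrCA -[leLHS]mulr1 ler_wpM2l ?Pr_ge0//.
    by have := PB k (leq_ord k); lra.
  - by move=> j; rewrite -ltnNge.
  - exact: measurable_passage_at.
  - by apply: mB => j /andP[].
have := HC n _ h1.
have : C * (n%:R * tail (s / 2)) <= C * (n%:R * (cF * tail s)).
  by rewrite ler_pM2l// ler_wpM2l.
lra.
Qed.

End moment_hypotheses.

End tail.

(** From 1 - t <= exp(-t) and x ^ k / k! <= exp(x). The exponent is [n.-1] because one step is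
    exempt from the absence of jumps, and the power of 2 pays for replacing [n] by [n.-1]. *)
Lemma geometric_decay (R : realType) (t : R) n k : 0 <= t <= 1 -> (0 < n)%N ->
  (1 - t) ^+ n.-1 * (n%:R * t) ^+ k.+1 <= 2 ^+ k.+1 * (k.+1)`!%:R.
Proof.
move=> /andP[t0 t1]; case: n => // m _ /=.
have k0 : (0 : R) < (k.+1)`!%:R by rewrite ltr0n fact_gt0.
have h2 : (0 : R) <= 2 ^+ k.+1 by rewrite exprn_ge0.
have [->|m0] := posnP m.
  rewrite expr0 !mul1r; apply: (@le_trans _ _ 1); first by rewrite exprn_ile1.
  by rewrite -[leLHS]mulr1 ler_pM// ?exprn_ege1 ?ler1n ?fact_gt0.
have mt0 : 0 <= m%:R * t by rewrite mulr_ge0.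
have le1 : (1 - t) ^+ m <= expR (- (m%:R * t)).
  rewrite -mulrN expRM_natl; apply: lerXn2r; rewrite ?nnegrE ?subr_ge0 ?expR_ge0//.
  exact: expR_ge1Dx.
have le2 : (m.+1%:R * t) ^+ k.+1 <= 2 ^+ k.+1 * (m%:R * t) ^+ k.+1.
  rewrite -exprMn; apply: lerXn2r; rewrite ?nnegrE ?mulr_ge0//.
  rewrite mulrA ler_wpM2r// -natrM ler_nat mul2n -addnn -addn1 leq_add2l//.
have le3 := expR_ge1Dxn k mt0.
have le4 : (m%:R * t) ^+ k.+1 <= expR (m%:R * t) * (k.+1)`!%:R.
  by rewrite -ler_pdivrMr//; apply: le_trans le3; rewrite lerDr.
apply: (@le_trans _ _ (expR (- (m%:R * t)) * (2 ^+ k.+1 * (expR (m%:R * t) * (k.+1)`!%:R)))).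
  apply: ler_pM => //; rewrite ?exprn_ge0 ?subr_ge0 ?mulr_ge0//.
  by apply: le_trans le2 _; rewrite ler_wpM2l.
have -> : expR (- (m%:R * t)) * (2 ^+ k.+1 * (expR (m%:R * t) * (k.+1)`!%:R)) =
   expR (- (m%:R * t)) * expR (m%:R * t) * (2 ^+ k.+1 * (k.+1)`!%:R) by ring.
by rewrite -expRD addNr expR0 mul1r.
Qed.

(** * Local bounds *)

Section local.
Variables (R : realType) (d : nat).
Local Notation E := ((d.+1).-tuple R).
Local Notation OmT := (@Om _ E predT).
Variables (mu : probability OmT R) (nu : probability E R).
Hypothesis mu_iid : iid_law mu nu.
Local Notation Pr := (Pr mu).
Local Notation tail := (tail mu).

Definition box (z : 'I_d.+1 -> R) (a b : nat) : set (nat -> E) :=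
  [set w | forall i, z i <= inc i a b w < z i + 1].

Lemma measurable_box (I : pred nat) z a b : (forall j, (a <= j < b)%N -> I j) ->
  measurable (box z a b : set (@Om _ E I)).
Proof.
move=> abI; apply: mset_forall_fin => i.
rewrite (_ : (fun _ => _) = [set w | z i <= inc i a b w] `&` [set w | inc i a b w < z i + 1]).
  by apply: measurableI; [apply: mset_le|apply: mset_lt] => //; exact: measurable_inc.
by apply/seteqP; split => w /andP.
Qed.

Lemma Pr_box z a b : (a <= b)%N -> Pr (box z a b) = Pr (box z 0 (b - a)).
Proof.
move=> ab; rewrite -[RHS](Pr_reind mu_iid (@addn_inj a)); last exact: measurable_box.
by congr (Pr _); apply/seteqP; split => w h i; have := h i;
  rewrite inc_shift addn0 subnKC.
Qed.

(** Given the steps outside [a, b), the box for the whole increment becomes a box for the increment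
    over [a, b) with a frozen corner, so a bound uniform in the corner suffices. *)
Lemma local_split a b n (A : set (@Om _ E (fun k => ~~ (a <= k < b)%N)))
    (G : set (@Om _ E (fun k => (a <= k < b)%N))) (B : set OmT) v q :
  (a <= b <= n)%N -> measurable A -> measurable G -> measurable B ->
  (forall z, Pr [set w | G w /\ box z a b w] <= q) ->
  (forall w, B w -> [/\ A w, G w & box v 0 n w]) ->
  Pr B <= Pr A * q.
Proof.
move=> /andP[ab bn] mA mG mB Gq BAG.
pose I : pred nat := fun k => ~~ (a <= k < b)%N.
pose J : pred nat := fun k => (a <= k < b)%N.
pose C : set (@Om _ E I * @Om _ E J) := [set p | G p.2 /\
  forall i, v i <= inc i 0 a p.1 + inc i a b p.2 + inc i b n p.1 < v i + 1].
have mf1 i c e : (forall k, (c <= k < e)%N -> I k) ->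
    measurable_fun setT (fun p : @Om _ E I * @Om _ E J => inc i c e p.1).
  by move=> ceI; apply: (measurableT_comp (measurable_inc i ceI) measurable_fst).
have mf2 i : measurable_fun setT (fun p : @Om _ E I * @Om _ E J => inc i a b p.2).
  exact: (measurableT_comp (@measurable_inc R d J i a b (fun _ h => h)) measurable_snd).
have mC : measurable C.
  apply: mset_and.
    by rewrite -[X in measurable X]setTI; apply: (@measurable_snd _ _ (@Om _ E I) (@Om _ E J)).
  apply: mset_forall_fin => i.
  have mm : measurable_fun setT (fun p : @Om _ E I * @Om _ E J =>
      inc i 0 a p.1 + inc i a b p.2 + inc i b n p.1).
    apply: measurable_funD; last by apply: mf1 => k; rewrite /I; lia.
    by apply: measurable_funD => //; apply: mf1 => k; rewrite /I; lia.
  rewrite (_ : (fun _ => _) =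
    [set p : @Om _ E I * @Om _ E J | v i <= inc i 0 a p.1 + inc i a b p.2 + inc i b n p.1] `&`
    [set p | inc i 0 a p.1 + inc i a b p.2 + inc i b n p.1 < v i + 1]).
    by apply: measurableI; [apply: mset_le|apply: mset_lt].
  by apply/seteqP; split => w /andP.
apply: (Pr_decouple_le mu_iid (I := I) (J := J) (A := A) (C := C)) => //.
- move=> w Bw; have [Aw Gw bw] := BAG w Bw; split => //; split => // i /=.
  have := bw i; rewrite (@inc_cat _ _ i 0 a n w) ?(leq_trans ab)//.
  by rewrite (@inc_cat _ _ i a b n w) ?ab// addrA.
- move=> w Aw; apply: le_trans (Gq (fun i => v i - inc i 0 a w - inc i b n w)).
  have -> : [set w' | C (w, w')] =
     [set w' | G w' /\ box (fun i => v i - inc i 0 a w - inc i b n w) a b w'].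
    by apply/seteqP; split => w' [Gw' h]; split => // i; have := h i; rewrite /=; lra.
  by [].
Qed.

Lemma Pr_nojump_except n k t : (k < n)%N ->
  Pr [set w | forall i, (i < n)%N -> i != k -> norm1 (w i) <= t] = (1 - tail t) ^+ n.-1.
Proof.
move=> kn.
pose A i : set E := if i == k then setT else [set e | norm1 e <= t].
have mn : measurable [set e : E | norm1 e <= t].
  apply: mset_le => //; rewrite /norm1; apply: measurable_sum => j.
  by apply: measurableT_comp => //; exact: measurable_tnth.
have nuE : fine (nu [set e : E | norm1 e <= t]) = 1 - tail t.
  have h : Pr (cylinder predT 1 (fun=> [set e : E | norm1 e <= t])) = fine (nu [set e : E | norm1 e <= t]).
    by rewrite -[Pr _]/(fine _) mu_iid//= big_ord_recl big_ord0 mulr1.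
  rewrite -h -PrC; last exact: measurable_jump.
  congr (Pr _); apply/seteqP; split => w /=.
    by move=> /(_ 0%N isT isT) /=; rewrite leNgt => /negP.
  by move=> /negP; rewrite -leNgt => wt [|//] _ _.
rewrite (_ : [set w | _] = cylinder predT n A); last first.
  apply/seteqP; split => w h i ni.
    by rewrite /A => _; case: eqP => [//|/eqP ik]; exact: h.
  by move=> ik; have := h i ni isT; rewrite /A (negbTE ik).
rewrite -[Pr _]/(fine _) mu_iid; last by move=> i; rewrite /A; case: eqP.
rewrite /= (bigD1 (Ordinal kn))//= {1}/A eqxx probability_setT mul1r.
under eq_bigr => i ik.
  rewrite /A ifN ?nuE; last by move: ik; rewrite -val_eqE.
  over.
by rewrite prodr_const cardC1 card_ord.
Qed.

(** * Concentration in unit boxes *)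

Section concentration.
Variables (cF C4 : R) (M : nat).
Hypotheses (cF_ge1 : 1 <= cF) (M_gt0 : (0 < M)%N)
  (tail_gt0 : forall t, 0 < tail t)
  (tail_double : forall t, 1 <= t -> tail t <= cF * tail (2 * t))
  (tail_half : forall t, 1 <= t -> tail (2 ^+ M * t) <= tail t / 2)
  (C4_gt0 : 0 < C4)
  (tail_loc : forall t z, 1 <= t ->
     Pr [set w | t < norm1 (w 0%N) /\ box z 0 1 w] <= C4 * (tail t / t ^+ d.+1)).

Local Notation D := d.+1.

Lemma tail_loc_at k t z : 1 <= t ->
  Pr [set w | t < norm1 (w k) /\ box z k k.+1 w] <= C4 * (tail t / t ^+ D).
Proof.
move=> t1; apply: le_trans (tail_loc z t1).
rewrite -[leRHS](Pr_reind mu_iid (@addn_inj k)); last first.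
  by apply: mset_and; [exact: measurable_jump|exact: measurable_box].
rewrite le_eqVlt; apply/orP; left; apply/eqP; congr (Pr _).
apply/seteqP; split => w; rewrite /reind /= => -[wt bw]; split.
- by rewrite addn0.
- by move=> i; rewrite inc_shift addn0 addn1.
- by rewrite addn0 in wt.
- by move=> i; have := bw i; rewrite inc_shift addn0 addn1.
Qed.

Lemma pow2_ge1 j : (1 : R) <= 2 ^+ j. Proof. by rewrite exprn_ege1// ler1n. Qed.

Lemma tail_iter i t : 1 <= t -> 2 ^+ i * tail (2 ^+ (M * i) * t) <= tail t.
Proof.
elim: i t => [|i IH] t t1; first by rewrite muln0 expr0 !mul1r.
rewrite mulnS exprD.
have -> : 2 ^+ M * 2 ^+ (M * i) * t = 2 ^+ (M * i) * (2 ^+ M * t) by ring.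
have h1 : 1 <= 2 ^+ M * t by rewrite -[leLHS]mulr1 ler_pM// ?pow2_ge1.
have := IH _ h1; have := tail_half t1; rewrite exprS; lra.
Qed.

(** The tail halves at least once every [M] doublings, so [n * tail (2 ^ j)] grows at least like 2 ^
    ((J - j) / M) as [j] decreases; rounding in the division by [M] costs the factor 1/2 in
    [c / 2]. *)
Lemma tail_pow_lower c n J j : 0 < c -> (j <= J)%N -> c <= n%:R * tail (2 ^+ J) ->
  (c / 2) ^+ M * 2 ^+ (J - j) <= (n%:R * tail (2 ^+ j)) ^+ M.
Proof.
move=> c0 jJ cn.
pose i := ((J - j) %/ M)%N.
have iM : (M * i <= J - j)%N by rewrite mulnC leq_divM.
have iM' : (J - j <= M * i + M)%N.
  by rewrite {1}(divn_eq (J - j) M) mulnC leq_add2l ltnW// ltn_mod.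
have low : c * 2 ^+ i <= n%:R * tail (2 ^+ j).
  have := tail_iter i (pow2_ge1 j); rewrite -exprD => h.
  have : tail (2 ^+ J) <= tail (2 ^+ (M * i + j)).
    by apply: tail_le; rewrite ler_weXn2l ?ler1n// -(subnK jJ) leq_add2r.
  move=> h2; apply: (@le_trans _ _ (2 ^+ i * (n%:R * tail (2 ^+ J)))).
    by rewrite mulrC ler_wpM2l// exprn_ge0.
  rewrite mulrCA ler_wpM2l//; apply: le_trans h.
  by rewrite ler_wpM2l// exprn_ge0.
apply: (@le_trans _ _ ((c * 2 ^+ i) ^+ M)); last first.
  by apply: lerXn2r low; rewrite ?nnegrE ?mulr_ge0 ?exprn_ge0 ?(ltW c0) ?tail_ge0.
rewrite !exprMn -exprM -mulrA ler_wpM2l ?exprn_ge0 ?(ltW c0)//.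
rewrite exprVn mulrC ler_pdivrMr ?exprn_gt0// -exprD ler_weXn2l ?ler1n//.
by rewrite mulnC.
Qed.

(* Sort the paths by the size [2 ^ j] of their largest jump: the position of
   that jump is spread over volume [2 ^ (j D)], and for [j < J] the absence of
   larger jumps is exponentially unlikely. *)
Lemma concentration c : 0 < c -> exists2 C, 0 < C & forall n J v,
  c <= n%:R * tail (2 ^+ J) -> n%:R * tail (2 ^+ J) <= 1 ->
  Pr (box v 0 n) <= C / (2 ^+ J) ^+ D.
Proof.
move=> c0.
have cF0 : 0 < cF by apply: lt_le_trans cF_ge1.
(* The [k]-th power of [n * tail (2 ^ j)] beats 2 ^ ((J - j) (D + 1)): [D] of these factors
   compensate the smaller volume 2 ^ (j D), and the last one makes the sum over [j] geometric. *)
pose k := (M * D.+1)%N.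
have [k' kE] : exists k', k = k'.+1 by exists k.-1; rewrite prednK// muln_gt0 M_gt0.
pose K1 : R := 2 ^+ k.+1 * (k.+1)`!%:R.
have K10 : 0 < K1 by rewrite mulr_gt0 ?exprn_gt0// ltr0n fact_gt0.
have K1le : 2 ^+ k * k`!%:R <= K1.
  apply: ler_pM; rewrite ?exprn_ge0//; first by rewrite ler_weXn2l// ler1n.
  by rewrite ler_nat leq_fact.
pose K0 : R := K1 / ((c / 2) ^+ k).
have K00 : 0 < K0 by rewrite divr_gt0// exprn_gt0// divr_gt0.
pose K : R := (C4 * cF + 1) * K0 * 2 ^+ D.+1.
have C41 : 0 < C4 * cF + 1 by rewrite addr_gt0// mulr_gt0.
have Kp : 0 < K.
  by apply: mulr_gt0; [exact: mulr_gt0|exact: exprn_gt0].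
exists (K + C4); first by rewrite addr_gt0.
move=> n J v cn n1.
have n0 : (0 < n)%N.
  by rewrite lt0n; apply/negP => /eqP n0; move: cn; rewrite n0 mul0r leNgt c0.
have Xlow j : (j <= J)%N -> (c / 2) ^+ k * (2 ^+ (J - j)) ^+ D.+1 <= (n%:R * tail (2 ^+ j)) ^+ k.
  move=> jJ; rewrite /k !exprM -exprMn; apply: lerXn2r; last exact: tail_pow_lower.
    by rewrite nnegrE mulr_ge0 ?exprn_ge0// divr_ge0// ltW.
  by rewrite nnegrE exprn_ge0// mulr_ge0// tail_ge0.
have x_gt0 j : 0 < n%:R * tail (2 ^+ j) by rewrite mulr_gt0 ?ltr0n.
have t01 j : 0 <= tail (2 ^+ j) <= 1 by rewrite tail_ge0 tail_le1.
have dec j : (j <= J)%N -> (n%:R * tail (2 ^+ j)) * (1 - tail (2 ^+ j)) ^+ n.-1 <=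
    K0 / (2 ^+ (J - j)) ^+ D.+1.
  move=> jJ; have := geometric_decay k (t01 j) n0; rewrite -/K1 => h.
  have y0 : 0 < (2 ^+ (J - j)) ^+ D.+1 :> R by rewrite !exprn_gt0.
  rewrite ler_pdivlMr// /K0 ler_pdivlMr; last by rewrite exprn_gt0// divr_gt0.
  apply: le_trans h; rewrite [in leRHS]exprS.
  have -> : n%:R * tail (2 ^+ j) * (1 - tail (2 ^+ j)) ^+ n.-1 * (2 ^+ (J - j)) ^+ D.+1 * (c / 2) ^+ k
    = (1 - tail (2 ^+ j)) ^+ n.-1 * (n%:R * tail (2 ^+ j)) * ((c / 2) ^+ k * (2 ^+ (J - j)) ^+ D.+1) by ring.
  rewrite [leRHS]mulrA; apply: ler_wpM2l; last exact: Xlow.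
  by rewrite mulr_ge0 ?(ltW (x_gt0 j))// exprn_ge0// subr_ge0 tail_le1.
have dec0 : (1 - tail (2 ^+ 0)) ^+ n.-1 <= K0 / (2 ^+ J) ^+ D.+1.
  have := geometric_decay k' (t01 0%N) n0; rewrite -kE => h.
  have y0 : 0 < (2 ^+ J) ^+ D.+1 :> R by rewrite !exprn_gt0.
  rewrite ler_pdivlMr// /K0 ler_pdivlMr; last by rewrite exprn_gt0// divr_gt0.
  apply: le_trans K1le; apply: le_trans h.
  rewrite -mulrA ler_wpM2l//; first by rewrite exprn_ge0// subr_ge0 tail_le1.
  by rewrite mulrC; have := Xlow 0%N (leq0n _); rewrite subn0.
pose W j := Pr [set w | box v 0 n w /\ forall i, (i < n)%N -> norm1 (w i) <= 2 ^+ j].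
have mW j : measurable ([set w | box v 0 n w /\ forall i, (i < n)%N -> norm1 (w i) <= 2 ^+ j] : set OmT).
  apply: mset_and; first exact: measurable_box.
  by apply: mset_forall => i; apply: mset_imp => _; exact: measurable_nojump.
pose Q : R := K / (2 ^+ J) ^+ D.
(* With all jumps at most 1 the box is dropped: the absence of jumps alone is rare enough. *)
have W0 : W 0%N <= Q / 2 ^+ J.
  apply: (@le_trans _ _ ((1 - tail (2 ^+ 0)) ^+ n.-1)).
    rewrite -(Pr_nojump_except _ n0); apply: le_Pr => //.
      apply: mset_forall => i; apply: mset_imp => _; apply: mset_imp => _.
      exact: measurable_nojump.
    by move=> w [_ h] i ni _; exact: h.
  apply: le_trans dec0 _; rewrite /Q -mulrA -invfM -exprSr ler_wpM2r ?invr_ge0 ?exprn_ge0//.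
  rewrite /K mulrAC -[leLHS]mul1r ler_wpM2r ?(ltW K00)//.
  rewrite -[leLHS]mul1r ler_pM// ?pow2_ge1//; last by rewrite lerDr mulr_ge0// ltW.
(* The added paths have a jump beyond [2 ^ j] at some [k0] and no jump beyond [2 ^ j.+1] elsewhere;
   the local law at [k0] and the decay of the no-jump probability multiply. *)
have Wstep j : (j < J)%N -> W j.+1 <= W j + Q / 2 ^+ (J - j).
  move=> jJ.
  pose Bk k0 := [set w : nat -> E | 2 ^+ j < norm1 (w k0) /\
    ((forall i, (i < n)%N -> i != k0 -> norm1 (w i) <= 2 ^+ j.+1) /\ box v 0 n w)].
  have mBk k0 : measurable (Bk k0 : set OmT).
    apply: mset_and; first exact: measurable_jump.
    apply: mset_and; last exact: measurable_box.
    apply: mset_forall => i; apply: mset_imp => _; apply: mset_imp => _.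
    exact: measurable_nojump.
  have PBk k0 : (k0 < n)%N -> Pr (Bk k0) <=
      (1 - tail (2 ^+ j.+1)) ^+ n.-1 * (C4 * (tail (2 ^+ j) / (2 ^+ j) ^+ D)).
    move=> kn; rewrite -(Pr_nojump_except _ kn).
    apply: (@local_split k0 k0.+1 n _ [set w | 2 ^+ j < norm1 (w k0)] _ v) => //.
    - by rewrite leqnSn.
    - apply: mset_forall => i; apply: mset_imp => _; apply: mset_imp => ik.
      by apply: measurable_nojump; rewrite ltnS -eqn_leq eq_sym.
    - by apply: measurable_jump; rewrite leqnn ltnS leqnn.
    - by move=> z; apply: tail_loc_at; exact: pow2_ge1.
    - by move=> w [h1 [h2 h3]]; split.
  apply: (@le_trans _ _ (W j + \sum_(k0 < n) Pr (Bk k0))).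
    have mU : measurable (\bigcup_(k0 < n) Bk k0 : set OmT) by apply: bigcup_measurable.
    apply: (@le_trans _ _ (W j + Pr (\bigcup_(k0 < n) Bk k0))).
      apply: Pr_le2 => // w [bw hw].
      have [hj|/existsNP[i /not_implyP[ni /negP]]] := pselect (forall i, (i < n)%N -> norm1 (w i) <= 2 ^+ j).
        by left; split.
      by rewrite -ltNge => hi; right; exists i => //; split => //; split => // i' i'n _; exact: hw.
    by rewrite lerD2l; apply: Pr_le_sum => // w [k0 kn bw]; exists k0.
  rewrite lerD2l; apply: (@le_trans _ _ (\sum_(k0 < n) ((1 - tail (2 ^+ j.+1)) ^+ n.-1 * (C4 * (tail (2 ^+ j) / (2 ^+ j) ^+ D))))).
    by apply: ler_sum => k0 _; exact: PBk.
  rewrite sumr_const card_ord -[leLHS]mulr_natl.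
  set p := (1 - _) ^+ _.
  have p0 : 0 <= p by rewrite exprn_ge0// subr_ge0 tail_le1.
  have td : tail (2 ^+ j) <= cF * tail (2 ^+ j.+1).
    by rewrite exprS; apply: tail_double; exact: pow2_ge1.
  apply: (@le_trans _ _ (C4 * cF * ((n%:R * tail (2 ^+ j.+1)) * p) / (2 ^+ j) ^+ D)).
    have -> : n%:R * (p * (C4 * (tail (2 ^+ j) / (2 ^+ j) ^+ D))) =
       n%:R * p * C4 / (2 ^+ j) ^+ D * tail (2 ^+ j) by ring.
    have -> : C4 * cF * ((n%:R * tail (2 ^+ j.+1)) * p) / (2 ^+ j) ^+ D =
       n%:R * p * C4 / (2 ^+ j) ^+ D * (cF * tail (2 ^+ j.+1)) by ring.
    by apply: ler_wpM2l => //; rewrite divr_ge0 ?exprn_ge0// mulr_ge0 ?(ltW C4_gt0)// mulr_ge0.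
  apply: (@le_trans _ _ (C4 * cF * (K0 / (2 ^+ (J - j.+1)) ^+ D.+1) / (2 ^+ j) ^+ D)).
    rewrite ler_wpM2r ?invr_ge0 ?exprn_ge0// ler_wpM2l ?(mulr_ge0 (ltW C4_gt0) (ltW cF0))//.
    exact: dec.
  have [m JE] : exists m, J = (m + j.+1)%N by exists (J - j.+1)%N; rewrite subnK.
  have Jj1 : (J - j.+1 = m)%N by rewrite JE addnK.
  have Jj : (J - j = m.+1)%N by rewrite JE addnS -addSn addnK.
  rewrite Jj Jj1 /Q /K JE.
  have -> : (2 ^+ (m + j.+1) : R) = 2 * (2 ^+ m * 2 ^+ j).
    by rewrite addnS exprS exprD.
  rewrite [2 ^+ m.+1]exprS.
  set y := 2 ^+ m; set z := 2 ^+ j.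
  have y0 : 0 < y by rewrite exprn_gt0.
  have z0 : 0 < z by rewrite exprn_gt0.
  rewrite !exprMn [y ^+ D.+1]exprS [2 ^+ D.+1]exprS.
  have yd0 : 0 < y ^+ D by rewrite exprn_gt0.
  have zd0 : 0 < z ^+ D by rewrite exprn_gt0.
  have td0 : (0 : R) < 2 ^+ D by rewrite exprn_gt0.
  move: (y ^+ D) (z ^+ D) (2 ^+ D : R) yd0 zd0 td0 => yd zd pd yd0 zd0 pd0.
  have -> : (C4 * cF + 1) * K0 * (2 * pd) / (pd * (yd * zd)) / (2 * y) =
    C4 * cF * (K0 / (y * yd)) / zd + K0 / (y * yd) / zd.
    by field; rewrite !gt_eqF.
  by rewrite lerDl; apply: ltW; do 2 (apply: divr_gt0 => //); exact: mulr_gt0.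
(* The increment in [Wstep] equals the bound already reached, so the bound doubles with each [j]. *)
have WJ j : (j <= J)%N -> W j <= Q / 2 ^+ (J - j).
  elim: j => [|j IH] jJ; first by rewrite subn0.
  apply: le_trans (Wstep j jJ) _.
  have -> : Q / 2 ^+ (J - j.+1) = Q / 2 ^+ (J - j) + Q / 2 ^+ (J - j).
    have -> : (J - j = (J - j.+1).+1)%N by rewrite -subSn ?subSS.
    by rewrite exprS; field; rewrite gt_eqF ?exprn_gt0.
  by rewrite lerD2r; apply: IH; exact: ltnW.
(* For jumps beyond [2 ^ J] a union bound over their time suffices, because [n * tail (2 ^ J)] is at
   most 1. *)
pose Bk k0 := [set w : nat -> E | 2 ^+ J < norm1 (w k0) /\ box v 0 n w].
have mBk k0 : measurable (Bk k0 : set OmT).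
  by apply: mset_and; [exact: measurable_jump|exact: measurable_box].
have PBk k0 : (k0 < n)%N -> Pr (Bk k0) <= C4 * (tail (2 ^+ J) / (2 ^+ J) ^+ D).
  move=> kn; rewrite -[leRHS]mul1r -[X in X * _](PrT mu).
  apply: (@local_split k0 k0.+1 n setT [set w | 2 ^+ J < norm1 (w k0)] _ v) => //.
  - by rewrite leqnSn.
  - by apply: measurable_jump; rewrite leqnn ltnS leqnn.
  - by move=> z; apply: tail_loc_at; exact: pow2_ge1.
  - by move=> w [h1 h2]; split.
apply: (@le_trans _ _ (W J + \sum_(k0 < n) Pr (Bk k0))).
  have mU : measurable (\bigcup_(k0 < n) Bk k0 : set OmT) by apply: bigcup_measurable.
  apply: (@le_trans _ _ (W J + Pr (\bigcup_(k0 < n) Bk k0))).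
    apply: Pr_le2 => //; first exact: measurable_box.
    move=> w bw.
    have [hj|/existsNP[i /not_implyP[ni /negP]]] := pselect (forall i, (i < n)%N -> norm1 (w i) <= 2 ^+ J).
      by left; split.
    by rewrite -ltNge => hi; right; exists i.
  by rewrite lerD2l; apply: Pr_le_sum => // w [k0 kn bw]; exists k0.
rewrite mulrDl; apply: lerD.
  by have := WJ J (leqnn J); rewrite subnn expr0 divr1.
apply: (@le_trans _ _ (\sum_(k0 < n) (C4 * (tail (2 ^+ J) / (2 ^+ J) ^+ D)))).
  by apply: ler_sum => k0 _; exact: PBk.
rewrite sumr_const card_ord -[leLHS]mulr_natl.
have -> : n%:R * (C4 * (tail (2 ^+ J) / (2 ^+ J) ^+ D)) =
  (C4 / (2 ^+ J) ^+ D) * (n%:R * tail (2 ^+ J)) by ring.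
by rewrite -[leRHS]mulr1 ler_wpM2l// divr_ge0 ?exprn_ge0// ltW.
Qed.

End concentration.

End local.

Lemma exists_expr_le (R : realType) (x e : R) : 0 <= x < 1 -> 0 < e -> exists i, x ^+ i <= e.
Proof.
move=> /andP[x0 x1] e0.
have := @cvg_expr R x; rewrite ger0_norm// => /(_ x1).
move=> /cvgrPdist_le /(_ e e0) [N _ /(_ N (leqnn _))].
by rewrite sub0r normrN ger0_norm ?exprn_ge0// => h; exists N.
Qed.

(** * Regularity of boundary survival probabilities *)

Section regularity.
Variables (R : realType) (d : nat).
Local Notation E := ((d.+1).-tuple R).
Local Notation OmT := (@Om _ E predT).
Variables (mu : probability OmT R) (nu : probability E R).
Hypothesis mu_iid : iid_law mu nu.
Local Notation Pr := (Pr mu).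
Local Notation tail := (tail mu).
Local Notation surv := (surv mu).
Local Notation surv0 := (surv0 mu).
Local Notation renewal := (renewal mu).
Local Notation surv_sum := (surv_sum mu).
Local Notation D := d.+1.

(* A slab of the l1-ball of radius [K] is covered by unit boxes of a grid. *)
Lemma slab_le s n (k K q : R) : 0 <= k -> 0 <= K -> (forall z, Pr (box z 0 n) <= q) ->
  Pr [set w | `|hinc s 0 n w| <= k /\ ninc 0 n w <= K] <= (2 * k + 1) * (2 * K + 1) ^+ d * q.
Proof.
move=> k0 K0 hq.
have q0 : 0 <= q by apply: le_trans (hq (fun=> 0)); exact: Pr_ge0.
pose N0 := Num.truncn (2 * k); pose N1 := Num.truncn (2 * K).
pose I := ('I_N0.+1 * {ffun 'I_d -> 'I_N1.+1})%type.
pose z (p : I) (i : 'I_d.+1) : R :=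
  if unlift ord0 i is Some j then - K + (p.2 j)%:R else - k + p.1%:R.
have mS : measurable ([set w | `|hinc s 0 n w| <= k /\ ninc 0 n w <= K] : set OmT).
  apply: mset_and; apply: mset_le => //; last exact: measurable_ninc.
  by apply: measurableT_comp => //; exact: measurable_hinc.
have trunc_spec (a x : R) : 0 <= a -> `|x| <= a ->
    exists j : 'I_(Num.truncn (2 * a)).+1, - a + j%:R <= x < - a + j%:R + 1.
  move=> a0 xa; have /andP[xa1 xa2] : - a <= x <= a by rewrite -ler_norml.
  have y0 : 0 <= x + a by lra.
  have jlt : (Num.truncn (x + a) < (Num.truncn (2 * a)).+1)%N.
    by rewrite ltnS le_truncn//; lra.
  exists (Ordinal jlt) => /=.
  have /andP[] := truncn_itv y0; rewrite -natr1; lra.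
apply: (@le_trans _ _ (\sum_(p : I) Pr (box (z p) 0 n))).
  apply: Pr_le_sum_fin => // [p|w [wk wK]]; first exact: measurable_box.
  have h0 : `|inc ord0 0 n w| <= k.
    by move: wk; rewrite /hinc; case: (s); rewrite ?normrN.
  have [j0 hj0] := trunc_spec _ _ k0 h0.
  have h1 i : `|inc i 0 n w| <= K by apply: le_trans wK; exact: inc_le_ninc.
  have /fin_all_exists[f hf] : forall j : 'I_d, exists jj : 'I_N1.+1,
      - K + jj%:R <= inc (lift ord0 j) 0 n w < - K + jj%:R + 1.
    by move=> j; exact: trunc_spec.
  exists (j0, [ffun j => f j]) => i; rewrite /z /=.
  by case: unliftP => [j|] -> //; rewrite ffunE.
apply: (@le_trans _ _ (\sum_(p : I) q)); first by apply: ler_sum => p _; exact: hq.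
rewrite sumr_const -[leLHS]mulr_natl ler_wpM2r// card_prod card_ffun !card_ord natrM natrX.
have t1 (a : R) : 0 <= a -> (Num.truncn (2 * a)).+1%:R <= 2 * a + 1.
  move=> a0; rewrite -natr1 lerD2r.
  by have /andP[] := truncn_itv (mulr_ge0 (ler0n R 2) a0).
apply: ler_pM => //; first exact: t1.
by apply: lerXn2r; rewrite ?nnegrE ?addr_ge0 ?mulr_ge0//; exact: t1.
Qed.

Variables (cF C4 C7 C8 : R) (M : nat).
Hypotheses (cF_ge1 : 1 <= cF) (M_gt0 : (0 < M)%N)
  (tail_gt0 : forall t, 0 < tail t)
  (tail_double : forall t, 1 <= t -> tail t <= cF * tail (2 * t))
  (tail_half : forall t, 1 <= t -> tail (2 ^+ M * t) <= tail t / 2)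
  (C4_gt0 : 0 < C4)
  (tail_loc : forall t z, 1 <= t ->
     Pr [set w | t < norm1 (w 0%N) /\ box z 0 1 w] <= C4 * (tail t / t ^+ D))
  (C7_gt0 : 0 < C7)
  (ninc_le : forall n x, 1 <= x -> Pr [set w | x <= ninc 0 n w] <= C7 * (n%:R * tail x))
  (C8_gt0 : 0 < C8)
  (exc_le : forall n x, 1 <= x -> Pr (exceed 0 n x) <= C8 * (n%:R * tail x)).

Let cF0 : 0 < cF. Proof. exact: lt_le_trans cF_ge1. Qed.

(** The least [J] with [n * tail (2 ^ J)] at most 1: by minimality the product exceeds 1 at [J.-1],
    and doubling loses at most [cF]. For [J = 0] the lower bound is [tail 1]. *)
Lemma exists_scale : exists2 c, 0 < c & forall n, (0 < n)%N ->
  exists J, c <= n%:R * tail (2 ^+ J) <= 1.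
Proof.
exists (Num.min (tail 1) (cF^-1)); first by rewrite lt_min tail_gt0 invr_gt0.
move=> n n0.
have ex : exists J, n%:R * tail (2 ^+ J) <= 1.
  exists (M * n)%N; have := tail_iter tail_half n (lexx 1); rewrite mulr1 => h.
  have : n%:R <= 2 ^+ n :> R by rewrite -natrX ler_nat ltnW// ltn_expl.
  have := tail_le1 mu 1; have := tail_ge0 mu (2 ^+ (M * n)) => h1 h2 h3.
  by apply: le_trans (le_trans h h2); rewrite ler_wpM2r.
have [J hJ minJ] := ex_minnP ex; exists J; rewrite hJ andbT ge_min.
case: J hJ minJ => [|J] hJ minJ.
  apply/orP; left; rewrite expr0 ler_peMl ?tail_ge0//.
  by rewrite ler1n.
apply/orP; right; have : 1 < n%:R * tail (2 ^+ J).
  by rewrite ltNge; apply/negP => /minJ; rewrite ltnn.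
have := tail_double (pow2_ge1 R J); rewrite -exprS => h1 h2.
rewrite -[leLHS]mulr1 ler_pdivrMl// mulrCA; apply: le_trans (ltW h2) _.
by rewrite ler_wpM2l.
Qed.

Lemma tail_double_iter a j : tail (2 ^+ j) <= cF ^+ a * tail (2 ^+ (a + j)).
Proof.
elim: a => [|a IH]; first by rewrite expr0 mul1r.
apply: le_trans IH _; rewrite addSn exprS [cF * _]mulrC -mulrA ler_wpM2l ?exprn_ge0 ?(ltW cF0)//.
by rewrite exprS; apply: tail_double; exact: pow2_ge1.
Qed.

Lemma scale_large a n J : n%:R * tail (2 ^+ J) <= 1 -> 1 < n%:R * tail (2 ^+ a) -> (a < J)%N.
Proof.
move=> h1 h2; rewrite ltnNge; apply/negP => Ja.
have : tail (2 ^+ a) <= tail (2 ^+ J) by apply: tail_le; rewrite ler_weXn2l ?ler1n.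
have : 0 <= n%:R :> R by []. nra.
Qed.

Section one_sided.
Variables (s : bool) (rho : R) (n0 : nat).
Hypotheses (rho_gt0 : 0 < rho)
  (Pr_cmp : forall n, (n0 <= n)%N -> rho <= Pr [set w | cmp s (hinc s 0 n w)]).

(** The sign condition has probability at least [rho]. A quarter of [rho] bounds the event that the
    walk leaves a large multiple of its scale, another quarter the thin slab around zero inside that
    ball, by concentration. *)
Lemma hinc_spread c : 0 < c -> exists a n1, forall n J, (n1 <= n)%N ->
  c <= n%:R * tail (2 ^+ J) -> n%:R * tail (2 ^+ J) <= 1 ->
  (a < J)%N /\ rho / 2 <= Pr [set w | 2 ^+ (J - a) < hinc s 0 n w].
Proof.
move=> c0.
have [C C0 conc] := concentration mu_iid cF_ge1 M_gt0 tail_gt0 tail_double tail_half C4_gt0 tail_loc c0.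
have [i hi] : exists i, C7 * (1 / 2) ^+ i <= rho / 4.
  have half01 : 0 <= (1 / 2 : R) < 1 by apply/andP; split; lra.
  have [|i hi] := @exists_expr_le R (1 / 2) (rho / 4 / C7) half01.
    by rewrite !divr_gt0.
  by exists i; rewrite mulrC -ler_pdivlMr.
pose K : R := 2 ^+ (M * i).
have K1 : 1 <= K by exact: pow2_ge1.
pose half : R := 1 / 2.
(* The slab has width [half ^ a] times the scale. The factors 3 bound [2 * k + 1] and
   [2 * (K * b) + 1] for lengths at least 1. *)
have [a ha] : exists a, half ^+ a * (3 * (3 * K) ^+ d * C) <= rho / 4.
  have X0 : 0 < 3 * (3 * K) ^+ d * C.
    by rewrite mulr_gt0// mulr_gt0// exprn_gt0// mulr_gt0// (lt_le_trans ltr01).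
  have half01 : 0 <= half < 1 by rewrite /half; apply/andP; split; lra.
  have [|a ha] := @exists_expr_le R half (rho / 4 / (3 * (3 * K) ^+ d * C)) half01.
    by rewrite !divr_gt0.
  by exists a; rewrite -ler_pdivlMr.
(* Beyond this, [n * tail (2 ^ a)] exceeds 1, which forces a < J. *)
pose n1 := maxn n0 (Num.truncn (tail (2 ^+ a))^-1).+1.
exists a, n1 => n J n1n cn nJ1.
have aJ : (a < J)%N.
  apply: (scale_large nJ1).
  rewrite -ltr_pdivrMr// mul1r; apply: lt_le_trans (_ : (Num.truncn (tail (2 ^+ a))^-1).+1%:R <= _).
    have ti : 0 <= (tail (2 ^+ a))^-1 by rewrite invr_ge0 tail_ge0.
    by have /andP[] := truncn_itv ti.
  by rewrite ler_nat; apply: leq_trans n1n; rewrite leq_maxr.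
split => //.
have n0n : (n0 <= n)%N by apply: leq_trans n1n; rewrite leq_maxl.
pose b : R := 2 ^+ J; have b1 : 1 <= b by exact: pow2_ge1.
have b0 : 0 < b by apply: lt_le_trans b1.
pose k : R := 2 ^+ (J - a).
have k1 : 1 <= k by exact: pow2_ge1.
have kb : k = half ^+ a * b.
  by rewrite /half /k /b -{2}(subnK (ltnW aJ)) exprD div1r exprVn mulrC mulfK//.
have Kb1 : 1 <= K * b by rewrite -[leLHS]mulr1 ler_pM.
have E3 : Pr [set w | K * b <= ninc 0 n w] <= rho / 4.
  apply: le_trans (ninc_le n Kb1) _; apply: le_trans hi; rewrite ler_pM2l//.
  have := tail_iter tail_half i b1; rewrite -/K => h.
  have p2 : 0 < 2 ^+ i :> R by rewrite exprn_gt0.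
  rewrite div1r exprVn -[leRHS]mul1r ler_pdivlMr//; apply: le_trans nJ1.
  by rewrite -mulrA ler_wpM2l// mulrC.
have E2 : Pr [set w | `|hinc s 0 n w| <= k /\ ninc 0 n w <= K * b] <= rho / 4.
  have k0 : 0 <= k by apply: le_trans k1.
  have Kb0 : 0 <= K * b by apply: le_trans Kb1.
  apply: le_trans (slab_le s k0 Kb0 (fun z => conc n J z cn nJ1)) _.
  apply: le_trans ha; rewrite -/b.
  have -> : half ^+ a * (3 * (3 * K) ^+ d * C) = (3 * k) * (3 * (K * b)) ^+ d * (C / b ^+ D).
    rewrite kb [3 * (K * b)]mulrA; set y := 3 * K; rewrite [(y * b) ^+ d]exprMn [b ^+ D]exprS.
    have bd0 : 0 < b ^+ d by rewrite exprn_gt0.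
    move: (y ^+ d) (b ^+ d) (half ^+ a) bd0 => yd bd h bd0.
    by field; rewrite !gt_eqF.
  rewrite ler_wpM2r ?divr_ge0 ?exprn_ge0 ?(ltW C0) ?(ltW b0)//.
  have q1 : 0 <= 2 * (K * b) + 1 by lra.
  apply: ler_pM => //; [lra|exact: exprn_ge0|lra|].
  by apply: lerXn2r; rewrite ?nnegrE; lra.
have mh : measurable_fun setT (fun w : OmT => hinc s 0 n w) by exact: measurable_hinc.
have mA1 : measurable ([set w | k < hinc s 0 n w] : set OmT) by exact: mset_lt.
have mA2 : measurable ([set w | `|hinc s 0 n w| <= k /\ ninc 0 n w <= K * b] : set OmT).
  apply: mset_and; apply: mset_le => //; first exact: measurableT_comp.
  exact: measurable_ninc.
have mA3 : measurable ([set w | K * b <= ninc 0 n w] : set OmT).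
  by apply: mset_le => //; exact: measurable_ninc.
have := Pr_cmp n0n.
have : Pr [set w | cmp s (hinc s 0 n w)] <= Pr [set w | k < hinc s 0 n w] +
   Pr ([set w | `|hinc s 0 n w| <= k /\ ninc 0 n w <= K * b] `|` [set w | K * b <= ninc 0 n w]).
  apply: Pr_le2 => //; first exact: mset_cmp.
    exact: measurableU.
  move=> w cw.
  have h0 : 0 <= hinc s 0 n w by move: cw; rewrite /cmp /=; case: (s) => // /ltW.
  have [|hk] := ltP k (hinc s 0 n w); first by left.
  right; have [KB|KB] := leP (K * b) (ninc 0 n w); first by right.
  by left; split; [rewrite ger0_norm|exact: ltW].
have := Pr_setU mu mA2 mA3.
rewrite -/k; lra.
Qed.

(* On a time interval of length [n = L h] the walk rises by a multiple of its
   scale with probability at least [rho / 2].  Either its last minimum occurs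
   before [n - h], with probability at most
   [surv0 s h * surv_sum (~~ s) n], or it rises that much during the last [h]
   steps, which is unlikely for large [L]. *)
Lemma surv0_lower : exists c h0, [/\ 0 < c, c <= 1 & forall h, (h0 <= h)%N ->
  c * surv_sum s h <= h%:R * surv0 s h].
Proof.
have [c c0 sc] := exists_scale.
have [a [n1 spread]] := hinc_spread c0.
pose X := C8 * cF ^+ a.+1.
have X0 : 0 < X by rewrite mulr_gt0// exprn_gt0.
(* Makes an increment of order of the scale of [n] during only [h = n / L] steps have probability at
   most [rho / 4]. *)
pose L := (Num.truncn (X / (rho / 4))).+1.
have LX : X <= rho / 4 * L%:R.
  rewrite mulrC -ler_pdivrMr; last by rewrite divr_gt0.
  have /andP[_] := truncn_itv (divr_ge0 (ltW X0) (divr_ge0 (ltW rho_gt0) (ler0n R 4))).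
  by move/ltW.
have L0 : 0 < L%:R :> R by rewrite ltr0n.
have rL : 0 < rho / (12 * L%:R) by rewrite divr_gt0// mulr_gt0.
(* Of the 12, a factor 4 comes from [rho / 4] and a factor 3 from 2n + 1 <= 3n. *)
exists (Num.min 1 (rho / (12 * L%:R))), n1.+1.
split; [by rewrite lt_min ltr01|by rewrite ge_min lexx|].
move=> h hn1.
have h0 : (0 < h)%N by apply: leq_trans hn1.
pose n := (L * h)%N.
have hn : (h <= n)%N by rewrite /n leq_pmull.
have n0' : (0 < n)%N by apply: leq_trans hn.
have [J /andP[cn nJ]] := sc n n0'.
have [aJ spr] := spread n J (leq_trans (ltnW hn1) hn) cn nJ.
pose k : R := 2 ^+ (J - a).
(* If the minimum is at a late time [k'], the increment from [k'] to [n] exceeds [k = 2 * k2]; hence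
   from [n - h] the walk moves by at least [k2] by time [n] or by time [k']. *)
pose k2 : R := 2 ^+ (J - a.+1).
have k2k : k = 2 * k2.
  by rewrite /k /k2 -exprS -subSn ?subSS.
have EX : Pr (exceed (n - h) n k2) <= rho / 4.
  rewrite (Pr_exceed mu_iid) ?leq_subr// subKn//.
  apply: le_trans (exc_le h (pow2_ge1 R (J - a.+1))) _.
  have := tail_double_iter a.+1 (J - a.+1)%N; rewrite subnKC// => td.
  apply: (@le_trans _ _ (X * (h%:R * tail (2 ^+ J)))).
    rewrite /X -mulrA ler_pM2l// mulrCA ler_wpM2l//.
  have : L%:R * (h%:R * tail (2 ^+ J)) <= 1 by rewrite mulrA -natrM.
  move=> hL; have y0 : 0 <= h%:R * tail (2 ^+ J) by rewrite mulr_ge0// tail_ge0.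
  apply: (@le_trans _ _ (rho / 4 * L%:R * (h%:R * tail (2 ^+ J)))).
    by rewrite ler_wpM2r.
  by rewrite -mulrA -[leRHS]mulr1 ler_wpM2l// divr_ge0// ltW.
pose Bk k := [set w : nat -> E | rcd s k w /\ pos s k n w].
have mBk k' : measurable (Bk k' : set OmT).
  by apply: mset_and; [exact: measurable_rcd|exact: measurable_pos].
have mU : measurable (\bigcup_(k' < (n - h).+1) Bk k' : set OmT) by apply: bigcup_measurable.
have mEx : measurable (exceed (n - h) n k2 : set OmT) by exact: measurable_exceed.
have S1 : Pr [set w | k < hinc s 0 n w] <= Pr (\bigcup_(k' < (n - h).+1) Bk k') + Pr (exceed (n - h) n k2).
  apply: Pr_le2 => //.
    by apply: mset_lt => //; exact: measurable_hinc.
  move=> w kw; have [k' k'n [rk pk]] := last_argmin s n w.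
  have [kh|kh] := leqP k' (n - h)%N.
    by left; exists k'.
  right.
  have hk0 : hinc s 0 k' w <= 0.
    have := rk 0%N (leq_ltn_trans (leq0n _) kh).
    by rewrite /cmp; case: (s); rewrite -?leNgt -?ltNge// => /ltW.
  have e1 := @hinc_cat R d s 0 k' n w; rewrite leq0n k'n in e1.
  have e2 := hinc_le_ninc s k' n w; have e3 := ler_norm (hinc s k' n w).
  have e4 := @ninc_tail R d (n - h) k' n w; rewrite (ltnW kh) k'n in e4.
  have {}e1 := e1 isT; have {}e4 := e4 isT.
  have kw' : k < hinc s 0 n w := kw.
  have [B|B] := leP k2 (ninc (n - h) n w).
    by exists n; rewrite leq_subr leqnn.
  exists k'; rewrite (ltnW kh) k'n; split => //; lra.
have S2 : Pr (\bigcup_(k' < (n - h).+1) Bk k') <= surv0 s h * surv_sum (~~ s) n.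
  apply: (@le_trans _ _ (\sum_(k' < (n - h).+1) Pr (Bk k'))).
    by apply: Pr_le_sum => // w [k' kn bw]; exists k'.
  apply: (@le_trans _ _ (\sum_(k' < (n - h).+1) surv0 s h * surv0 (~~ s) k')).
    apply: ler_sum => k' _.
    have k'n : (k' <= n - h)%N by exact: leq_ord.
    have := argmin_split mu_iid s (leq_trans k'n (leq_subr h n)).
    rewrite -[Pr (rcd s k' `&` pos s k' n)]/(Pr (Bk k')) => <-.
    rewrite mulrC ler_wpM2r ?surv0_ge0//; apply: surv0_le.
    by rewrite leq_subRL ?(leq_trans k'n (leq_subr h n))// addnC -leq_subRL// subKn.
  rewrite -mulr_sumr ler_wpM2l ?surv0_ge0//; apply: sum_le_sum; last by rewrite ltnS leq_subr.
  by move=> k'; exact: surv0_ge0.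
have key : rho / 4 <= surv0 s h * surv_sum (~~ s) n.
  have : rho / 2 <= Pr [set w | k < hinc s 0 n w] by [].
  lra.
have P1 := surv_sum_prod mu_iid s n.
have A1 := surv_sum_le mu s hn.
have Ah1 := surv_sum_ge1 mu s h.
have An1 := surv_sum_ge1 mu (~~ s) n.
have n3 : n.*2.+1%:R <= 3 * (L%:R * h%:R) :> R.
  rewrite -natrM -/n -(natrM _ 3) ler_nat; move: n0'; clear; lia.
have sv := surv0_ge0 mu s h.
have a0 : 0 <= surv_sum (~~ s) n by apply: le_trans An1.
have ah0 : 0 <= surv_sum s h by apply: le_trans Ah1.
apply: (@le_trans _ _ (rho / (12 * L%:R) * surv_sum s h)).
  by rewrite ler_wpM2r// ge_min lexx orbT.
have : rho / 4 * surv_sum s h <= surv0 s h * (3 * (L%:R * h%:R)).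
  apply: (@le_trans _ _ (surv0 s h * (surv_sum s n * surv_sum (~~ s) n))).
    rewrite [surv_sum s n * _]mulrC mulrA; apply: ler_pM => //.
    by rewrite divr_ge0// ltW.
  by rewrite ler_wpM2l//; apply: le_trans n3.
move=> H; have -> : rho / (12 * L%:R) * surv_sum s h = (rho / 4 * surv_sum s h) / (3 * L%:R).
  by field; rewrite gt_eqF.
rewrite ler_pdivrMr ?mulr_gt0//; apply: le_trans H _.
by rewrite le_eqVlt; apply/orP; left; apply/eqP; ring.
Qed.

(** By [surv0_lower] and monotonicity the terms between [m] and [2 * m] carry a fixed fraction of
    the sum up to [2 * m], so halving the range multiplies the sum by at most [1 - c / 2];
    iterate. *)
Lemma surv_sum_decay (g : R) : 0 < g -> exists L m0, (1 < L)%N /\ forall m, (m0 <= m)%N ->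
  surv_sum s (m %/ L) <= g * surv_sum s m.
Proof.
move=> g0; have [c [h0 [c0 c1 low]]] := surv0_lower.
pose th := 1 - c / 2.
have dbl m : (h0 <= m)%N -> surv_sum s m <= th * surv_sum s (2 * m).
  move=> hm.
  have := low (2 * m)%N (leq_trans hm (leq_pmull m (ltn0Sn 1))).
  have : surv_sum s m + m%:R * surv0 s (2 * m) <= surv_sum s (2 * m).
    have sumE k : surv_sum s k = \sum_(0 <= j < k.+1) surv0 s j by rewrite big_mkord.
    rewrite !sumE [leRHS](@big_cat_nat _ _ _ m.+1)//=; last first.
      by clear; lia.
    rewrite lerD2l.
    have -> : m%:R * surv0 s (2 * m) = \sum_(m.+1 <= k < (2 * m).+1) surv0 s (2 * m).
      rewrite sumr_const_nat mulr_natl; congr (_ *+ _); clear; lia.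
    by apply: ler_sum_nat => k /andP[_ k2]; apply: surv0_le.
  rewrite natrM /th => h1 h2; lra.
have th01 : 0 <= th < 1 by rewrite /th; apply/andP; split; lra.
have [i hi] := exists_expr_le th01 g0.
have iter j m : (h0 <= m)%N -> surv_sum s m <= th ^+ j * surv_sum s (2 ^ j * m).
  move=> hm; elim: j => [|j IH]; first by rewrite expr0 expn0 mul1r mul1n.
  apply: le_trans IH _; rewrite exprSr -mulrA ler_wpM2l ?exprn_ge0 ?(proj1 (andP th01))//.
  rewrite expnS -mulnA; apply: dbl; apply: leq_trans hm _.
  by rewrite leq_pmull// expn_gt0.
exists (2 ^ i.+1)%N, (2 ^ i.+1 * h0)%N; split.
  by rewrite -[1%N](expn0 2) ltn_exp2l.
move=> m hm.
have hq : (h0 <= m %/ 2 ^ i.+1)%N by rewrite leq_divRL ?expn_gt0// mulnC.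
apply: le_trans (iter i.+1 _ hq) _.
apply: (@le_trans _ _ (th ^+ i.+1 * surv_sum s m)).
  rewrite ler_wpM2l ?exprn_ge0 ?(proj1 (andP th01))//; apply: surv_sum_le.
  by rewrite mulnC leq_divM.
rewrite ler_wpM2r ?(le_trans _ (surv_sum_ge1 mu s m))//.
apply: le_trans hi; have /andP[t0 t1] := th01.
by rewrite exprS ler_piMl ?exprn_ge0// ltW.
Qed.

(* Induction on [m], splitting at time [m / L]: by [surv_sum_decay] the early
   part contributes at most half of the bound. *)
Lemma excur0_le : exists2 C, 0 < C & forall u m x, 0 < u -> 1 <= x ->
  Pr (excur0 s u m x) <= C * (renewal s u m * surv_sum s m * tail x).
Proof.
(* In the recursion [cF] pays for passing from [x] to [x / 2], and the remaining 1/2 closes the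
   induction. *)
have [|L [m0 [L1 dec]]] := @surv_sum_decay (2 * cF)^-1.
  by rewrite invr_gt0 mulr_gt0.
(* The summands serve m < m0, x < 2, and the late part, which must be at most [C / 2]. *)
pose C := C8 * m0%:R + (tail 2)^-1 + 2 * L%:R * C8 * cF.
have L0 : 0 < L%:R :> R by rewrite ltr0n ltnW.
have p1 : 0 <= C8 * m0%:R by rewrite mulr_ge0// ltW.
have p2 : 0 < (tail 2)^-1 by rewrite invr_gt0.
have p3 : 0 < 2 * L%:R * C8 * cF by rewrite !mulr_gt0.
have C0 : 0 < C by rewrite /C; lra.
exists C => // u m; elim/ltn_ind: m => m IH x u0 x1.
have T0 := tail_gt0 x.
have R1 := renewal_ge1 mu s m u0.
have A1 := surv_sum_ge1 mu s m.
have RA1 : 1 <= renewal s u m * surv_sum s m by rewrite -[leLHS]mulr1 ler_pM.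
have RAT : tail x <= renewal s u m * surv_sum s m * tail x.
  by rewrite ler_peMl// ltW.
have mE : measurable (excur0 s u m x : set OmT) by exact: measurable_excur0.
have [mm0|m0m] := ltnP m m0.
  apply: (@le_trans _ _ (Pr (exceed 0 m x))).
    apply: le_Pr => //; first exact: measurable_exceed.
    by move=> w [k [km [xk _]]]; exists k.
  apply: le_trans (exc_le m x1) _.
  apply: (@le_trans _ _ (C8 * m0%:R * tail x)).
    by rewrite mulrA ler_wpM2r ?(ltW T0)// ler_pM2l// ler_nat ltnW.
  apply: ler_pM => //; first exact: ltW.
  by rewrite /C; lra.
have [x2|x2] := ltP x 2.
  apply: le_trans (Pr_le1 mu mE) _.
  apply: (@le_trans _ _ ((tail 2)^-1 * tail x)).
    by rewrite ler_pdivlMl// mulr1; apply: tail_le; exact: ltW.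
  apply: ler_pM => //; [exact: ltW|exact: ltW|].
  by rewrite /C; lra.
have xh1 : 1 <= x / 2 by lra.
have Td : tail (x / 2) <= cF * tail x.
  by have := tail_double xh1; have -> : 2 * (x / 2) = x by field.
have [m00|mgt0] := posnP m.
  have -> : (excur0 s u m x : set OmT) = set0.
    apply/seteqP; split => // w [k [km [xk _]]].
    move: km xk; rewrite m00 leqn0 => /eqP ->; rewrite ninc_nil leNgt.
    by rewrite (lt_le_trans ltr01).
  by rewrite Pr0 mulr_ge0 ?(ltW C0)// (le_trans (ltW T0)).
pose h := (m %/ L)%N.
have hm : (h < m)%N by rewrite ltn_Pdiv.
have rec := IH h hm (x / 2) u0 xh1.
have mst : measurable ((stay s u h : set (nat -> E)) `&` exceed h m (x / 2) : set OmT).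
  by apply: measurableI; [exact: measurable_stay|exact: measurable_exceed].
have S1 : Pr (excur0 s u m x) <= Pr (excur0 s u h (x / 2)) +
    Pr (stay s u h `&` exceed h m (x / 2)).
  apply: Pr_le2 => //; first exact: measurable_excur0.
  move=> w [k [km [xk st]]].
  have [kh|hk] := leqP k h.
    by left; exists k; split => //; split => //; apply: le_trans xk; lra.
  have [xh|xh] := leP (x / 2) (ninc 0 h w).
    left; exists h; split => //; split => // j /andP[j0 jh]; apply: st.
    by rewrite j0 (ltn_trans jh).
  right; split.
    by move=> j /andP[j0 jh]; apply: st; rewrite j0 (leq_ltn_trans jh).
  exists k; rewrite (ltnW hk) km; split => //.
  have := @ninc_triangle R d 0 h k w; rewrite leq0n (ltnW hk) => /(_ isT).
  lra.
have S2 : Pr (stay s u h `&` exceed h m (x / 2)) <= L%:R * C8 * cF * (renewal s u m * surv_sum s m * tail x).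
  rewrite (Pr_indep mu_iid (I := fun j => (j < h)%N) (J := fun j => (h <= j)%N)).
  - rewrite (Pr_exceed mu_iid) ?(ltnW hm)//.
    have e1 := surv_renewal_le mu_iid s h u0.
    have e2 := exc_le (m - h) xh1.
    have e3 : (m - h)%:R <= L%:R * h.+1%:R :> R.
      rewrite -natrM ler_nat (leq_trans (leq_subr _ _))// mulnC ltnW// ltn_ceil//.
      exact: ltnW.
    have e4 := renewal_le mu s u (ltnW hm).
    have e5 := surv_sum_le mu s (ltnW hm).
    have sv0 := surv_ge0 mu s u h.
    apply: (@le_trans _ _ (surv s u h * (C8 * ((L%:R * h.+1%:R) * (cF * tail x))))).
      rewrite -/(surv s u h) ler_wpM2l//; apply: le_trans e2 _; rewrite ler_pM2l//.
      by apply: ler_pM => //; exact: tail_ge0.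
    have -> : surv s u h * (C8 * ((L%:R * h.+1%:R) * (cF * tail x))) =
      L%:R * C8 * cF * (h.+1%:R * surv s u h * tail x) by ring.
    rewrite ler_wpM2l ?mulr_ge0 ?(ltW L0) ?(ltW C8_gt0) ?(ltW cF0)//.
    rewrite ler_wpM2r ?(ltW T0)//; apply: le_trans e1 _.
    apply: ler_pM => //; first exact: renewal_ge0.
    by apply: le_trans (surv_sum_ge1 mu s h).
  - by move=> j /=; rewrite -ltnNge.
  - exact: measurable_stay.
  - by apply: measurable_exceed => j /andP[].
have S3 : C * (renewal s u h * surv_sum s h * tail (x / 2)) <=
    C / 2 * (renewal s u m * surv_sum s m * tail x).
  have -> : C / 2 * (renewal s u m * surv_sum s m * tail x) =
     C * (renewal s u m * ((2 * cF)^-1 * surv_sum s m) * (cF * tail x)).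
    by field; rewrite gt_eqF.
  rewrite ler_pM2l//; apply: ler_pM => //.
  - rewrite mulr_ge0 ?renewal_ge0//; exact: le_trans (surv_sum_ge1 mu s h).
  - exact: tail_ge0.
  - apply: ler_pM; rewrite ?renewal_ge0//.
    + by apply: le_trans (surv_sum_ge1 mu s h).
    + exact: renewal_le (ltnW hm).
    + exact: dec.
have p0 : 0 <= renewal s u m * surv_sum s m * tail x by apply: le_trans RAT; exact: ltW.
have : L%:R * C8 * cF * (renewal s u m * surv_sum s m * tail x) <=
   C / 2 * (renewal s u m * surv_sum s m * tail x).
  by rewrite ler_wpM2r// /C; lra.
lra.
Qed.

End one_sided.

End regularity.

(** * Walks pinned at both ends *)

Section bridge.
Variables (R : realType) (d : nat).
Local Notation E := ((d.+1).-tuple R).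
Local Notation OmT := (@Om _ E predT).
Variables (mu : probability OmT R) (nu : probability E R).
Hypothesis mu_iid : iid_law mu nu.
Local Notation Pr := (Pr mu).
Local Notation tail := (tail mu).
Local Notation surv := (surv mu).
Local Notation renewal := (renewal mu).
Local Notation surv_sum := (surv_sum mu).
Local Notation D := d.+1.

(** Positivity of the walk read backwards from time [n] for [m] steps. In [bridge] the backward walk
    uses [~~ s], since the reversed path from the endpoint moves by the opposite increments. *)
Definition rstay s (z : R) m n : set (nat -> E) :=
  [set w | forall j, (0 < j <= m)%N -> 0 < z + hinc s (n - j) n w].

Definition bridge s (u z : R) v n : set (nat -> E) :=
  [set w | box v 0 n w /\ (stay s u n w /\ rstay (~~ s) z n n w)].

Lemma hinc_rev s a b n (w : nat -> E) : (a <= b <= n)%N ->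
  hinc s a b (reind (revn n) w) = hinc s (n - b) (n - a) w.
Proof. by move=> abn; rewrite /hinc !inc_rev. Qed.

Lemma measurable_rstay (I : pred nat) s z m n : (forall j, (n - m <= j < n)%N -> I j) ->
  measurable (rstay s z m n : set (@Om _ E I)).
Proof.
move=> mI; apply: mset_forall => j; apply: mset_imp => jn; apply: mset_lt => //.
apply: measurable_funD => //; apply: measurable_hinc => k kj; apply: mI.
by move: kj jn; lia.
Qed.

Lemma Pr_rstay s z m n : (m <= n)%N -> Pr (rstay s z m n) = surv s z m.
Proof.
move=> mn; rewrite -[surv s z m]/(Pr _) -[RHS](Pr_reind mu_iid (@revn_inj n)); last exact: measurable_stay.
congr (Pr _); apply/seteqP; split => w h j jm.
  by rewrite hinc_rev ?subn0; [exact: h|lia].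
by have := h j jm; rewrite hinc_rev ?subn0//; lia.
Qed.

Lemma measurable_bridge s u z v n : measurable (bridge s u z v n : set OmT).
Proof.
apply: mset_and; first exact: measurable_box.
by apply: mset_and; [exact: measurable_stay|exact: measurable_rstay].
Qed.

(** This symmetry lets the second half of a bridge be treated as the first half of another. *)
Lemma bridge_rev s u z v n w :
  bridge s u z v n (reind (revn n) w) = bridge (~~ s) z u v n w.
Proof.
have bE : box v 0 n (reind (revn n) w) = box v 0 n w.
  rewrite /box /=; apply/propext; split => h i; have := h i.
    by rewrite inc_rev ?leqnn// subnn subn0.
  by rewrite inc_rev ?leqnn// subnn subn0.
have sE s' u' : stay s' u' n (reind (revn n) w) = rstay s' u' n n w.
  rewrite /stay /rstay /=; apply/propext; split => h j jn; have := h j jn;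
  by rewrite hinc_rev ?subn0//; move: jn; lia.
have rE s' u' : rstay s' u' n n (reind (revn n) w) = stay s' u' n w.
  rewrite /stay /rstay /=; apply/propext; split => h j jn; have := h j jn;
  by (rewrite hinc_rev ?subnn; last by move: jn; lia); rewrite subKn//; case/andP: jn.
rewrite /bridge /= bE sE rE negbK; apply/propext; split => -[h1 [h2 h3]]; split => //.
Qed.

(** Initial and final steps are independent, and given both, the middle steps must hit one unit
    box. *)
Lemma box_sandwich a b n (A1 : set (@Om _ E (fun k => (k < a)%N)))
    (A2 : set (@Om _ E (fun k => (b <= k)%N))) (B : set OmT) v q :
  (a <= b <= n)%N -> measurable A1 -> measurable A2 -> measurable B ->
  (forall z, Pr (box z 0 (b - a)) <= q) ->
  (forall w, B w -> [/\ A1 w, A2 w & box v 0 n w]) ->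
  Pr B <= Pr A1 * Pr A2 * q.
Proof.
move=> abn mA1 mA2 mB hq BA; have /andP[ab bn] := abn.
pose I : pred nat := fun k => ~~ (a <= k < b)%N.
have mA1' : measurable (A1 : set (@Om _ E I)).
  by apply: measurable_OmW mA1 => k; rewrite !unfold_in /I /=; clear; lia.
have mA2' : measurable (A2 : set (@Om _ E I)).
  by apply: measurable_OmW mA2 => k; rewrite !unfold_in /I /=; clear; lia.
have -> : Pr A1 * Pr A2 = Pr (A1 `&` A2).
  rewrite (Pr_indep mu_iid (I := fun k => (k < a)%N) (J := fun k => (b <= k)%N))//.
  by move=> k /= ka; lia.
apply: (@local_split _ _ _ _ mu_iid a b n (A1 `&` A2) setT _ v) => //.
- exact: measurableI.
- move=> z; rewrite (_ : [set w | _] = box z a b); last by apply/seteqP; split => w // [].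
  by rewrite (Pr_box mu_iid).
- by move=> w /BA[]; split.
Qed.

Variables (cF C4 C8 C12 : R) (M : nat).
Hypotheses (cF_ge1 : 1 <= cF) (M_gt0 : (0 < M)%N)
  (tail_gt0 : forall t, 0 < tail t)
  (tail_double : forall t, 1 <= t -> tail t <= cF * tail (2 * t))
  (tail_half : forall t, 1 <= t -> tail (2 ^+ M * t) <= tail t / 2)
  (C4_gt0 : 0 < C4)
  (tail_loc : forall t z, 1 <= t ->
     Pr [set w | t < norm1 (w 0%N) /\ box z 0 1 w] <= C4 * (tail t / t ^+ D))
  (C8_gt0 : 0 < C8)
  (exc_le : forall n x, 1 <= x -> Pr (exceed 0 n x) <= C8 * (n%:R * tail x))
  (C12_gt0 : 0 < C12)
  (exc0_le : forall s (u : R) m x, 0 < u -> 1 <= x ->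
     Pr (excur0 s u m x) <= C12 * (renewal s u m * surv_sum s m * tail x)).

Let cF0 : 0 < cF. Proof. exact: lt_le_trans cF_ge1. Qed.

(* Given the other steps, the jump at time [k] has to hit a prescribed box. *)
Lemma bridge_big_jump s u z v n t : 0 < u -> 0 < z -> 1 <= t -> (0 < n)%N ->
  Pr [set w | bridge s u z v n w /\ exists k, (k < n)%N /\ t < norm1 (w k)] <=
  C4 * (tail t / t ^+ D) * (renewal s u n * renewal (~~ s) z n).
Proof.
case: n => // n u0 z0 t1 _.
pose q := C4 * (tail t / t ^+ D).
have q0 : 0 <= q.
  by rewrite mulr_ge0 ?(ltW C4_gt0)// divr_ge0 ?tail_ge0// exprn_ge0// (le_trans ler01).
pose B k := [set w : nat -> E | bridge s u z v n.+1 w /\ t < norm1 (w k)].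
have mB k : measurable (B k : set OmT).
  by apply: mset_and; [exact: measurable_bridge|exact: measurable_jump].
have mE : measurable ([set w | bridge s u z v n.+1 w /\ exists k, (k < n.+1)%N /\ t < norm1 (w k)] : set OmT).
  apply: mset_and; first exact: measurable_bridge.
  by apply: mset_exists => k; apply: mset_andp => _; exact: measurable_jump.
apply: (@le_trans _ _ (\sum_(k < n.+1) Pr (B k))).
  by apply: Pr_le_sum => // w [bw [k [kn tk]]]; exists k.
apply: (@le_trans _ _ (\sum_(k < n.+1) surv s u k * surv (~~ s) z (n - k) * q)); last first.
  rewrite -mulr_suml mulrC ler_wpM2l//.
  apply: le_trans (surv_conv mu_iid s n u0 z0) _.
  by apply: ler_pM; rewrite ?renewal_ge0 ?renewal_le.
apply: ler_sum => -[k /= kn] _.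
have kn' : (k <= n)%N by [].
pose A1 := stay s u k : set (nat -> E).
pose A2 := rstay (~~ s) z (n - k) n.+1.
have m1 : measurable (A1 : set (@Om _ E (fun j => (j < k)%N))) by exact: measurable_stay.
have m2 : measurable (A2 : set (@Om _ E (fun j => (k.+1 <= j)%N))).
  by apply: measurable_rstay => j; move: kn'; clear; lia.
have -> : surv s u k * surv (~~ s) z (n - k) = Pr (A1 `&` A2).
  rewrite (Pr_indep mu_iid (I := fun j => (j < k)%N) (J := fun j => (k.+1 <= j)%N))//.
    by rewrite Pr_rstay// (leq_trans (leq_subr _ _)).
  by move=> j /=; clear; lia.
apply: (@local_split _ _ _ _ mu_iid k k.+1 n.+1 _ [set w | t < norm1 (w k)] _ v) => //.
- by rewrite leqnSn.
- apply: measurableI; [apply: measurable_OmW m1|apply: measurable_OmW m2];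
    by move=> j; rewrite !unfold_in /=; clear; lia.
- by apply: measurable_jump; rewrite leqnn ltnS leqnn.
- by move=> y; exact: (tail_loc_at mu_iid tail_loc).
- move=> w [[bw [st rst]] tw]; split => //; split.
    by move=> j jk; apply: st; move: jk kn'; clear; lia.
  by move=> j jk; apply: rst; move: jk kn'; clear; lia.
Qed.

Lemma tail_shrink a t : 1 <= t -> tail t <= cF ^+ a * tail (2 ^+ a * t).
Proof.
move=> t1; elim: a => [|a IH]; first by rewrite !mul1r.
apply: le_trans IH _; rewrite [cF ^+ a.+1]exprSr -mulrA ler_wpM2l ?exprn_ge0 ?(ltW cF0)//.
rewrite exprS -mulrA; apply: tail_double.
by rewrite -[leLHS]mulr1 ler_pM// pow2_ge1.
Qed.

(** For r > b choose [j] with [2 ^ (M * j) * b <= r < 2 ^ (M * j.+1) * b]. Then [n * tail r] is at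
    most 2 ^ (-j), whose power [M * D] compares with (b / r) ^ D up to the factor [2 ^ (M * D)]. *)
Lemma power_comparison n J r : n%:R * tail (2 ^+ J) <= 1 -> 0 < r ->
  n%:R * tail r <= 1 ->
  (n%:R * tail r) ^+ (M * D) / (2 ^+ J) ^+ D <= 2 ^+ (M * D) / r ^+ D.
Proof.
move=> nJ r0 nr.
have b1 : (1 : R) <= 2 ^+ J by exact: pow2_ge1.
set b : R := 2 ^+ J in nJ b1 *.
have b0 : 0 < b by apply: lt_le_trans b1.
have nr0 : 0 <= n%:R * tail r by rewrite mulr_ge0// tail_ge0.
have [rb|br] := leP r b.
  apply: ler_pM.
  - exact: exprn_ge0.
  - by rewrite invr_ge0 exprn_ge0// ltW.
  - by rewrite (le_trans (exprn_ile1 _ nr0 nr))// pow2_ge1.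
  - by rewrite lef_pV2 ?posrE ?exprn_gt0//; apply: lerXn2r; rewrite ?nnegrE// ltW.
have ex : exists j, r < 2 ^+ (M * j.+1) * b.
  exists (Num.truncn r); apply: (@lt_le_trans _ _ (Num.truncn r).+1%:R).
    by have /andP[] := truncn_itv (ltW r0).
  apply: (@le_trans _ _ (2 ^+ (M * (Num.truncn r).+1))); last by rewrite ler_peMr// exprn_ge0.
  apply: (@le_trans _ _ (2 ^+ (Num.truncn r).+1)).
    by rewrite -natrX ler_nat ltnW// ltn_expl.
  by rewrite ler_weXn2l ?ler1n// leq_pmull.
have [j rj minj] := ex_minnP ex.
have jr : 2 ^+ (M * j) * b <= r.
  case: j rj minj => [|j] rj minj; first by rewrite muln0 mul1r ltW.
  by rewrite leNgt; apply/negP => /minj; rewrite ltnn.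
have t1 : 2 ^+ j * (n%:R * tail r) <= 1.
  apply: le_trans nJ; rewrite mulrCA ler_wpM2l//.
  apply: le_trans (tail_iter tail_half j b1); rewrite ler_wpM2l ?exprn_ge0//.
  exact: tail_le.
have p0 : 0 < r ^+ D by rewrite exprn_gt0.
have bD : 0 < b ^+ D by rewrite exprn_gt0.
rewrite ler_pdivrMr// mulrAC ler_pdivlMr//.
apply: (@le_trans _ _ ((n%:R * tail r) ^+ (M * D) * (2 ^+ (M * j.+1) * b) ^+ D)).
  rewrite ler_wpM2l ?exprn_ge0//; apply: lerXn2r; rewrite ?nnegrE ?(ltW r0) ?(ltW rj)//.
  by rewrite mulr_ge0 ?exprn_ge0// ltW.
rewrite [(_ * b) ^+ D]exprMn mulrA ler_wpM2r ?(ltW bD)//.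
have -> : (2 ^+ (M * j.+1)) ^+ D = (2 ^+ j) ^+ (M * D) * 2 ^+ (M * D) :> R.
  by rewrite -!exprM -exprD; congr (_ ^+ _); clear; nia.
by rewrite mulrA -exprMn ler_piMl ?exprn_ge0// exprn_ile1// 1?mulrC// mulr_ge0 ?exprn_ge0.
Qed.

(** Survival up to [h] supplies a factor [surv_sum (~~ s) h / h.+1]; with [surv_sum s m] this is at
    most (2n + 1) / (h + 1), hence the 12 = 3 * 4. *)
Lemma survival_product s u z m h n : 0 < u -> 0 < z -> (m <= n)%N -> (h <= n)%N ->
  (0 < n)%N -> (n <= 4 * h.+1)%N ->
  renewal s u m * surv_sum s m * surv (~~ s) z h <= 12 * (renewal s u n * renewal (~~ s) z n).
Proof.
move=> u0 z0 mn hn n0 n4.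
have e1 := surv_renewal_le mu_iid (~~ s) h z0.
have e2 := surv_sum_prod mu_iid s n.
have e3 := surv_sum_le mu s mn.
have e4 := surv_sum_le mu (~~ s) hn.
have e5 := renewal_le mu s u mn.
have e6 := renewal_le mu (~~ s) z hn.
have A1 := surv_sum_ge1 mu s m; have B1 := surv_sum_ge1 mu (~~ s) h.
have R0 := renewal_ge0 mu s u m; have R'0 := renewal_ge0 mu (~~ s) z h.
have An0 : 0 <= surv_sum s n by apply: le_trans (surv_sum_ge1 mu s n).
have Rn0 := renewal_ge0 mu s u n; have R'n0 := renewal_ge0 mu (~~ s) z n.
have h0 : 0 < h.+1%:R :> R by rewrite ltr0n.
have A0 : 0 <= surv_sum s m by apply: le_trans A1.
have B0 : 0 <= surv_sum (~~ s) h by apply: le_trans B1.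
rewrite -(ler_pM2l h0).
apply: (@le_trans _ _ (renewal s u n * surv_sum s n * (renewal (~~ s) z n * surv_sum (~~ s) n))).
  rewrite mulrCA; apply: ler_pM.
  - exact: mulr_ge0.
  - by rewrite mulr_ge0// surv_ge0.
  - exact: ler_pM.
  - by apply: le_trans e1 _; exact: ler_pM.
have -> : renewal s u n * surv_sum s n * (renewal (~~ s) z n * surv_sum (~~ s) n) =
  surv_sum s n * surv_sum (~~ s) n * (renewal s u n * renewal (~~ s) z n) by ring.
rewrite [leRHS]mulrA ler_wpM2r ?mulr_ge0//; apply: le_trans e2 _.
by rewrite -natrM ler_nat; move: n0 n4; clear; lia.
Qed.

Lemma bridge_bound : exists2 C, 0 < C & exists r0, forall n u z v r,
  (0 < n)%N -> 0 < u -> 0 < z -> r0 <= r ->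
  (forall w : nat -> E, box v 0 n w -> r / 2 <= ninc 0 n w) ->
  Pr (bridge true u z v n) <= C * (tail r / r ^+ D) * (renewal true u n * renewal false z n).
Proof.
have [c c0 sc] := exists_scale cF_ge1 tail_gt0 tail_double tail_half.
(* Concentration is applied to blocks of at least [n / 8] steps at the scale of [n]. *)
have c80 : 0 < c / 8 by rewrite divr_gt0.
have [Cc Cc0 conc] := concentration mu_iid cF_ge1 M_gt0 tail_gt0 tail_double tail_half C4_gt0 tail_loc c80.
(* The exponent of [power_comparison]. [excur_chain] needs [2 p + 1] levels for it, so jumps are cut
   at [r / (4 * N)], and [a] doublings lead from there back beyond [r]. *)
pose p := (M * D)%N.
pose N : R := p.*2.+1%:R.
have N1 : 3 <= N.
  have p0 : (0 < p)%N by rewrite muln_gt0 M_gt0.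
  by rewrite /N ler_nat ltnS -(doubleS 0) leq_double.
pose a := (4 * p.*2.+1)%N.
have Na : 4 * N <= 2 ^+ a by rewrite -natrM -natrX ler_nat ltnW// ltn_expl.
pose K1 := C4 * cF ^+ a * (4 * N) ^+ D.
pose K2 := 12 * C12 * cF ^+ a * (C8 * cF ^+ a) ^+ p * Cc * 2 ^+ p.
pose K3 := 48 * Cc / c * 2 ^+ p.
have cFa : 0 < cF ^+ a by rewrite exprn_gt0.
have K10 : 0 < K1 by rewrite !mulr_gt0// exprn_gt0// mulr_gt0// (lt_le_trans _ N1).
have K20 : 0 < K2 by rewrite !mulr_gt0// exprn_gt0// mulr_gt0.
have K30 : 0 < K3 by rewrite !mulr_gt0 ?invr_gt0// exprn_gt0.
have KK1 : 0 <= K1 + 2 * K2 by rewrite ltW// addr_gt0// mulr_gt0.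
have KK2 : 0 <= 2 * K2 + K3 by rewrite ltW// addr_gt0// mulr_gt0.
exists (K1 + 2 * K2 + K3); first by rewrite !addr_gt0// mulr_gt0.
(* The first entry makes [eta] at least 1, the second makes [tail r] at most 1/4. *)
exists (Num.max (4 * N) (2 ^+ (M * 2))) => n u z v r n0 u0 z0.
rewrite ge_max => /andP[r4N r2M] hr.
have r0 : 0 < r by apply: lt_le_trans r4N; rewrite mulr_gt0// (lt_le_trans _ N1).
have Tr := tail_gt0 r.
have rD : 0 < r ^+ D by rewrite exprn_gt0.
have RR0 : 0 <= renewal true u n * renewal false z n by rewrite mulr_ge0// renewal_ge0.
have g0 : 0 <= tail r / r ^+ D by apply: divr_ge0; exact: ltW.
have [J /andP[cJ nJ]] := sc n n0.
pose b : R := 2 ^+ J.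
have b1 : 1 <= b by exact: pow2_ge1.
have b0 : 0 < b by apply: lt_le_trans b1.
have bD : 0 < b ^+ D by rewrite exprn_gt0.
have blocks len : (n <= 8 * len)%N -> (len <= n)%N -> forall y, Pr (box y 0 len) <= Cc / b ^+ D.
  move=> l8 ln y; apply: conc.
    rewrite ler_pdivrMr// mulrAC; apply: le_trans cJ _; rewrite ler_wpM2r ?tail_ge0//.
    by rewrite -natrM ler_nat mulnC.
  by apply: le_trans nJ; rewrite ler_wpM2r ?tail_ge0// ler_nat.
have [nr|nr] := ltP (n%:R * tail r) 1; last first.
  (* [r] is at most of the order of the scale [b], and pinning the middle third
     of the path by the concentration bound suffices. *)
  have n3 : (2 < n)%N.
    rewrite ltnNge; apply/negP => n2.
    have h := tail_iter tail_half 2 (lexx 1); rewrite mulr1 in h.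
    have h2 := tail_le mu r2M; have h3 := tail_le1 mu 1.
    have : n%:R * tail r <= 2 * tail r by rewrite ler_wpM2r ?tail_ge0// ler_nat.
    move: h; rewrite expr2; lra.
  pose h := (n %/ 3)%N.
  have hE : (3 * h <= n < 3 * h + 3)%N.
    by rewrite /h; move: (divn_eq n 3) (ltn_pmod n (ltn0Sn 2)); clear; lia.
  have hn : (h <= n - h <= n)%N by move: hE; clear; lia.
  have S1 : Pr (bridge true u z v n) <= Pr (stay true u h) * Pr (rstay false z h n) * (Cc / b ^+ D).
    apply: (@box_sandwich h (n - h) n (stay true u h) (rstay false z h n) _ v) => //.
    - exact: measurable_stay.
    - by apply: measurable_rstay => j /andP[].
    - exact: measurable_bridge.
    - by apply: blocks; move: hE n3; clear; lia.
    - move=> w [bw [st rst]]; split => // j jh; [apply: st|apply: rst];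
        by move: jh hE; clear; lia.
  rewrite Pr_rstay in S1; last by move: hE; clear; lia.
  have hn' : (h <= n)%N by move: hE; clear; lia.
  have sp : n%:R * (Pr (stay true u h) * surv false z h) <= 48 * (renewal true u n * renewal false z n).
    have e1 := surv_renewal_le mu_iid true h u0.
    have e2 : (n <= 4 * h.+1)%N by move: hE; clear; lia.
    have := @survival_product true u z h h n u0 z0 hn' hn' n0 e2.
    have sv0 := surv_ge0 mu false z h.
    move=> e3; have n4 : n%:R <= 4 * h.+1%:R :> R by rewrite -natrM ler_nat.
    apply: (@le_trans _ _ (4 * (h.+1%:R * surv true u h) * surv false z h)).
      rewrite !mulrA ler_wpM2r//; rewrite ler_wpM2r ?surv_ge0//.
    apply: (@le_trans _ _ (4 * (renewal true u h * surv_sum true h) * surv false z h)).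
      by rewrite ler_wpM2r// ler_wpM2l.
    rewrite -mulrA; have -> : (48 : R) = 4 * 12 by rewrite -natrM.
    by rewrite -[leRHS]mulrA ler_wpM2l.
  (* If [r] exceeded [2 ^ M * b], then [tail r] would be at most half of [tail b] and [n * tail r]
     below 1. *)
  have gb : tail b / b ^+ D <= 2 ^+ p * (tail r / r ^+ D).
    have p1 : (1 : R) <= 2 ^+ p by exact: pow2_ge1.
    have [rb|br] := leP r b.
      apply: (@le_trans _ _ (tail r / r ^+ D)); last by rewrite ler_peMl.
      apply: ler_pM; rewrite ?tail_ge0 ?invr_ge0 ?(ltW bD) ?tail_le//.
      by rewrite lef_pV2 ?posrE//; apply: lerXn2r; rewrite ?nnegrE// ltW.
    have n0' : 0 < n%:R :> R by rewrite ltr0n.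
    have tbr : tail b <= tail r.
      by rewrite -(ler_pM2l n0'); apply: le_trans nr.
    have rMb : r <= 2 ^+ M * b.
      rewrite leNgt; apply/negP => Mr; have := tail_half b1; have := tail_le mu (ltW Mr).
      have := tail_gt0 b; have : n%:R * tail b <= n%:R * tail r by exact: le_trans nr.
      move=> h1 h2 h3 h4; have : n%:R * tail b < n%:R * tail b; last by rewrite ltxx.
      apply: le_lt_trans h1 _; rewrite ltr_pM2l//; lra.
    rewrite mulrCA; apply: ler_pM; rewrite ?tail_ge0 ?invr_ge0 ?(ltW bD)//.
    rewrite ler_pdivlMr// mulrC ler_pdivrMr// /p exprM -exprMn.
    apply: lerXn2r rMb; rewrite nnegrE; first exact: ltW.
    by rewrite mulr_ge0 ?exprn_ge0// ltW.
  have fin : Pr (bridge true u z v n) <= K3 * (tail r / r ^+ D) * (renewal true u n * renewal false z n).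
    apply: le_trans S1 _.
    have ss0 : 0 <= Pr (stay true u h) * surv false z h by rewrite mulr_ge0// ?Pr_ge0// surv_ge0.
    apply: (@le_trans _ _ (48 * Cc / c * (renewal true u n * renewal false z n) * (tail b / b ^+ D))).
      have -> : 48 * Cc / c * (renewal true u n * renewal false z n) * (tail b / b ^+ D) =
        (48 * (renewal true u n * renewal false z n)) * (tail b / c) * (Cc / b ^+ D) by ring.
      rewrite ler_wpM2r ?divr_ge0 ?(ltW Cc0) ?(ltW bD)//.
      apply: (@le_trans _ _ (n%:R * (Pr (stay true u h) * surv false z h) * (tail b / c))).
        have -> : n%:R * (Pr (stay true u h) * surv false z h) * (tail b / c) =
          (Pr (stay true u h) * surv false z h) * (n%:R * tail b / c) by ring.
        by rewrite ler_peMr// ler_pdivlMr// mul1r.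
      by rewrite ler_wpM2r// divr_ge0 ?tail_ge0 ?(ltW c0).
    have -> : K3 * (tail r / r ^+ D) * (renewal true u n * renewal false z n) =
      48 * Cc / c * (renewal true u n * renewal false z n) * (2 ^+ p * (tail r / r ^+ D)) by rewrite /K3; ring.
    by rewrite ler_wpM2l// mulr_ge0// divr_ge0 ?mulr_ge0 ?(ltW Cc0) ?(ltW c0).
  apply: le_trans fin _; by rewrite ler_wpM2r// ler_wpM2r// lerDr.
(* Either some jump exceeds [eta], or one half of the path reaches distance
   [r / 4] by smaller jumps, which costs [(n * tail r) ^ p]; time reversal
   exchanges the halves. *)
pose eta : R := r / (4 * N).
have N0 : 0 < N by apply: lt_le_trans N1.
have eta1 : 1 <= eta by rewrite ler_pdivlMr ?mul1r// mulr_gt0.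
have eta0 : 0 < eta by apply: lt_le_trans eta1.
have rE : r / 4 = N * eta by rewrite /eta; field; rewrite gt_eqF.
have Teta : tail eta <= cF ^+ a * tail r.
  apply: le_trans (tail_shrink a eta1) _; rewrite ler_wpM2l ?(ltW cFa)//.
  apply: tail_le; apply: (@le_trans _ _ (4 * N * eta)).
    by rewrite -mulrA -rE mulrC divfK.
  by rewrite ler_wpM2r// ltW.
pose nojump : set (nat -> E) := [set w | forall k, (k < n)%N -> norm1 (w k) <= eta].
have mnj : measurable (nojump : set OmT).
  by apply: mset_forall => k; apply: mset_imp => _; exact: measurable_nojump.
pose piece s u' z' m := [set w | bridge s u' z' v n w /\ (nojump w /\ r / 4 <= ninc 0 m w)].
have mpiece s u' z' m : measurable (piece s u' z' m : set OmT).
  apply: mset_and; first exact: measurable_bridge.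
  by apply: mset_and => //; apply: mset_le => //; exact: measurable_ninc.
(* The first [m] steps make the excursion, the last quarter survives backwards from [z'], and the
   steps between, at least an eighth of all, hit the box. *)
have piece_le s u' z' m : 0 < u' -> 0 < z' -> (3 < n)%N -> (2 * m <= n.+1)%N ->
    Pr (piece s u' z' m) <= K2 * (tail r / r ^+ D) * (renewal s u' n * renewal (~~ s) z' n).
  move=> u'0 z'0 n4 m2.
  pose h := (n %/ 4)%N.
  have hE : (4 * h <= n < 4 * h + 4)%N.
    by rewrite /h; move: (divn_eq n 4) (ltn_pmod n (ltn0Sn 3)); clear; lia.
  have mn : (m <= n)%N by move: m2 n0; clear; lia.
  have mh : (m <= n - h <= n)%N by move: m2 hE n4; clear; lia.
  have hn : (h <= n)%N by move: hE; clear; lia.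
  have S1 : Pr (piece s u' z' m) <= Pr (excur s u' m (N * eta) eta) *
      Pr (rstay (~~ s) z' h n) * (Cc / b ^+ D).
    apply: (@box_sandwich m (n - h) n (excur s u' m (N * eta) eta) (rstay (~~ s) z' h n) _ v) => //.
    - exact: measurable_excur.
    - by apply: measurable_rstay => j /andP[].
    - by apply: blocks; move: hE n4 m2; clear; lia.
    - move=> w [[bw [st rst]] [nj rm]]; split => //.
        exists m; split => //; split; [by rewrite -rE| |] => j jm.
          by apply: st; move: jm mn; clear; lia.
        by apply: nj; exact: leq_trans mn.
      by move=> j jh; apply: rst; move: jh hn; clear; lia.
  rewrite Pr_rstay// in S1; apply: le_trans S1 _.
  have e1 := excur_chain mu_iid s u' m p eta0.
  have e2 := exc0_le s m u'0 eta1.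
  have e3 : Pr (exceed 0 m eta) <= C8 * cF ^+ a * (n%:R * tail r).
    apply: le_trans (exc_le m eta1) _; rewrite -mulrA ler_pM2l//.
    rewrite mulrCA; apply: ler_pM; rewrite ?tail_ge0// ler_nat//.
  have e4 : Pr (exceed 0 m eta) ^+ p <= (C8 * cF ^+ a) ^+ p * (n%:R * tail r) ^+ p.
    rewrite -exprMn; apply: lerXn2r e3; rewrite nnegrE ?Pr_ge0//.
    by rewrite !mulr_ge0 ?(ltW C8_gt0) ?(ltW cFa) ?tail_ge0.
  have e5 := power_comparison nJ r0 (ltW nr); rewrite -/p -/b in e5.
  have e6 := @survival_product s u' z' m h n u'0 z'0 mn hn n0.
  have {}e6 := e6 ltac:(move: hE; clear; lia).
  have sv0 := surv_ge0 mu (~~ s) z' h.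
  pose RA := renewal s u' m * surv_sum s m.
  have RA0 : 0 <= RA.
    by rewrite mulr_ge0 ?renewal_ge0//; exact: le_trans (surv_sum_ge1 mu s m).
  apply: (@le_trans _ _ (C12 * (RA * (cF ^+ a * tail r)) *
      ((C8 * cF ^+ a) ^+ p * (n%:R * tail r) ^+ p) * surv (~~ s) z' h * (Cc / b ^+ D))).
    rewrite ler_wpM2r ?divr_ge0 ?(ltW Cc0) ?(ltW bD)// ler_wpM2r//.
    apply: le_trans e1 _; apply: ler_pM; rewrite ?Pr_ge0 ?exprn_ge0 ?Pr_ge0//.
    by apply: le_trans e2 _; rewrite ler_pM2l// ler_wpM2l.
  have -> : C12 * (RA * (cF ^+ a * tail r)) *
      ((C8 * cF ^+ a) ^+ p * (n%:R * tail r) ^+ p) * surv (~~ s) z' h * (Cc / b ^+ D) =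
      C12 * cF ^+ a * (C8 * cF ^+ a) ^+ p * Cc * tail r * (RA * surv (~~ s) z' h) *
      ((n%:R * tail r) ^+ p / b ^+ D) by ring.
  have -> : K2 * (tail r / r ^+ D) * (renewal s u' n * renewal (~~ s) z' n) =
      C12 * cF ^+ a * (C8 * cF ^+ a) ^+ p * Cc * tail r *
      (12 * (renewal s u' n * renewal (~~ s) z' n)) * (2 ^+ p / r ^+ D) by rewrite /K2; ring.
  have k0 : 0 <= C12 * cF ^+ a * (C8 * cF ^+ a) ^+ p * Cc * tail r.
    by rewrite !mulr_ge0 ?exprn_ge0 ?mulr_ge0 ?(ltW C12_gt0) ?(ltW C8_gt0) ?(ltW cFa) ?(ltW Cc0) ?(ltW Tr) ?(ltW cF0).
  apply: ler_pM => //.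
  - by apply: mulr_ge0 => //; exact: mulr_ge0.
  - by rewrite divr_ge0 ?exprn_ge0 ?mulr_ge0 ?tail_ge0 ?(ltW b0).
  - by apply: ler_wpM2l; [exact: k0|exact: e6].
have mbig : measurable ([set w | bridge true u z v n w /\ exists k, (k < n)%N /\ eta < norm1 (w k)] : set OmT).
  apply: mset_and; first exact: measurable_bridge.
  by apply: mset_exists => k; apply: mset_andp => _; exact: measurable_jump.
have big : Pr [set w | bridge true u z v n w /\ exists k, (k < n)%N /\ eta < norm1 (w k)] <=
    K1 * (tail r / r ^+ D) * (renewal true u n * renewal false z n).
  apply: le_trans (bridge_big_jump true v u0 z0 eta1 n0) _.
  rewrite ler_wpM2r// /K1 -!mulrA ler_pM2l//.
  have -> : cF ^+ a * ((4 * N) ^+ D * (tail r / r ^+ D)) = cF ^+ a * tail r / eta ^+ D.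
    rewrite /eta expr_div_n invf_div; ring.
  by rewrite ler_wpM2r// invr_ge0 exprn_ge0// ltW.
(* Up to three jumps of size at most [eta] cannot cover [r / 2], so a big jump is certain. *)
have [n4|n4] := ltnP 3 n; last first.
  have sub : Pr (bridge true u z v n) <= Pr [set w | bridge true u z v n w /\ exists k, (k < n)%N /\ eta < norm1 (w k)].
    apply: le_Pr => //; first exact: measurable_bridge.
    move=> w bw; split => //; apply: contrapT => nj.
    have nj' k : (k < n)%N -> norm1 (w k) <= eta.
      by move=> kn; rewrite leNgt; apply/negP => ek; apply: nj; exists k.
    have [bx _] := bw; have := hr w bx.
    have sumle m : (m <= n)%N -> ninc 0 m w <= m%:R * eta.
      elim: m => [|m IH] mn; first by rewrite ninc_nil mul0r.
      have := @ninc_triangle R d 0 m m.+1 w; rewrite leqnSn => /(_ isT).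
      rewrite ninc1 -natr1; have := IH (ltnW mn); have := nj' m mn; nra.
    have := sumle n (leqnn n).
    have : n%:R * eta <= 3 * eta by rewrite ler_wpM2r ?(ltW eta0)// ler_nat.
    have : 3 * eta <= N * eta by rewrite ler_wpM2r// ltW.
    rewrite -rE; lra.
  apply: le_trans sub _; apply: le_trans big _; rewrite ler_wpM2r// ler_wpM2r//.
  by rewrite -addrA lerDl.
pose m1 := (n %/ 2)%N; pose m2 := (n - m1)%N.
have mE : (2 * m1 <= n < 2 * m1 + 2)%N.
  by rewrite /m1; move: (divn_eq n 2) (ltn_pmod n (ltn0Sn 1)); clear; lia.
have m1n : (m1 <= n)%N by move: mE; clear; lia.
have P1 := @piece_le true u z m1 u0 z0 n4 ltac:(move: mE; clear; lia).
have P2 := @piece_le false z u m2 z0 u0 n4 ltac:(rewrite /m2; move: mE; clear; lia).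
have revE : Pr (piece false z u m2) = Pr [set w | bridge true u z v n w /\ (nojump w /\ r / 4 <= ninc m1 n w)].
  rewrite -[LHS](Pr_reind mu_iid (@revn_inj n)) //; congr (Pr _).
  have nE w : ninc 0 m2 (reind (revn n) w) = ninc m1 n w.
    by apply: eq_bigr => i _; rewrite inc_rev ?leq_subr// subn0 /m2 subKn.
  have jE w : nojump (reind (revn n) w) <-> nojump w.
    split => h k kn; rewrite /reind; last first.
      by apply: h; rewrite /revn kn; move: kn; clear; lia.
    have := h (n - k.+1)%N; rewrite /reind /revn ifT; last by move: kn; clear; lia.
    have -> : (n - (n - k.+1).+1 = k)%N by move: kn; clear; lia.
    by apply; move: kn; clear; lia.
  apply/seteqP; split => w; rewrite /piece /= bridge_rev nE => -[h1 [h2 h3]]; split => //; split => //; exact/jE.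
have m3 : measurable ([set w | bridge true u z v n w /\ (nojump w /\ r / 4 <= ninc m1 n w)] : set OmT).
  apply: mset_and; first exact: measurable_bridge.
  by apply: mset_and => //; apply: mset_le => //; exact: measurable_ninc.
have step : Pr (bridge true u z v n) <=
   Pr [set w | bridge true u z v n w /\ exists k, (k < n)%N /\ eta < norm1 (w k)] +
   (Pr (piece true u z m1) + Pr [set w | bridge true u z v n w /\ (nojump w /\ r / 4 <= ninc m1 n w)]).
  apply: le_trans (_ : _ <= Pr [set w | bridge true u z v n w /\ exists k, (k < n)%N /\ eta < norm1 (w k)] +
    Pr (piece true u z m1 `|` [set w | bridge true u z v n w /\ (nojump w /\ r / 4 <= ninc m1 n w)])) _; last first.
    by rewrite lerD2l; exact: Pr_setU.
  apply: Pr_le2 => //; [exact: measurable_bridge|exact: measurableU|].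
  move=> w bw; have [|nj] := pselect (exists k, (k < n)%N /\ eta < norm1 (w k)); first by left.
  have nj' : nojump w.
    by move=> k kn; rewrite leNgt; apply/negP => ek; apply: nj; exists k.
  right; have [h1|h1] := leP (r / 4) (ninc 0 m1 w); first by left.
  right; split => //; split => //.
  have [bx _] := bw; have := hr w bx.
  have := @ninc_triangle R d 0 m1 n w; rewrite leq0n m1n => /(_ isT); lra.
rewrite -revE in step; apply: le_trans step _.
rewrite /= in P2; rewrite [renewal false z n * _]mulrC in P2.
have X0 : 0 <= (tail r / r ^+ D) * (renewal true u n * renewal false z n) by rewrite mulr_ge0.
have : 0 <= K3 * ((tail r / r ^+ D) * (renewal true u n * renewal false z n)).
  by rewrite mulr_ge0// ltW.
move: big P1 P2; move: (tail r / r ^+ D) (renewal true u n * renewal false z n) X0 => G RR X0.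
move: (Pr (piece true u z m1)) (Pr (piece false z u m2)) => p1 p2.
move: (Pr _) => p3; move: KK1 KK2; move=> _ _ h1 h2 h3 h4; lra.
Qed.

End bridge.

(** * Ladder heights *)

Section ladder.
Variables (R : realType) (d : nat).
Local Notation E := ((d.+1).-tuple R).
Local Notation OmT := (@Om _ E predT).
Variables (mu : probability OmT R) (nu : probability E R).
Hypothesis mu_iid : iid_law mu nu.
Local Notation Pr := (Pr mu).
Local Notation renewal := (renewal mu).
Variable s : bool.

Definition lad (w : nat -> E) : pred nat := fun m => (0 < m)%N && ~~ cmp s (hinc s 0 m w).

Definition lads : set (nat -> E) := [set w | exists m, lad w m].

(** The default 0 never contributes, as [Flad] integrates over [lads] only. *)
Definition chi (w : nat -> E) : R :=
  match pselect (exists m, lad w m) with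
  | left h => - hinc s 0 (ex_minn h) w | right _ => 0 end.

(* [Fminus] for [s = true], [Fplus] for [s = false]. *)
Fixpoint Flad (k : nat) (u : R) : \bar R :=
  match k with
  | 0 => ((if s then 0 <= u else 0 < u)%:R)%:E
  | k'.+1 => (\int[mu]_(w in lads) Flad k' (u - chi w))%E
  end.

Definition first_lad i : set (nat -> E) :=
  [set w | lad w i /\ forall j, (j < i)%N -> ~~ lad w j].

Lemma first_lad_chi i w : first_lad i w -> lads w /\ chi w = - hinc s 0 i w.
Proof.
move=> [li mi]; have ex : exists m, lad w m by exists i.
split => //; rewrite /chi; case: pselect => // h.
case: ex_minnP => m lm minm; congr (- hinc s 0 _ w); apply/eqP.
rewrite eqn_leq minm//= leqNgt; apply/negP => im.
by have := mi m im; rewrite lm.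
Qed.

Lemma lads_first_lad w : lads w -> exists i, first_lad i w.
Proof.
move=> h; have ex : exists m, lad w m := h.
case: (ex_minnP ex) => m lm minm; exists m; split => // j jm.
by apply/negP => /minm; rewrite leqNgt jm.
Qed.

Lemma first_lad_inj i j w : first_lad i w -> first_lad j w -> i = j.
Proof.
move=> [li mi] [lj mj]; have [ij|ji|//] := ltngtP i j.
  by have := mj i ij; rewrite li.
by have := mi j ji; rewrite lj.
Qed.

Lemma measurable_lad (I : pred nat) m : (forall j, (j < m)%N -> I j) ->
  measurable ([set w | lad w m] : set (@Om _ E I)).
Proof.
move=> mI; have -> : [set w | lad w m] = [set w | (0 < m)%N /\ ~~ cmp s (hinc s 0 m w)].
  by apply/seteqP; split => w /andP.
by apply: mset_andp => _; apply: mset_cmpN; apply: measurable_hinc => j /andP[_]; exact: mI.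
Qed.

Lemma measurable_first_lad (I : pred nat) i : (forall j, (j < i)%N -> I j) ->
  measurable (first_lad i : set (@Om _ E I)).
Proof.
move=> iI; apply: mset_and; first exact: measurable_lad.
apply: mset_forall => j; apply: mset_imp => ji.
have -> : (fun w : @Om _ E I => is_true (~~ lad w j)) = ~` [set w | lad w j].
  by apply/seteqP; split => w /negP.
by apply: measurableC; apply: measurable_lad => k kj; apply: iI; exact: ltn_trans ji.
Qed.

Lemma measurable_lads : measurable (lads : set OmT).
Proof. by apply: mset_exists => m; exact: measurable_lad. Qed.

Lemma measurable_chi : measurable_fun setT (chi : OmT -> R).
Proof.
move=> _ A mA; rewrite setTI.
have -> : chi @^-1` A = (\bigcup_i (first_lad i `&` ((fun w => - hinc s 0 i w) @^-1` A))) `|`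
    ((~` lads) `&` [set w | A 0]).
  apply/seteqP; split => w.
    move=> Aw; have [h|h] := pselect (lads w).
      have [i fi] := lads_first_lad h; left; exists i => //; split => //=.
      by have [_ <-] := first_lad_chi fi.
    right; split => //; move: Aw; rewrite /= /chi; case: pselect => //.
  move=> [[i _ [fi Ai]]|[nl A0]].
    by have [_ e] := first_lad_chi fi; rewrite /preimage/= e.
  by rewrite /preimage/= /chi; case: pselect.
apply: measurableU.
  apply: bigcup_measurable => i _; apply: measurableI; first exact: measurable_first_lad.
  rewrite -[X in measurable X]setTI; apply: measurableT_comp => //.
  exact: measurable_hinc.
by apply: measurableI; [apply: measurableC; exact: measurable_lads|exact: mset_cst].
Qed.

(** Proved jointly because Tonelli's theorem gives measurability in [u] only for a nonnegative
    integrand. *)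
Lemma Flad_ge0_measurable k : (forall u, 0 <= Flad k u)%E /\ measurable_fun setT (Flad k).
Proof.
elim: k => [|k [F0 mF]] /=.
  split => [u|]; first by rewrite lee_fin ler0n.
  apply/measurable_EFinP.
  have -> : (fun u : R => (if s then 0 <= u else 0 < u)%:R : R) =
     \1_(if s then `[0, +oo[%classic else `]0, +oo[%classic).
    apply/funext => u; rewrite indicE; case: (s).
      by rewrite mem_setE in_itv/= andbT.
    by rewrite mem_setE in_itv/= andbT.
  by apply: measurable_indic; case: (s).
split => [u|]; first by apply: integral_ge0 => w _; exact: F0.
pose f (p : R * OmT) : \bar R := (Flad k (p.1 - chi p.2) * (\1_lads p.2)%:E)%E.
have mf : measurable_fun setT f.
  apply: emeasurable_funM.
    apply: (measurableT_comp mF); apply: measurable_funB => //.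
    exact: (measurableT_comp measurable_chi).
  apply/measurable_EFinP; apply: (measurableT_comp _ measurable_snd).
  by apply: measurable_indic; exact: measurable_lads.
have f0 p : (0 <= f p)%E by rewrite mule_ge0// lee_fin.
have H := @measurable_fun_fubini_tonelli_F _ _ _ _ R mu f mf f0.
apply: eq_measurable_fun H => u _; rewrite /fubini_F /f/=.
rewrite [RHS]integral_mkcond; apply: eq_integral => w _.
by rewrite patchE indicE; case: ifP; rewrite ?mule1 ?mule0.
Qed.

Lemma renew_shift u i k (c : R) : (i <= k)%N ->
  Pr [set w | (forall j, (i <= j < k)%N -> ~~ cmp s (hinc s j k w)) /\ 0 < u + c + hinc s i k w] =
  renew mu s (u + c) (k - i).
Proof.
move=> ik; rewrite /renew -[RHS](Pr_reind mu_iid (@addn_inj i)); last first.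
  exact: measurable_renew.
have hE a b w : hinc s a b (reind (addn i) w) = hinc s (i + a) (i + b) w.
  by rewrite /hinc !inc_shift.
congr (Pr _); apply/seteqP; split => w [h1 h2]; split => /=.
- by move=> j jk; rewrite hE subnKC//; apply: h1; move: jk ik; lia.
- by rewrite hE addn0 subnKC.
- move=> j jk; have := h1 (j - i)%N; rewrite hE !subnKC//; last by case/andP: jk.
  by apply; move: jk; lia.
- by move: h2; rewrite hE addn0 subnKC.
Qed.

Let aft i k u (c : R) : set (nat -> E) :=
  [set w | (forall j, (i <= j < k)%N -> ~~ cmp s (hinc s j k w)) /\ 0 < u + c + hinc s i k w].

Let measurable_aft (I : pred nat) i k u c : (forall j, (i <= j < k)%N -> I j) ->
  measurable (aft i k u c : set (@Om _ E I)).
Proof.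
move=> ikI; apply: mset_and.
  apply: mset_forall => j; apply: mset_imp => jk; apply: mset_cmpN.
  by apply: measurable_hinc => m mk; apply: ikI; move: mk jk; lia.
by apply: mset_lt => //; apply: measurable_funD => //; exact: measurable_hinc.
Qed.

(* Markov property at the first ladder epoch. *)
Lemma renewal_step n u (g : R -> \bar R) : (forall v, 0 <= g v)%E -> measurable_fun setT g ->
  (forall v, (renewal s v n)%:E <= g v)%E ->
  ((\sum_(k < n.+1) renew mu s u k.+1)%:E <= \int[mu]_(w in lads) g (u - chi w)%R)%E.
Proof.
move=> g0 mg Rg.
pose I i : pred nat := fun j => (j < i.+1)%N.
pose J i : pred nat := fun j => (i.+1 <= j)%N.
(* The first ladder epoch is [i.+1], read off [p.1]; from there to the record at [k.+1] only the
   later steps [p.2] matter, besides the height already reached. *)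
pose C i k : set (@Om _ E (I i) * @Om _ E (J i)) := [set p | first_lad i.+1 p.1 /\
  ((forall j, (i.+1 <= j < k.+1)%N -> ~~ cmp s (hinc s j k.+1 p.2)) /\
   0 < u + hinc s 0 i.+1 p.1 + hinc s i.+1 k.+1 p.2)].
have mC i k : measurable (C i k).
  apply: mset_and.
    have mf : measurable (first_lad i.+1 : set (@Om _ E (I i))) by exact: measurable_first_lad.
    by rewrite -[X in measurable X]setTI; apply: (@measurable_fst _ _ (@Om _ E (I i)) (@Om _ E (J i))).
  have m2 a : (i.+1 <= a)%N -> measurable_fun setT (fun p : @Om _ E (I i) * @Om _ E (J i) => hinc s a k.+1 p.2).
    move=> ia; apply: (measurableT_comp (@measurable_hinc R d (J i) s a k.+1 _) measurable_snd).
    by move=> j /andP[aj _]; exact: leq_trans aj.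
  apply: mset_and.
    apply: mset_forall => j; apply: mset_imp => /andP[ij jk].
    have -> : (fun p : @Om _ E (I i) * @Om _ E (J i) => is_true (~~ cmp s (hinc s j k.+1 p.2))) =
       ~` [set p | cmp s (hinc s j k.+1 p.2)].
      by apply/seteqP; split => p /negP.
    apply: measurableC; rewrite /cmp; case: (s) m2 => m2;
      by [apply: mset_lt => //; exact: m2|apply: mset_le => //; exact: m2].
  apply: mset_lt => //; apply: measurable_funD; last exact: m2.
  apply: measurable_funD => //.
  apply: (measurableT_comp (@measurable_hinc R d (I i) s 0 i.+1 _) measurable_fst).
  by move=> j /andP[_].
have IJ i k : I i k -> ~~ J i k by rewrite /I /J -leqNgt.
have dec i k := mu_decouple mu_iid (@IJ i) (mC i k).
have step1 k : renew mu s u k.+1 <= \sum_(i < k.+1) Pr [set w | C i k (w, w)].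
  apply: (@Pr_le_sum _ _ _ _ _ _ (fun i => [set w | C i k (w, w)])).
  - exact: measurable_renew.
  - by move=> i ik; have [] := dec i k.
  move=> w [rk uk].
  have lk : lad w k.+1 by rewrite /lad /= rk.
  have [i fi] : exists i, first_lad i w by apply: lads_first_lad; exists k.+1.
  have ik : (i <= k.+1)%N.
    rewrite leqNgt; apply/negP => ki; case: fi => _ /(_ k.+1 ki).
    by rewrite lk.
  case: i fi ik => [|i] fi ik; first by case: fi => /andP[].
  exists i => //; split => //; split.
    by move=> j /andP[_]; exact: rk.
  by rewrite /= -addrA -(@hinc_cat _ _ s 0 i.+1 k.+1 w).
pose m i k w : \bar R := if (i <= k)%N then mu [set w' | C i k (w, w')] else 0%E.
have mm i k : measurable_fun [set: OmT] (m i k).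
  by rewrite /m; case: (leqP i k) => _ //; have [_ []] := dec i k.
have m0 i k w : (0 <= m i k w)%E by rewrite /m; case: ifP.
have step2 : ((\sum_(k < n.+1) renew mu s u k.+1)%:E <=
    \sum_(k < n.+1) \sum_(i < n.+1) \int[mu]_w m i k w)%E.
  rewrite -sumEFin; apply: lee_sum => k _.
  apply: (@le_trans _ _ (\sum_(i < k.+1) Pr [set w | C i k (w, w)])%:E).
    by rewrite lee_fin.
  have -> : \sum_(i < k.+1) Pr [set w | C i k (w, w)] =
      \sum_(i < n.+1) (if (i < k.+1)%N then Pr [set w | C i k (w, w)] else 0).
    exact: (sum_widen (fun i => Pr [set w | C i k (w, w)])).
  rewrite -sumEFin; apply: lee_sum => i _; rewrite /m ltnS.
  case: ifP => _; last by rewrite integral0.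
  by have [mD [_ <-]] := dec i k; rewrite -Pr_fin.
apply: le_trans step2 _.
have int1 k : (\sum_(i < n.+1) \int[mu]_w m i k w = \int[mu]_w \sum_(i < n.+1) m i k w)%E.
  by rewrite ge0_integral_sum.
under eq_bigr => k _ do rewrite int1.
rewrite -ge0_integral_sum//; last 2 first.
- by move=> k; apply: emeasurable_sum.
- by move=> k w _; apply: sume_ge0.
rewrite [leRHS]integral_mkcond; apply: ge0_le_integral => //.
- by move=> w _; apply: sume_ge0 => k _; apply: sume_ge0.
- by apply: emeasurable_sum => k; apply: emeasurable_sum.
- apply/(measurable_restrictT _ measurable_lads).
  apply: measurable_funTS; apply: (measurableT_comp mg); apply: measurable_funB => //.
  exact: measurable_chi.
move=> w _; rewrite patchE.
have mz i k : ~ first_lad i.+1 w -> m i k w = 0%E.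
  move=> nf; rewrite /m; case: ifP => // _.
  rewrite (_ : [set w' | _] = set0) ?measure0//.
  by apply/seteqP; split => // w' [].
have [[i0 fi0]|nf] := pselect (exists i : 'I_n.+1, first_lad i.+1 w); last first.
  rewrite big1 => [|k _]; last first.
    by rewrite big1// => i _; apply: mz => fi; apply: nf; exists i.
  by case: ifP => // _; exact: g0.
have [lw cE] := first_lad_chi fi0.
rewrite mem_set//; apply: le_trans (Rg (u - chi w)).
(* Given the path, the first ladder epoch is unique, so one index [i0] survives. *)
have -> : (\sum_(k < n.+1) \sum_(i < n.+1) m i k w = \sum_(k < n.+1) m i0 k w)%E.
  apply: eq_bigr => k _; rewrite (bigD1 i0)//= big1 ?adde0// => i ii0; apply: mz => fi.
  by have [e] := first_lad_inj fi fi0; move: ii0; rewrite -val_eqE /= e eqxx.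
have mE k : m i0 k w = (if (i0 <= k)%N then renew mu s (u - chi w) (k - i0) else 0)%:E.
  rewrite /m; case: leqP => // ik.
  have := @renew_shift u i0.+1 k.+1 (hinc s 0 i0.+1 w) ik.
  rewrite subSS cE opprK => <-.
  rewrite -Pr_fin; last exact: measurable_aft.
  by congr (mu _); apply/seteqP; split => w' //= [].
under eq_bigr => k _ do rewrite mE.
rewrite sumEFin lee_fin (sum_shift (renew mu s (u - chi w)))//; last exact: ltnW.
by apply: sum_le_sum => [k|]; [exact: renew_ge0|exact: leq_subr].
Qed.

(** A record at a positive time follows a first ladder epoch, after which it is a record of the
    shifted walk at an earlier time; hence induction on [n]. The strict depth condition in [renew]
    is weaker than or equal to that of [Flad] as a restriction on mass only in the direction needed:
    for [s = true] the indicator of 0 < u is at most that of 0 <= u. *)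
Lemma renewal_le_Flad n u : ((renewal s u n)%:E <= \sum_(k < n.+1) Flad k u)%E.
Proof.
elim: n u => [|n IH] u.
  rewrite big_ord_recl big_ord0 adde0 -[renewal _ _ _]/(\sum_(k < _) _) big_ord_recl big_ord0 addr0 /= lee_fin.
  have [u0|u0] := ltP 0 u.
    apply: le_trans (_ : 1 <= _); last by case: (s); rewrite ?(ltW u0) ?u0.
    by apply: Pr_le1; exact: measurable_renew.
  rewrite /renew (_ : [set w | _] = set0) ?Pr0 ?ler0n//.
  by apply/seteqP; split => // w [_]; rewrite hinc_nil addr0 ltNge u0.
rewrite -[renewal _ _ _]/(\sum_(k < _) _) big_ord_recl EFinD [leRHS]big_ord_recl/=; apply: leeD.
  rewrite lee_fin; have [u0|u0] := ltP 0 u.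
    apply: le_trans (_ : 1 <= _); last by case: (s); rewrite ?(ltW u0) ?u0.
    by apply: Pr_le1; exact: measurable_renew.
  rewrite /renew (_ : [set w | _] = set0) ?Pr0 ?ler0n//.
  by apply/seteqP; split => // w [_]; rewrite hinc_nil addr0 ltNge u0.
have F0 k := (Flad_ge0_measurable k).1.
have mF k := (Flad_ge0_measurable k).2.
apply: le_trans (@renewal_step n u (fun v => \sum_(k < n.+1) Flad k v)%E _ _ IH) _.
- by move=> v; apply: sume_ge0.
- exact: emeasurable_sum.
rewrite ge0_integral_sum//.
- exact: measurable_lads.
- move=> k; apply: measurable_funTS; apply: (measurableT_comp (mF k)).
  by apply: measurable_funB => //; exact: measurable_chi.
Qed.

End ladder.

(** * Consequences of regular variation *)

Section norms.
Variables (R : realType) (d : nat).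
Implicit Types e : (d.+1).-tuple R.

Lemma coord_le_enorm e i : `|tnth e i| <= enorm e.
Proof.
rewrite /enorm -sqrtr_sqr; apply: ler_wsqrtr; rewrite /vdot (bigD1 i)//= expr2 lerDl.
by apply: sumr_ge0 => j _; rewrite -expr2 sqr_ge0.
Qed.

Lemma norm1_le_enorm e : norm1 e <= d.+1%:R * enorm e.
Proof.
apply: (@le_trans _ _ (\sum_(i < d.+1) enorm e)).
  by apply: ler_sum => i _; exact: coord_le_enorm.
by rewrite sumr_const card_ord mulr_natl.
Qed.

Lemma enorm_le_norm1 e : enorm e <= norm1 e.
Proof.
have n0 := norm1_ge0 e.
rewrite /enorm -[leRHS]ger0_norm// -sqrtr_sqr; apply: ler_wsqrtr.
rewrite expr2 /vdot {2}/norm1 mulr_sumr; apply: ler_sum => i _.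
rewrite -[leLHS]ger0_norm; last by rewrite -expr2 sqr_ge0.
by rewrite normrM ler_wpM2r//; exact: norm1_coord.
Qed.

Lemma enorm_ge0 e : 0 <= enorm e.
Proof. exact: sqrtr_ge0. Qed.

End norms.

Section regular_variation.
Variables (R : realType) (phi tl : R -> R) (alpha a1 a2 D : R).
Hypotheses (alpha_gt0 : 0 < alpha) (alpha_lt2 : alpha < 2)
  (phi_rv : regularly_varying phi (- alpha)) (a1_gt0 : 0 < a1) (a2_gt0 : 0 < a2)
  (D_ge1 : 1 <= D)
  (tl_phi : forall t, 0 < t -> a1 * phi t <= tl t)
  (phi_tl : forall t, 0 < t -> tl t <= a2 * phi (t / D))
  (tl_le : forall s t, s <= t -> tl t <= tl s)
  (tl_le1 : forall t, tl t <= 1).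

Let phi_gt0 t : 0 < t -> 0 < phi t.
Proof. by case: phi_rv => _ h _; exact: h. Qed.

Let D_gt0 : 0 < D. Proof. exact: lt_le_trans D_ge1. Qed.

Lemma rv_tail_gt0 t : 0 < tl t.
Proof.
have t1 : 0 < Num.max t 1 by rewrite lt_max ltr01 orbT.
apply: (@lt_le_trans _ _ (tl (Num.max t 1))); last by apply: tl_le; rewrite le_max lexx.
by apply: lt_le_trans (tl_phi t1); rewrite mulr_gt0// phi_gt0.
Qed.

Lemma rv_ratio l : 0 < l -> exists2 t0, 1 <= t0 & forall t, t0 <= t ->
  phi (l * t) <= 2 * l `^ (- alpha) * phi t /\ l `^ (- alpha) / 2 * phi t <= phi (l * t).
Proof.
move=> l0; case: phi_rv => _ phi0 /(_ l l0).
have p0 : 0 < l `^ (- alpha) by exact: powR_gt0.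
have e0 : 0 < l `^ (- alpha) / 2 by rewrite divr_gt0.
move=> /cvgrPdist_le /(_ _ e0) [t1 [_ Ht]].
exists (Num.max (t1 + 1) 1); first by rewrite le_max lexx orbT.
move=> t; rewrite ge_max => /andP[t1t t1']; have t0 : 0 < t by apply: lt_le_trans t1'.
have := Ht t; rewrite (lt_le_trans _ t1t) ?ltrDl// => /(_ isT).
rewrite ler_norml => /andP[h1 h2].
have ph := phi0 t t0.
have E : phi (l * t) = phi (l * t) / phi t * phi t by rewrite divfK// gt_eqF.
by split; rewrite E ler_pM2r//; lra.
Qed.

(** For large [t] compare [phi] at [t / D] and [2 * t], a ratio of [2 * D], where [D] is the loss
    between the norms; on bounded ranges monotonicity gives the constant [(tl (2 * t1))^-1]. *)
Lemma rv_double : exists2 cF, 1 <= cF & forall t, 1 <= t -> tl t <= cF * tl (2 * t).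
Proof.
have l0 : 0 < 2 * D by rewrite mulr_gt0.
have [t0 t01 H] := rv_ratio l0.
set p := (2 * D) `^ (- alpha) in H.
have p0 : 0 < p by exact: powR_gt0.
pose t1 := D * t0.
have T := rv_tail_gt0 (2 * t1).
exists (1 + (tl (2 * t1))^-1 + a2 / (a1 * (p / 2))).
  by rewrite -addrA lerDl addr_ge0 ?invr_ge0 ?divr_ge0 ?mulr_ge0// ltW.
move=> t t_ge1; have t_gt0 : 0 < t by apply: lt_le_trans t_ge1.
have T2 := rv_tail_gt0 (2 * t).
have i0 : 0 < (tl (2 * t1))^-1 by rewrite invr_gt0.
have j0 : 0 < a2 / (a1 * (p / 2)) by rewrite divr_gt0// mulr_gt0// divr_gt0.
rewrite [leRHS]mulrDl [X in _ <= X + _]mulrDl mul1r.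
set X := (tl (2 * t1))^-1 * _; set Y := a2 / _ * _.
have [tt1|tt1] := leP t t1.
  have : 1 <= X.
    by rewrite ler_pdivlMl// mulr1; apply: tl_le; rewrite ler_pM2l.
  have := tl_le1 t; have : 0 <= Y by rewrite mulr_ge0// ltW.
  lra.
have tD : t0 <= t / D by rewrite ler_pdivlMr// mulrC; exact: ltW.
have [_ h] := H _ tD.
have e : 2 * D * (t / D) = 2 * t by field; rewrite gt_eqF.
rewrite e in h.
have : tl t <= Y.
  apply: le_trans (phi_tl t_gt0) _.
  have -> : a2 * phi (t / D) = a2 / (a1 * (p / 2)) * (a1 * (p / 2 * phi (t / D))).
    by field; rewrite !gt_eqF.
  rewrite ler_pM2l//; apply: le_trans (tl_phi _); last by rewrite mulr_gt0.
  by rewrite ler_pM2l.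
have : 0 < X by rewrite mulr_gt0.
lra.
Qed.

Lemma powR2_expr (x : R) k : (2 ^+ k) `^ x = (2 `^ x) ^+ k :> R.
Proof.
elim: k => [|k IH]; first by rewrite !expr0 powR1.
by rewrite !exprS powRM ?exprn_ge0// IH.
Qed.

Lemma powR2_lt1 (x : R) : 0 < x -> 0 <= (2 : R) `^ (- x) < 1.
Proof.
move=> x0; rewrite powR_ge0/= /powR pnatr_eq0/= expR_lt1 mulNr oppr_lt0 mulr_gt0//.
by rewrite ln_gt0// ltr1n.
Qed.

(** Since alpha > 0, [m] doublings make the limiting ratio small enough to absorb the constants for
    t >= t0; [k] more doublings carry any t >= 1 beyond [t0]. *)
Lemma rv_half : exists2 M, (0 < M)%N & forall t, 1 <= t -> tl (2 ^+ M * t) <= tl t / 2.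
Proof.
have /exists_expr_le := powR2_lt1 alpha_gt0.
pose K := 2 * a2 / a1 * D `^ alpha.
have Da0 : 0 < D `^ alpha by exact: powR_gt0.
have K0 : 0 < K by rewrite mulr_gt0// divr_gt0// mulr_gt0.
move=> /(_ ((2 * K)^-1)) [|m hm]; first by rewrite invr_gt0 mulr_gt0.
pose l : R := 2 ^+ m / D.
have l0 : 0 < l by rewrite divr_gt0// exprn_gt0.
have [t0 t01 H] := rv_ratio l0.
have big t : t0 <= t -> tl (2 ^+ m * t) <= tl t / 2.
  move=> t0t; have [h _] := H t t0t; have t_gt0 : 0 < t by apply: lt_le_trans t0t; apply: lt_le_trans t01.
  apply: le_trans (phi_tl _) _; first by rewrite mulr_gt0// exprn_gt0.
  have -> : 2 ^+ m * t / D = l * t by rewrite /l; ring.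
  have lE : l `^ (- alpha) = (2 `^ (- alpha)) ^+ m * D `^ alpha.
    rewrite /l powRM ?exprn_ge0 ?invr_ge0 ?(ltW D_gt0)// powR2_expr.
    by rewrite -powR_inv1 ?(ltW D_gt0)// -powRrM mulrNN mul1r.
  have : a2 * phi (l * t) <= a2 * (2 * ((2 * K)^-1 * D `^ alpha) * phi t).
    rewrite ler_pM2l//; apply: le_trans h _.
    rewrite ler_wpM2r ?(ltW (phi_gt0 t_gt0))// ler_pM2l// lE.
    by rewrite ler_wpM2r// ltW.
  have -> : a2 * (2 * ((2 * K)^-1 * D `^ alpha) * phi t) = (a1 * phi t) / 2.
    by rewrite /K; field; rewrite !gt_eqF.
  move=> h1; apply: le_trans h1 _; rewrite ler_pM2r ?invr_gt0//.
  exact: tl_phi.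
pose k := (Num.truncn t0).+1.
have kt0 : t0 <= 2 ^+ k.
  have t00 : 0 <= t0 by apply: le_trans t01.
  have /andP[_ /ltW h] := truncn_itv t00; apply: le_trans h _.
  by rewrite -natrX ler_nat ltnW// ltn_expl.
exists (m + k)%N; first by rewrite addnS.
move=> t t1; have t_gt0 : 0 < t by apply: lt_le_trans t1.
have [tt0|tt0] := leP t0 t.
  apply: le_trans (big _ tt0); apply: tl_le.
  by rewrite ler_pM2r// ler_weXn2l ?ler1n// leq_addr.
apply: (@le_trans _ _ (tl t0 / 2)); last by rewrite ler_pM2r// tl_le// ltW.
apply: le_trans (big _ (lexx _)); apply: tl_le.
rewrite exprD -mulrA ler_wpM2l ?exprn_ge0//.
by rewrite -[leLHS]mulr1 ler_pM// (le_trans _ t01).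
Qed.

(** Here alpha < 2 enters: [L ^ 2 * L ^ (- alpha)] is unbounded in [L]. The factor 2 gained makes
    the recursion for truncated second moments contract. *)
Lemma rv_square : exists L t0 : R, [/\ 2 <= L, 1 <= t0 & forall t, t0 <= t ->
  2 * tl t <= L ^+ 2 * tl (L * t)].
Proof.
have x0 : 0 < 2 - alpha by rewrite subr_gt0.
have x01 := powR2_lt1 x0.
have /exists_expr_le := x01.
pose K := 4 * a2 / a1 * D `^ alpha.
have Da0 : 0 < D `^ alpha by exact: powR_gt0.
have K0 : 0 < K by rewrite mulr_gt0// divr_gt0// mulr_gt0.
move=> /(_ K^-1) [|m' hm']; first by rewrite invr_gt0.
(* A positive exponent guarantees L >= 2. *)
pose m := m'.+1.
have hm : (2 `^ (- (2 - alpha))) ^+ m <= K^-1.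
  apply: le_trans hm'; have /andP[y0 y1] := x01.
  by rewrite exprS ler_piMl ?exprn_ge0// ltW.
pose L : R := 2 ^+ m.
have L0 : 0 < L by rewrite exprn_gt0.
have [t0 t01 H] := rv_ratio (mulr_gt0 L0 D_gt0).
exists L, (D * t0); split.
- by rewrite /L exprS ler_peMr// pow2_ge1.
- by rewrite -[leLHS]mulr1 ler_pM.
move=> t tt.
have t_gt0 : 0 < t by apply: lt_le_trans tt; rewrite mulr_gt0// (lt_le_trans ltr01).
have tD : t0 <= t / D by rewrite ler_pdivlMr// mulrC.
have [_ h] := H _ tD.
have e : L * D * (t / D) = L * t by field; rewrite gt_eqF.
rewrite e in h.
have pt : 0 < phi (t / D) by apply: phi_gt0; rewrite divr_gt0.
have LE : (L * D) `^ (- alpha) = L `^ (- alpha) * (D `^ alpha)^-1.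
  by rewrite powRM ?(ltW L0) ?(ltW D_gt0)// [D `^ _]powRN.
have La0 : 0 < L `^ (- alpha) by exact: powR_gt0.
have L2 : K <= L ^+ 2 * L `^ (- alpha).
  have LL0 : 0 < L ^+ 2 * L `^ (- alpha) by rewrite mulr_gt0// exprn_gt0.
  rewrite -[leRHS]invrK -[K]invrK lef_pV2 ?posrE ?invr_gt0//.
  apply: le_trans hm; rewrite -powR2_expr -/L.
  rewrite -[L ^+ 2]powR_mulrn ?(ltW L0)// -powRD; last by rewrite (gt_eqF L0) implybT.
  by rewrite -powRN.
have t1 := phi_tl t_gt0.
have t2 : a1 * phi (L * t) <= tl (L * t) by apply: tl_phi; rewrite mulr_gt0.
rewrite LE in h.
apply: (@le_trans _ _ (L ^+ 2 * (a1 * (L `^ (- alpha) / D `^ alpha / 2 * phi (t / D))))); last first.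
  rewrite ler_pM2l ?exprn_gt0//; apply: le_trans t2.
  by rewrite ler_pM2l.
apply: (@le_trans _ _ (2 * (a2 * phi (t / D)))); first by rewrite ler_pM2l.
have -> : 2 * (a2 * phi (t / D)) = K * (a1 * ((D `^ alpha)^-1 / 2 * phi (t / D))).
  by rewrite /K; field; rewrite !gt_eqF.
have -> : L ^+ 2 * (a1 * (L `^ (- alpha) / D `^ alpha / 2 * phi (t / D))) =
  (L ^+ 2 * L `^ (- alpha)) * (a1 * ((D `^ alpha)^-1 / 2 * phi (t / D))) by ring.
rewrite ler_wpM2r//.
by rewrite mulr_ge0 ?(ltW a1_gt0)// mulr_ge0 ?(ltW pt)// divr_ge0// invr_ge0 ltW.
Qed.

End regular_variation.

(** * Truncated second moments *)

Section truncated_moment.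
Variables (R : realType) (d : nat).
Local Notation E := ((d.+1).-tuple R).
Local Notation OmT := (@Om _ E predT).
Variable (mu : probability OmT R).
Local Notation tail := (tail mu).

Variables (L t0 : R).
Hypotheses (L_ge2 : 2 <= L) (t0_ge1 : 1 <= t0) (tail_gt0 : forall t, 0 < tail t)
  (tail_sq : forall t, t0 <= t -> 2 * tail t <= L ^+ 2 * tail (L * t)).

Let sq (t : R) (w : OmT) : R := if norm1 (w 0%N) <= t then norm1 (w 0%N) ^+ 2 else 0.

Let msq t : measurable_fun setT (EFin \o sq t).
Proof.
apply/measurable_EFinP; apply: measurable_fun_ifT => //.
  by apply: measurable_fun_ler => //; exact: measurable_norm1.
by apply: measurable_funX; exact: measurable_norm1.
Qed.

Let sq_ge0 t w : 0 <= sq t w.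
Proof. by rewrite /sq; case: ifP => // _; rewrite sqr_ge0. Qed.

Let m2 t := (\int[mu]_w (sq t w)%:E)%E.

Let m2_le t : 0 <= t -> (m2 t <= (t ^+ 2)%:E)%E.
Proof.
move=> t1; rewrite -(integral_cstr mu (t ^+ 2)); apply: ge0_le_integral => //.
- by move=> w _; rewrite lee_fin.
- exact: msq.
move=> w _; rewrite lee_fin /sq; case: ifP => [h|_]; last exact: sqr_ge0.
by apply: lerXn2r; rewrite ?nnegrE// norm1_ge0.
Qed.

Let m2_step s t : 0 <= s <= t -> (m2 t <= m2 s + (t ^+ 2 * tail s)%:E)%E.
Proof.
move=> /andP[s0 st].
pose A : set OmT := [set w | s < norm1 (w 0%N)].
have mA : measurable A by exact: measurable_jump.
have -> : ((t ^+ 2 * tail s)%:E = \int[mu]_w ((t ^+ 2)%:E * (\1_A w)%:E))%E.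
  rewrite ge0_integralZl_EFin ?sqr_ge0//; last exact/measurable_EFinP.
  by rewrite integral_indic// setIT EFinM -(Pr_fin mu mA).
have mI : measurable_fun setT (fun w : OmT => ((t ^+ 2)%:E * (\1_A w)%:E)%E).
  by apply: emeasurable_funM => //; exact/measurable_EFinP.
have I0 w : (0 <= (t ^+ 2)%:E * (\1_A w)%:E)%E by rewrite -EFinM lee_fin mulr_ge0 ?sqr_ge0.
rewrite /m2 -ge0_integralD//; [|by move=> w _; rewrite lee_fin|exact: msq].
apply: ge0_le_integral => //.
- by move=> w _; rewrite lee_fin.
- exact: msq.
- by apply: emeasurable_funD => //; exact: msq.
move=> w _; rewrite -EFinM -EFinD lee_fin /sq indicE.
have n0 := norm1_ge0 (w 0%N).
case: (leP (norm1 (w 0%N)) s) => [ws|sw].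
  by rewrite (le_trans ws st) lerDl mulr_ge0 ?sqr_ge0.
rewrite mem_set// mulr1 add0r; case: ifP => [wt|_]; last exact: sqr_ge0.
by apply: lerXn2r; rewrite ?nnegrE// (le_trans s0).
Qed.

(** Recursion from [t] to [t / L]: the new jumps contribute at most [t ^ 2 * tail (t / L)], and as C
    >= L ^ 2, [tail_sq] absorbs the sum into the bound at [t]. The recursion stops below [L * t0],
    where the other summand of [C] suffices. *)
Lemma trunc_sqr_le : exists2 C, 0 < C & forall i t, 1 <= t ->
  (\int[mu]_w ((trunc i t (w 0%N)) ^+ 2)%:E <= (C * t ^+ 2 * tail t)%:E)%E.
Proof.
have L0 : 0 < L by exact: lt_le_trans L_ge2.
have t00 : 0 < t0 by exact: lt_le_trans t0_ge1.
have Lg : 2 <= L := L_ge2.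
have t0g : 1 <= t0 := t0_ge1.
pose C := L ^+ 2 + (tail (L * t0))^-1.
have i0 : 0 < (tail (L * t0))^-1 by rewrite invr_gt0.
have C0 : 0 < C by rewrite addr_gt0 ?exprn_gt0.
exists C => // i t t1.
apply: (@le_trans _ _ (m2 t)).
  apply: ge0_le_integral => //.
  - by move=> w _; rewrite lee_fin sqr_ge0.
  - apply/measurable_EFinP; apply: measurable_funX.
    by apply: (measurableT_comp (measurable_trunc i t)); exact: measurable_coord.
  - exact: msq.
  - move=> w _; rewrite lee_fin /trunc /sq; case: ifP => _; last by rewrite expr0n.
    rewrite -real_normK ?num_real//; apply: lerXn2r; rewrite ?nnegrE ?norm1_ge0//.
    exact: norm1_coord.
have main k : forall t, 1 <= t -> t <= L ^+ k * (L * t0) -> (m2 t <= (C * t ^+ 2 * tail t)%:E)%E.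
  elim: k => [|k IH] {t1}t t1 tk.
    have t0' : 0 <= t by lra.
    rewrite expr0 mul1r in tk.
    apply: le_trans (m2_le t0') _; rewrite lee_fin.
    have h : 1 <= C * tail t.
      apply: (@le_trans _ _ ((tail (L * t0))^-1 * tail t)).
        by rewrite ler_pdivlMl// mulr1; exact: tail_le.
      by rewrite ler_pM2r// /C lerDr sqr_ge0.
    by rewrite mulrAC ler_peMl// sqr_ge0.
  have [tk'|tk'] := leP t (L ^+ k * (L * t0)); first exact: IH.
  pose t' := t / L.
  have Lt0 : L * t0 < t.
    by apply: le_lt_trans tk'; rewrite ler_peMl ?mulr_ge0 ?exprn_ege1 ?(ltW L0) ?(ltW t00)//; lra.
  have t't0 : t0 <= t' by rewrite ler_pdivlMr// mulrC ltW.
  have t'1 : 1 <= t' by lra.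
  have t'k : t' <= L ^+ k * (L * t0).
    by rewrite ler_pdivrMr//; apply: le_trans tk _; rewrite exprSr -!mulrA ler_wpM2l ?exprn_ge0 ?(ltW L0)// mulrCA mulrC -mulrA.
  have tE : L * t' = t by rewrite /t'; field; rewrite gt_eqF.
  have := tail_sq t't0; rewrite tE => h.
  have t't : 0 <= t' <= t by rewrite -tE; apply/andP; split; nra.
  apply: le_trans (m2_step t't) _; apply: le_trans (leeD2r _ (IH t' t'1 t'k)) _.
  rewrite -EFinD lee_fin -[t in leLHS]tE -[X in _ <= _ * X ^+ 2 * _]tE.
  have T' := tail_gt0 t'; have T := tail_gt0 t.
  have CL : L ^+ 2 <= C by rewrite /C lerDl ltW.
  have t'2 : 0 <= t' ^+ 2 by rewrite sqr_ge0.
  apply: (@le_trans _ _ ((C + L ^+ 2) * t' ^+ 2 * tail t')); first by rewrite le_eqVlt; apply/orP; left; apply/eqP; ring.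
  apply: (@le_trans _ _ (C * t' ^+ 2 * (2 * tail t'))).
    have : (C + L ^+ 2) * t' ^+ 2 * tail t' <= (C + C) * t' ^+ 2 * tail t'.
      by rewrite ler_wpM2r ?(ltW T')// ler_wpM2r// lerD2l.
    lra.
  apply: (@le_trans _ _ (C * t' ^+ 2 * (L ^+ 2 * tail t))).
    by rewrite ler_wpM2l// mulr_ge0// ltW.
  by rewrite le_eqVlt; apply/orP; left; apply/eqP; ring.
have [k hk] : exists k, t <= L ^+ k * (L * t0).
  exists (Num.truncn t).+1.
  have t0' : 0 <= t by lra.
  have /andP[_ /ltW h] := truncn_itv t0'; apply: le_trans h _.
  apply: (@le_trans _ _ (2 ^+ (Num.truncn t).+1)).
    by rewrite -natrX ler_nat ltnW// ltn_expl.
  apply: (@le_trans _ _ (L ^+ (Num.truncn t).+1)).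
    by apply: lerXn2r; rewrite ?nnegrE// ltW.
  by rewrite ler_peMr ?exprn_ge0 ?(ltW L0)//; nra.
exact: main hk.
Qed.

End truncated_moment.

(** * The local law of a large jump *)

Section local_bound.
Variables (R : realType) (d : nat).
Local Notation E := ((d.+1).-tuple R).
Local Notation OmT := (@Om _ E predT).
Variable (mu : probability OmT R).
Local Notation Pr := (Pr mu).
Local Notation tail := (tail mu).
Local Notation D := d.+1.
Variables (phi : R -> R) (a1 cF : R).
Hypotheses (a1_gt0 : 0 < a1) (phi_tail : forall t, 0 < t -> a1 * phi t <= tail t)
  (cF_ge1 : 1 <= cF) (tail_gt0 : forall t, 0 < tail t)
  (tail_double : forall t, 1 <= t -> tail t <= cF * tail (2 * t))
  (box_phi : forall x : E, enorm x != 0 -> Pr (box (tnth x) 0 1) <= phi (enorm x) / enorm x ^+ D).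

(** For t > 2 D a unit box meeting norms beyond [t] has its corner at Euclidean distance at least t
    / (2 D), where the local hypothesis and doubling apply; smaller [t] are covered by [C2]. *)
Lemma tail_loc_of_box : exists2 C, 0 < C & forall t z, 1 <= t ->
  Pr [set w | t < norm1 (w 0%N) /\ box z 0 1 w] <= C * (tail t / t ^+ D).
Proof.
have cF0 : 0 < cF by apply: lt_le_trans cF_ge1.
pose D' : R := D%:R.
have D'1 : 1 <= D' by rewrite ler1n.
have D'0 : 0 < D' by apply: lt_le_trans D'1.
pose a := (2 * D)%N.
have Da : 2 * D' <= 2 ^+ a by rewrite -natrM -natrX ler_nat ltnW// ltn_expl.
have dD : 0 < 2 * D' by rewrite mulr_gt0.
pose C1 := cF ^+ a * (2 * D') ^+ D / a1.
pose C2 := (2 * D') ^+ D / tail (2 * D').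
have C10 : 0 < C1 by rewrite divr_gt0// mulr_gt0// exprn_gt0.
have C20 : 0 < C2 by rewrite divr_gt0// exprn_gt0.
exists (C1 + C2); first by rewrite addr_gt0.
move=> t z t1; have t_gt0 : 0 < t by apply: lt_le_trans t1.
have tD0 : 0 < t ^+ D by rewrite exprn_gt0.
have q0 : 0 <= tail t / t ^+ D by apply: divr_ge0; exact: ltW.
have mE : measurable ([set w | t < norm1 (w 0%N) /\ box z 0 1 w] : set OmT).
  by apply: mset_and; [exact: measurable_jump|exact: measurable_box].
rewrite mulrDl.
have [tD|tD] := leP t (2 * D').
  apply: le_trans (Pr_le1 mu mE) _.
  apply: (@le_trans _ _ (C2 * (tail t / t ^+ D))); last first.
    by rewrite lerDr mulr_ge0// ltW.
  have -> : C2 * (tail t / t ^+ D) = (tail t / tail (2 * D')) * ((2 * D') ^+ D / t ^+ D).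
    by rewrite /C2; ring.
  rewrite -[leLHS]mulr1; apply: ler_pM => //.
    by rewrite ler_pdivlMr// mul1r; exact: tail_le.
  by rewrite ler_pdivlMr// mul1r; apply: lerXn2r; rewrite ?nnegrE// ltW.
apply: (@le_trans _ _ (C1 * (tail t / t ^+ D))); last first.
  by rewrite lerDl mulr_ge0// ltW.
have [->|/set0P[w [tw bw]]] := eqVneq [set w : nat -> E | t < norm1 (w 0%N) /\ box z 0 1 w] set0.
  by rewrite Pr0 mulr_ge0// ltW.
pose x : E := [tuple z i | i < D].
have xz : tnth x = z by apply/funext => i; rewrite tnth_mktuple.
have wx : norm1 (w 0%N) <= norm1 x + D'.
  have -> : D' = \sum_(i < D) (1 : R) by rewrite sumr_const card_ord.
  rewrite -big_split/=; apply: ler_sum => i _; rewrite xz.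
  have := bw i; rewrite inc1 => /andP[z1 z2].
  have : `|tnth (w 0%N) i - z i| <= 1.
    by rewrite ler_norml; apply/andP; split; lra.
  have := ler_normD (z i) (tnth (w 0%N) i - z i); rewrite [z i + _]addrC subrK; lra.
have xt : t / (2 * D') <= enorm x.
  have := norm1_le_enorm x; rewrite -/D' => h.
  rewrite ler_pdivrMr//; have : D' * (2 * enorm x) = enorm x * (2 * D') by ring.
  lra.
pose y := t / (2 * D').
have y1 : 1 <= y by rewrite /y ler_pdivlMr// mul1r ltW.
have y0 : 0 < y by apply: lt_le_trans y1.
have e0 : 0 < enorm x by apply: lt_le_trans xt.
apply: (@le_trans _ _ (Pr (box z 0 1))).
  by apply: le_Pr => //; [exact: measurable_box|move=> ? []].
rewrite -xz; apply: le_trans (box_phi _) _; first by rewrite gt_eqF.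
have h1 : phi (enorm x) <= tail y / a1.
  rewrite ler_pdivlMr// mulrC; apply: le_trans (phi_tail e0) _; exact: tail_le.
have h2 : tail y <= cF ^+ a * tail t.
  have it k : tail y <= cF ^+ k * tail (2 ^+ k * y).
    elim: k => [|k IH]; first by rewrite !mul1r.
    apply: le_trans IH _; rewrite [cF ^+ k.+1]exprSr -mulrA ler_wpM2l ?exprn_ge0 ?(ltW cF0)//.
    rewrite exprS -mulrA; apply: tail_double.
    by rewrite -[leLHS]mulr1 ler_pM// pow2_ge1.
  apply: le_trans (it a) _; rewrite ler_wpM2l ?exprn_ge0 ?(ltW cF0)//.
  apply: tail_le; rewrite /y mulrA ler_pdivlMr// mulrC ler_wpM2r// ltW//.
have h3 : (enorm x ^+ D)^-1 <= (y ^+ D)^-1.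
  rewrite lef_pV2 ?posrE ?exprn_gt0//; apply: lerXn2r xt; rewrite ?nnegrE ltW//.
have ty : (y ^+ D)^-1 = (2 * D') ^+ D / t ^+ D.
  by rewrite /y expr_div_n invf_div.
have e1 : phi (enorm x) / enorm x ^+ D <= (tail y / a1) * (y ^+ D)^-1.
  apply: (@le_trans _ _ ((tail y / a1) * (enorm x ^+ D)^-1)).
    by rewrite ler_wpM2r// invr_ge0 exprn_ge0// ltW.
  by rewrite ler_wpM2l// divr_ge0 ?tail_ge0// ltW.
apply: le_trans e1 _; rewrite ty.
have -> : C1 * (tail t / t ^+ D) = (cF ^+ a * tail t / a1) * ((2 * D') ^+ D / t ^+ D).
  by rewrite /C1; ring.
rewrite ler_wpM2r//; first by rewrite divr_ge0 ?exprn_ge0// ltW.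
by rewrite ler_wpM2r// invr_ge0 ltW.
Qed.

End local_bound.

(** * Truncated means in the absence of centering *)

Section centering.
Variables (R : realType) (d : nat).
Local Notation E := ((d.+1).-tuple R).
Local Notation OmT := (@Om _ E predT).
Variables (mu : probability OmT R) (nu : probability E R).
Hypothesis mu_iid : iid_law mu nu.
Local Notation Pr := (Pr mu).
Local Notation tail := (tail mu).
Let D : R := d.+1%:R.

Variables (C3 : R) (M : nat) (c : nat -> R).
Hypotheses (tail_gt0 : forall t, 0 < tail t)
  (tail_half : forall t, 1 <= t -> tail (2 ^+ M * t) <= tail t / 2)
  (C3_gt0 : 0 < C3)
  (trunc_sqr : forall i t, 1 <= t ->
     (\int[mu]_w ((trunc i t (w 0%N)) ^+ 2)%:E <= (C3 * t ^+ 2 * tail t)%:E)%E)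
  (c_gt0 : forall n, 0 < c n).

Let th n (w : OmT) : R := inc ord0 0 n w / c n.

(** [spread] keeps the squared modulus of the characteristic function of the rescaled first
    coordinate, at frequency 1, away from 1; [tight] is tightness of the rescaled walk. *)
Hypotheses
  (spread : exists2 kappa, 0 < kappa & exists n0, forall n, (n0 <= n)%N ->
     (\int[mu]_w cos (th n w)) ^+ 2 + (\int[mu]_w sin (th n w)) ^+ 2 <= 1 - kappa)
  (tight : forall e, 0 < e -> exists K n0, forall n, (n0 <= n)%N ->
     Pr [set w | K * c n <= ninc 0 n w] <= e).

Let mth n : measurable_fun setT (th n).
Proof. by apply: measurable_funM => //; exact: measurable_inc. Qed.

Let mcos (f : OmT -> R) : measurable_fun setT f -> measurable_fun setT (fun w => cos (f w)).
Proof. by move=> mf; apply: measurableT_comp => //; exact: continuous_measurable_fun (@continuous_cos R). Qed.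

Let msin (f : OmT -> R) : measurable_fun setT f -> measurable_fun setT (fun w => sin (f w)).
Proof. by move=> mf; apply: measurableT_comp => //; exact: continuous_measurable_fun (@continuous_sin R). Qed.

Let icos (f : OmT -> R) : measurable_fun setT f -> mu.-integrable setT (EFin \o (fun w => cos (f w))).
Proof.
move=> mf; apply: (@bounded_integrable _ _ _ mu _ 1); first exact: mcos.
by move=> w; exact: cos_max.
Qed.

Let isin (f : OmT -> R) : measurable_fun setT f -> mu.-integrable setT (EFin \o (fun w => sin (f w))).
Proof.
move=> mf; apply: (@bounded_integrable _ _ _ mu _ 1); first exact: msin.
by move=> w; exact: sin_max.
Qed.

(* The real part of [E exp (i (th - y))] is at most its modulus [|E exp (i th)|]. *)
Lemma cos_shift_sqr n y :
  (\int[mu]_w cos (th n w - y)) ^+ 2 <=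
  (\int[mu]_w cos (th n w)) ^+ 2 + (\int[mu]_w sin (th n w)) ^+ 2.
Proof.
have i1 : mu.-integrable setT (EFin \o (fun w => cos (th n w) * cos y)).
  apply: (@bounded_integrable _ _ _ mu _ 1); first by apply: measurable_funM => //; exact: mcos.
  by move=> w; rewrite normrM -[leRHS]mulr1 ler_pM// cos_max.
have i2 : mu.-integrable setT (EFin \o (fun w => sin (th n w) * sin y)).
  apply: (@bounded_integrable _ _ _ mu _ 1); first by apply: measurable_funM => //; exact: msin.
  by move=> w; rewrite normrM -[leRHS]mulr1 ler_pM// ?cos_max// sin_max.
have -> : \int[mu]_w cos (th n w - y) =
    \int[mu]_w (cos (th n w) * cos y + sin (th n w) * sin y).
  by apply: eq_Rintegral => w _; rewrite cosB.
rewrite RintegralD// RintegralZr//; last exact: icos.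
rewrite RintegralZr//; last exact: isin.
have := cos2Dsin2 y.
set a := \int[mu]_w cos (th n w); set b := \int[mu]_w sin (th n w).
move: (cos y) (sin y) => p q h.
have -> : a ^+ 2 + b ^+ 2 = (a * p + b * q) ^+ 2 + (a * q - b * p) ^+ 2.
  by rewrite -[a ^+ 2]mulr1 -[b ^+ 2]mulr1 -h; ring.
by rewrite lerDl sqr_ge0.
Qed.

(** The cosine is at least -1 on [A] and at least 1 - e elsewhere. *)
Lemma cos_shift_lower n y e (A : set OmT) : measurable A -> 0 <= e <= 1 ->
  Pr A <= e -> (forall w, ~ A w -> 1 - e <= cos (th n w - y)) ->
  1 - 3 * e <= \int[mu]_w cos (th n w - y).
Proof.
move=> mA /andP[e0 e1] PA hA.
pose g (w : OmT) : R := (1 - e) + (- 2) * \1_A w.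
have i1 : mu.-integrable setT (EFin \o (fun w : OmT => (- 2) * \1_A w : R)).
  apply: (@bounded_integrable _ _ _ mu _ 2); first exact: measurable_funM.
  by move=> w; rewrite indicE; case: (w \in A); rewrite /= ?mulr1 ?mulr0 ?normrN ?normr0// ger0_norm.
have i0 : mu.-integrable setT (EFin \o (fun _ : OmT => 1 - e)).
  by apply: (@bounded_integrable _ _ _ mu _ `|1 - e|).
have iA : mu.-integrable setT (EFin \o (fun w : OmT => \1_A w : R)).
  apply: (@bounded_integrable _ _ _ mu _ 1) => [|w]; first exact: measurable_indic.
  by rewrite indicE; case: (w \in A); rewrite ?normr1 ?normr0.
have ig : mu.-integrable setT (EFin \o g).
  rewrite (_ : EFin \o g = (EFin \o (fun _ : OmT => 1 - e)) \+ (EFin \o (fun w : OmT => (- 2) * \1_A w : R))).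
    exact: integrableD.
  by apply/funext => w.
apply: (@le_trans _ _ (\int[mu]_w g w)); last first.
  apply: le_Rintegral => //.
    by apply: icos; apply: measurable_funB => //; exact: mth.
  move=> w _; rewrite /g indicE; case: (boolP (w \in A)) => [_|].
    have := cos_geN1 (th n w - y); rewrite mulr1; lra.
  by rewrite notin_setE => /hA; rewrite mulr0 addr0.
rewrite /g RintegralD// RintegralZl// Rintegral_cst//.
have -> : \int[mu]_w (\1_A w : R) = Pr A by rewrite /Rintegral integral_indic// setIT.
have -> : fine (mu setT) = 1 := PrT mu.
lra.
Qed.

Lemma deviation n t i : 1 <= t ->
  Pr [set w | t <= `|inc i 0 n w - n%:R * mean mu (trunc i t)|] <=
  (1 + D * C3) * (n%:R * tail t).
Proof.
move=> t1; have t0 : 0 < t by exact: lt_le_trans t1.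
have h1 := Pr_exists_jump mu_iid n t.
have h2 := truncated_deviation mu_iid trunc_sqr n t1 t0.
have e : d.+1%:R * (n%:R * (C3 * t ^+ 2 * tail t) / t ^+ 2) = D * C3 * (n%:R * tail t).
  by rewrite /D; field; rewrite gt_eqF.
rewrite e in h2; rewrite mulrDl mul1r; apply: le_trans (lerD h1 h2).
have mS j : measurable ([set w | t <= `|\sum_(0 <= k < n) trunc j t (w k) - n%:R * mean mu (trunc j t)|] : set OmT).
  apply: mset_le => //; apply: measurableT_comp => //; apply: measurable_funB => //.
  apply: measurable_sum => k; apply: (measurableT_comp (measurable_trunc j t)).
  exact: measurable_coord.
apply: Pr_le2.
- apply: mset_le => //; apply: measurableT_comp => //; apply: measurable_funB => //.
  exact: measurable_inc.
- apply: mset_exists => k; apply: mset_and; first exact: mset_cst.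
  exact: measurable_jump.
- rewrite (_ : [set w | _] = \bigcup_(j in [set: 'I_d.+1]) [set w | t <=
       `|\sum_(0 <= k < n) trunc j t (w k) - n%:R * mean mu (trunc j t)|]).
    by apply: fin_bigcup_measurable => [|j _] //; exact: finite_finset.
  by apply/seteqP; split => w [j]; [exists j|exists j].
move=> w tw; have [|nj] := pselect (exists k, (k < n)%N /\ t < norm1 (w k)); first by left.
right; exists i; rewrite sum_trunc_inc// => k kn.
by rewrite leNgt; apply/negP => tk; apply: nj; exists k.
Qed.

Lemma tail_small e : 0 < e -> exists i, forall n t, 1 <= t -> n%:R * tail t <= 1 ->
  (1 + D * C3) * (n%:R * tail (2 ^+ (M * i) * t)) <= e.
Proof.
move=> e0.
have half01 : 0 <= (1 / 2 : R) < 1 by apply/andP; split; lra.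
have X0 : 0 < 1 + D * C3 by rewrite addr_gt0// mulr_gt0.
have [i hi] := exists_expr_le half01 (divr_gt0 e0 X0).
exists i => n t t1 nt.
rewrite mulrC -ler_pdivlMr//; apply: le_trans hi.
have := tail_iter tail_half i t1 => h.
have p2 : 0 < 2 ^+ i :> R by rewrite exprn_gt0.
rewrite div1r exprVn -[leRHS]mul1r ler_pdivlMr//; apply: le_trans nt.
by rewrite -mulrA ler_wpM2l// mulrC.
Qed.

(* Otherwise [S_1(n) / c n] would be asymptotically deterministic. *)
Lemma norming_upper : exists2 K, 0 < K & exists n1, forall n t, (n1 <= n)%N -> 1 <= t ->
  n%:R * tail t <= 1 -> c n <= K * t.
Proof.
have [kappa k0 [n0 spr]] := spread.
(* Since 7 > 6, (1 - 3e) ^ 2 > 1 - 6e contradicts the bound 1 - kappa; the entry 1/7 keeps 1 - 3e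
   nonnegative. *)
pose e := Num.min (kappa / 7) (1 / 7).
have e0 : 0 < e by rewrite lt_min; apply/andP; split; lra.
have ek : e <= kappa / 7 by rewrite ge_min lexx.
have e1 : e <= 1 / 7 by rewrite ge_min lexx orbT.
have [eta eta0 heta] : exists2 eta, 0 < eta & forall x : R, `|x| < eta -> 1 - e <= cos x.
  have := @continuous_cos R 0; move=> /cvgrPdist_le /(_ e e0) [eta /= eta0 h].
  exists eta => // x xe; have := h x; rewrite /ball_/= sub0r normrN => /(_ xe).
  by rewrite cos0 ler_norml; lra.
have [i hi] := tail_small e0.
pose K := 2 ^+ (M * i) / eta.
have p0 : 0 < 2 ^+ (M * i) :> R by rewrite exprn_gt0.
have K0 : 0 < K by rewrite divr_gt0.
exists K => //; exists n0 => n t nn0 t1 nt.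
rewrite leNgt; apply/negP => cK.
(* At this larger truncation level the deviation probability is at most [e], while c n > K t makes
   [t'] smaller than [eta * c n]. *)
pose t' := 2 ^+ (M * i) * t.
have t'1 : 1 <= t' by rewrite -[leLHS]mulr1 ler_pM// pow2_ge1.
pose y := n%:R * mean mu (trunc ord0 t') / c n.
pose A : set OmT := [set w | t' <= `|inc ord0 0 n w - n%:R * mean mu (trunc ord0 t')|].
have mA : measurable A.
  apply: mset_le => //; apply: measurableT_comp => //; apply: measurable_funB => //.
  exact: measurable_inc.
have PA : Pr A <= e by apply: le_trans (deviation n ord0 t'1) _; exact: hi.
have low : 1 - 3 * e <= \int[mu]_w cos (th n w - y).
  apply: (cos_shift_lower mA) => // [|w nA]; first by apply/andP; split; lra.
  apply: heta; rewrite /th /y -mulrBl normrM normfV (gtr0_norm (c_gt0 n)).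
  rewrite ltr_pdivrMr//.
  have : `|inc ord0 0 n w - n%:R * mean mu (trunc ord0 t')| < t'.
    by rewrite ltNge; apply/negP.
  move=> h; apply: lt_trans h _.
  have -> : t' = eta * (K * t) by rewrite /t' /K; field; rewrite gt_eqF.
  by rewrite ltr_pM2l.
have up := le_trans (cos_shift_sqr n y) (spr n nn0).
have l0 : 0 <= 1 - 3 * e by lra.
have : (1 - 3 * e) ^+ 2 <= (\int[mu]_w cos (th n w - y)) ^+ 2.
  by apply: lerXn2r; rewrite ?nnegrE// (le_trans l0).
move=> low2; have := le_trans low2 up.
have : 0 < e ^+ 2 by rewrite exprn_gt0.
rewrite sqrrB expr1n; lra.
Qed.

Lemma mean_trunc_le i t : 0 <= t -> `|mean mu (trunc i t)| <= t.
Proof.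
move=> t0; have mt : measurable_fun setT (fun w : OmT => trunc i t (w 0%N)).
  by apply: (measurableT_comp (measurable_trunc i t)); exact: measurable_coord.
have it : mu.-integrable setT (EFin \o (fun w => trunc i t (w 0%N))).
  by apply: (@bounded_integrable _ _ _ mu _ t) => // w; exact: trunc_le.
apply: le_trans (le_normr_Rintegral _ it) _ => //.
apply: (@le_trans _ _ (\int[mu]_(w in setT) (cst t w))).
  apply: le_Rintegral => //.
  - apply: (@bounded_integrable _ _ _ mu _ t) => [|w]; first exact: measurableT_comp.
    by rewrite normr_id; exact: trunc_le.
  - by apply: (@bounded_integrable _ _ _ mu _ `|t|).
  - by move=> w _; exact: trunc_le.
rewrite Rintegral_cst//; have -> : fine (mu setT) = 1 := PrT mu.
by rewrite mulr1.
Qed.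

(* Choose [n] of order [1 / tail t].  By Chebyshev [n] times the truncated mean
   is within [O(t)] of [S n], which by tightness and [norming_upper] is itself
   [O(t)], on events of positive probability that hence intersect. *)
Lemma trunc_mean_le : exists2 C, 0 < C & forall i t, 1 <= t ->
  `|mean mu (trunc i t)| <= C * t * tail t.
Proof.
have [Kc Kc0 [n1 hc]] := norming_upper.
have e80 : 0 < 1 / 8 :> R by rewrite divr_gt0.
have [K2 [n2 ht]] := tight e80.
have D0 : 0 < D by rewrite ltr0n.
(* Makes the Chebyshev bound at most 1/8. *)
pose K3 := 1 + 4 * D * C3.
have X0 : 0 < 4 * D * C3 by rewrite !mulr_gt0.
have K30 : 1 <= K3 by rewrite lerDl ltW.
pose KK := `|K2| * Kc + K3.
have KK0 : 0 < KK by rewrite ltr_wpDl ?mulr_ge0 ?(ltW Kc0)// (lt_le_trans ltr01).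
pose ns := (maxn n1 n2).+1.
have [t1 t11 ht1] : exists2 t1, 1 <= t1 & tail t1 <= (2 * ns%:R)^-1.
  have half01 : 0 <= (1 / 2 : R) < 1 by apply/andP; split; lra.
  have [|j hj] := @exists_expr_le R (1 / 2) (2 * ns%:R)^-1 half01.
    by rewrite invr_gt0 mulr_gt0 ?ltr0n.
  exists (2 ^+ (M * j)); first exact: pow2_ge1.
  apply: le_trans hj; have := tail_iter tail_half j (lexx 1); rewrite mulr1 => h.
  have p2 : 0 < 2 ^+ j :> R by rewrite exprn_gt0.
  rewrite div1r exprVn -[leRHS]mul1r ler_pdivlMr// mulrC.
  by apply: le_trans h (tail_le1 _ _).
have Tt1 := tail_gt0 t1.
exists ((tail t1)^-1 + 4 * KK); first by rewrite addr_gt0 ?invr_gt0// mulr_gt0.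
move=> i t t_ge1; have t0 : 0 < t by exact: lt_le_trans t_ge1.
have T := tail_gt0 t.
have [tt1|tt1] := leP t t1.
  apply: le_trans (mean_trunc_le i (ltW t0)) _.
  apply: (@le_trans _ _ ((tail t1)^-1 * t * tail t)).
    rewrite -mulrA ler_pdivlMl// mulrC ler_pM2l//; exact: tail_le.
  by rewrite ler_wpM2r ?(ltW T)// ler_wpM2r ?(ltW t0)// lerDl mulr_ge0// ltW.
apply: (@le_trans _ _ (4 * KK * t * tail t)); last first.
  by rewrite ler_wpM2r ?(ltW T)// ler_wpM2r ?(ltW t0)// lerDr invr_ge0 ltW.
(* With [n] the integer part of [x], [n * tail t] lies in [1/4, 1/2]. The upper bound leaves room
   for the two events of probability 1/8; the lower bound converts an estimate of [n] times the mean
   into one with the factor [tail t]. *)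
pose x := (2 * tail t)^-1.
have x0 : 0 <= x by rewrite invr_ge0 mulr_ge0// ltW.
pose n := Num.truncn x.
have /andP[nx xn] := truncn_itv x0; rewrite -/n in nx xn.
have ns0 : 0 < ns%:R :> R by rewrite ltr0n.
have nsx : ns%:R <= x.
  rewrite /x -[leLHS]invrK lef_pV2 ?posrE ?invr_gt0 ?mulr_gt0//.
  have := le_trans (tail_le mu (ltW tt1)) ht1; rewrite invfM; lra.
have nsn : (ns <= n)%N by rewrite truncn_ge_nat.
have n_gt0 : (0 < n)%N by apply: leq_trans nsn.
have nn1 : (n1 <= n)%N by apply: leq_trans nsn; rewrite ltnW// ltnS leq_maxl.
have nn2 : (n2 <= n)%N by apply: leq_trans nsn; rewrite ltnW// ltnS leq_maxr.
have nt2 : n%:R * tail t <= 1 / 2.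
  have : n%:R * (2 * tail t) <= 1 by rewrite -ler_pdivlMr ?mulr_gt0// div1r.
  lra.
have nt4 : 1 / 4 <= n%:R * tail t.
  have : x * (2 * tail t) = 1 by rewrite /x mulVf// gt_eqF// mulr_gt0.
  have : n.+1%:R <= 2 * n%:R :> R by rewrite -natrM ler_nat; move: n_gt0; clear; lia.
  move=> h1 h2; have h3 : x <= 2 * n%:R by apply: le_trans (ltW xn) h1.
  have : x * (2 * tail t) <= 2 * n%:R * (2 * tail t) by rewrite ler_wpM2r// mulr_ge0// ltW.
  lra.
have nt1 : n%:R * tail t <= 1 by lra.
have cn := hc n t nn1 t_ge1 nt1.
have P2 := ht n nn2.
have P1 := Pr_exists_jump mu_iid n t.
have K3t : 0 < K3 * t by rewrite mulr_gt0// (lt_le_trans ltr01).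
have P3 := truncated_deviation mu_iid trunc_sqr n t_ge1 K3t.
have {}P3 : Pr [set w | exists j : 'I_d.+1, K3 * t <=
    `|\sum_(0 <= k < n) trunc j t (w k) - n%:R * mean mu (trunc j t)|] <= 1 / 8.
  apply: le_trans P3 _.
  have -> : d.+1%:R * (n%:R * (C3 * t ^+ 2 * tail t) / (K3 * t) ^+ 2) =
     D * C3 * (n%:R * tail t) / K3 ^+ 2.
    by rewrite /D; field; rewrite !gt_eqF// (lt_le_trans ltr01).
  rewrite ler_pdivrMr; last by rewrite exprn_gt0// (lt_le_trans ltr01).
  have : K3 <= K3 ^+ 2 by rewrite ler_eXnr.
  have : D * C3 * (n%:R * tail t) <= D * C3 * (1 / 2).
    by rewrite ler_wpM2l// mulr_ge0// ltW.
  rewrite {1}/K3; lra.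
have mS j : measurable ([set w | K3 * t <= `|\sum_(0 <= k < n) trunc j t (w k) - n%:R * mean mu (trunc j t)|] : set OmT).
  apply: mset_le => //; apply: measurableT_comp => //; apply: measurable_funB => //.
  apply: measurable_sum => k; apply: (measurableT_comp (measurable_trunc j t)).
  exact: measurable_coord.
have m1 : measurable ([set w | exists k, (k < n)%N /\ t < norm1 (w k)] : set OmT).
  by apply: mset_exists => k; apply: mset_andp => _; exact: measurable_jump.
have m2 : measurable ([set w | K2 * c n <= ninc 0 n w] : set OmT).
  by apply: mset_le => //; exact: measurable_ninc.
have m3 : measurable ([set w | exists j : 'I_d.+1, K3 * t <=
    `|\sum_(0 <= k < n) trunc j t (w k) - n%:R * mean mu (trunc j t)|] : set OmT).
  rewrite (_ : [set w | _] = \bigcup_(j in [set: 'I_d.+1]) [set w | K3 * t <=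
       `|\sum_(0 <= k < n) trunc j t (w k) - n%:R * mean mu (trunc j t)|]).
    by apply: fin_bigcup_measurable => [|j _] //; exact: finite_finset.
  by apply/seteqP; split => w [j]; [exists j|exists j].
have [w [g1 g2 g3]] : exists w : nat -> E, [/\ (forall k, (k < n)%N -> norm1 (w k) <= t),
   ninc 0 n w < K2 * c n &
   `|\sum_(0 <= k < n) trunc i t (w k) - n%:R * mean mu (trunc i t)| < K3 * t].
  apply: contrapT => nw.
  have : Pr setT <= Pr [set w | exists k, (k < n)%N /\ t < norm1 (w k)] +
    Pr ([set w | K2 * c n <= ninc 0 n w] `|` [set w | exists j : 'I_d.+1, K3 * t <=
    `|\sum_(0 <= k < n) trunc j t (w k) - n%:R * mean mu (trunc j t)|]).
    apply: Pr_le2 => //; first exact: measurableU.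
    move=> w _; have [|nj] := pselect (exists k, (k < n)%N /\ t < norm1 (w k)); first by left.
    right; apply: contrapT => /not_orP[h1 h2]; apply: nw; exists w; split.
    - by move=> k kn; rewrite leNgt; apply/negP => tk; apply: nj; exists k.
    - by rewrite ltNge; apply/negP.
    - by rewrite ltNge; apply/negP => h; apply: h2; exists i.
  have := Pr_setU mu m2 m3; rewrite PrT; lra.
rewrite (sum_trunc_inc i g1) in g3.
have g4 : `|inc i 0 n w| <= `|K2| * Kc * t.
  apply: le_trans (inc_le_ninc i 0 n w) _; apply: le_trans (ltW g2) _.
  apply: (@le_trans _ _ (`|K2| * c n)); first by rewrite ler_wpM2r ?(ltW (c_gt0 n))// ler_norm.
  by rewrite -mulrA ler_wpM2l.
have g5 : n%:R * `|mean mu (trunc i t)| <= KK * t.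
  rewrite -[n%:R]normr_nat -normrM /KK mulrDl.
  have := ler_normB (inc i 0 n w) (inc i 0 n w - n%:R * mean mu (trunc i t)).
  rewrite opprB addrC subrK; lra.
have ph : 0 <= `|mean mu (trunc i t)| by [].
have : 1 / 4 * `|mean mu (trunc i t)| <= KK * t * tail t.
  apply: (@le_trans _ _ (n%:R * tail t * `|mean mu (trunc i t)|)); first by rewrite ler_wpM2r.
  by rewrite mulrAC ler_wpM2r// ltW.
lra.
Qed.

End centering.

(** * The bound for pinned walks in terms of phi *)

Section walk_bound.
Variables (R : realType) (d : nat).
Local Notation E := ((d.+1).-tuple R).
Local Notation OmT := (@Om _ E predT).
Variables (mu : probability OmT R) (nu : probability E R).
Hypothesis mu_iid : iid_law mu nu.
Local Notation Pr := (Pr mu).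
Local Notation tail := (tail mu).

Variables (phi : R -> R) (alpha a1 a2 rho : R) (n0 : nat) (c : nat -> R).
Hypotheses (alpha_gt0 : 0 < alpha) (alpha_lt2 : alpha < 2)
  (phi_rv : regularly_varying phi (- alpha)) (a1_gt0 : 0 < a1) (a2_gt0 : 0 < a2)
  (phi_tail : forall t, 0 < t -> a1 * phi t <= tail t)
  (tail_phi : forall t, 0 < t -> tail t <= a2 * phi (t / d.+1%:R))
  (box_phi : forall x : E, enorm x != 0 ->
     Pr (box (tnth x) 0 1) <= phi (enorm x) / enorm x ^+ d.+1)
  (c_gt0 : forall n, 0 < c n)
  (spread : exists2 kappa, 0 < kappa & exists n0, forall n, (n0 <= n)%N ->
     (\int[mu]_w cos (inc ord0 0 n w / c n)) ^+ 2 +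
     (\int[mu]_w sin (inc ord0 0 n w / c n)) ^+ 2 <= 1 - kappa)
  (tight : forall e, 0 < e -> exists K n0, forall n, (n0 <= n)%N ->
     Pr [set w | K * c n <= ninc 0 n w] <= e)
  (rho_gt0 : 0 < rho)
  (Pr_cmp : forall s n, (n0 <= n)%N -> rho <= Pr [set w | cmp s (hinc s 0 n w)]).

Lemma bridge_bound_rv : exists2 C, 0 < C & exists r0, forall n u z v r,
  (0 < n)%N -> 0 < u -> 0 < z -> r0 <= r ->
  (forall w, box v 0 n w -> r / 2 <= ninc 0 n w) ->
  Pr (bridge true u z v n) <=
  C * (tail r / r ^+ d.+1) * (renewal mu true u n * renewal mu false z n).
Proof.
have D1 : 1 <= d.+1%:R :> R by rewrite ler1n.
have tl_le s t : s <= t -> tail t <= tail s by exact: tail_le.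
have tl1 t : tail t <= 1 by exact: tail_le1.
have t_gt0 := rv_tail_gt0 phi_rv a1_gt0 phi_tail tl_le.
have [cF cF1 hF] := rv_double phi_rv a1_gt0 a2_gt0 D1 phi_tail tail_phi tl_le tl1.
have [M M0 hM] := rv_half alpha_gt0 phi_rv a1_gt0 a2_gt0 D1 phi_tail tail_phi tl_le.
have [L [t0 [L2 t01 hL]]] := rv_square alpha_lt2 phi_rv a1_gt0 a2_gt0 D1 phi_tail tail_phi.
have [C3 C30 h3] := trunc_sqr_le L2 t01 t_gt0 hL.
have [C4 C40 h4] := tail_loc_of_box a1_gt0 phi_tail cF1 t_gt0 hF box_phi.
have [C5 C50 h5] := trunc_mean_le mu_iid t_gt0 hM C30 h3 c_gt0 spread tight.
have [C7 C70 h7] := ninc_tail_le mu_iid t_gt0 C30 C50 h3 h5.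
have [C8 C80 h8] := exceed_tail_le mu_iid cF1 t_gt0 hF C30 C50 h3 h5.
have ex s := excur0_le mu_iid cF1 M0 t_gt0 hF hM C40 h4 C70 h7 C80 h8 rho_gt0 (@Pr_cmp s).
have [Ct Ct0 ht] := ex true; have [Cf Cf0 hf] := ex false.
apply: (@bridge_bound _ _ _ _ mu_iid cF C4 C8 (Ct + Cf) M) => //; first exact: addr_gt0.
have P0 s u m x : 0 < u -> 0 <= renewal mu s u m * surv_sum mu s m * tail x.
  move=> u0; rewrite !mulr_ge0 ?tail_ge0//; first by rewrite (le_trans _ (renewal_ge1 _ _ _ u0)).
  exact: le_trans (surv_sum_ge1 mu s m).
move=> [] u m x u0 x1; rewrite mulrDl.
- by apply: le_trans (ht u m x u0 x1) _; rewrite lerDl mulr_ge0 ?P0// ltW.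
- by apply: le_trans (hf u m x u0 x1) _; rewrite lerDr mulr_ge0 ?P0// ltW.
Qed.

Lemma box_ninc (v : E) n w : 2 * d.+1%:R <= norm1 v -> box (tnth v) 0 n w ->
  norm1 v / 2 <= ninc 0 n w.
Proof.
move=> vD vw.
suff : norm1 v <= ninc 0 n w + d.+1%:R by lra.
have -> : d.+1%:R = \sum_(i < d.+1) 1 :> R by rewrite sumr_const card_ord.
rewrite /norm1 /ninc -big_split; apply: ler_sum => i _ /=.
have /andP[h1 h2] := vw i.
have := ler_normB (inc i 0 n w) (inc i 0 n w - tnth v i).
rewrite subKr => h; apply: le_trans h _; rewrite lerD2l.
by rewrite ger0_norm ?subr_ge0// lerBlDl; exact: ltW.
Qed.

(** For large displacement only the norms change. For bounded displacement [g] is bounded below by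
    [k1] and both renewal sums are at least 1, so the bound exceeds 1. *)
Lemma bridge_bound_phi : exists2 C, 0 < C & forall n u z (v : E),
  (0 < n)%N -> 0 < u -> 0 < z -> enorm v != 0 ->
  Pr (bridge true u z (tnth v) n) <=
  C * (phi (enorm v) / enorm v ^+ d.+1) * (renewal mu true u n * renewal mu false z n).
Proof.
have [C C0 [r0 hC]] := bridge_bound_rv.
have D1 : 1 <= d.+1%:R :> R by rewrite ler1n.
have D0 : 0 < d.+1%:R :> R by rewrite ltr0n.
have tl_le s t : s <= t -> tail t <= tail s by exact: tail_le.
have tl1 t : tail t <= 1 by exact: tail_le1.
have t_gt0 := rv_tail_gt0 phi_rv a1_gt0 phi_tail tl_le.
have [cF cF1 hF] := rv_double phi_rv a1_gt0 a2_gt0 D1 phi_tail tail_phi tl_le tl1.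
pose r1 := Num.max r0 (2 * d.+1%:R).
have r10 : r0 <= r1 by rewrite le_max lexx.
have r1D : 2 * d.+1%:R <= r1 by rewrite le_max lexx orbT.
have r1_gt0 : 0 < r1 by apply: lt_le_trans r1D; rewrite mulr_gt0.
pose k1 := tail (d.+1%:R * r1) / (a2 * r1 ^+ d.+1).
have k10 : 0 < k1 by rewrite divr_gt0// mulr_gt0// exprn_gt0.
have cF0 : 0 < cF ^+ d.+1 by rewrite exprn_gt0// (lt_le_trans ltr01).
pose C2 := C * cF ^+ d.+1 * a2.
have C20 : 0 < C2 by rewrite !mulr_gt0.
exists (C2 + k1^-1); first by rewrite addr_gt0 ?invr_gt0.
move=> n u z v n_gt0 u0 z0 v0.
have s0 : 0 < enorm v by rewrite lt_def v0 enorm_ge0.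
have sr := enorm_le_norm1 v; have rs := norm1_le_enorm v.
have phi_gt0 : 0 < phi (enorm v) by case: phi_rv => _ h _; exact: h.
have tphi : tail (d.+1%:R * enorm v) <= a2 * phi (enorm v).
  have := @tail_phi (d.+1%:R * enorm v); rewrite mulr_gt0// => /(_ isT).
  by rewrite [_ * enorm v]mulrC mulfK// gt_eqF.
have rr1 : 1 <= renewal mu true u n * renewal mu false z n.
  by rewrite -[leLHS]mulr1 ler_pM ?renewal_ge1.
have rr0 := le_trans ler01 rr1.
set g := phi (enorm v) / enorm v ^+ d.+1.
have sD : 0 < enorm v ^+ d.+1 by rewrite exprn_gt0.
have g0 : 0 < g by rewrite divr_gt0.
have [rlt|rge] := ltP (norm1 v) r1.
  apply: (@le_trans _ _ 1); first by apply: Pr_le1; exact: measurable_bridge.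
  apply: (@le_trans _ _ (k1^-1 * g)); last first.
    rewrite -[leLHS]mulr1; apply: ler_pM => //; first by rewrite mulr_ge0 ?invr_ge0// ltW.
    by rewrite ler_pM2r// lerDr ltW.
  have srle : enorm v <= r1 by apply: le_trans sr (ltW rlt).
  have tle : tail (d.+1%:R * r1) <= a2 * phi (enorm v).
    by apply: le_trans tphi; apply: tl_le; rewrite ler_pM2l.
  have sle : enorm v ^+ d.+1 <= r1 ^+ d.+1.
    by apply: lerXn2r => //; rewrite nnegrE ltW.
  rewrite ler_pdivlMl// mulr1 /k1 /g invfM mulrA.
  have T0 := tail_ge0 mu (d.+1%:R * r1); have a20 := ltW a2_gt0; have r1_ge0 := ltW r1_gt0.
  apply: ler_pM; first by rewrite divr_ge0.
  - by rewrite invr_ge0 exprn_ge0.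
  - by rewrite ler_pdivrMr// [leRHS]mulrC.
  - by rewrite lef_pV2 ?posrE ?exprn_gt0.
apply: le_trans (hC n u z (tnth v) (norm1 v) n_gt0 u0 z0 (le_trans r10 rge) _) _.
  by move=> w; apply: box_ninc; exact: le_trans r1D rge.
rewrite ler_wpM2r//; apply: (@le_trans _ _ (C2 * g)); last first.
  by rewrite ler_pM2r// lerDl invr_ge0 ltW.
rewrite /C2 -!mulrA ler_pM2l// /g.
have r1' : 1 <= norm1 v.
  apply: le_trans rge; apply: le_trans r1D.
  by apply: le_trans D1 _; rewrite ler_peMl ?ler1n// ltW.
have shr := tail_shrink cF1 hF d.+1 r1'.
have tl_s : tail (2 ^+ d.+1 * norm1 v) <= tail (d.+1%:R * enorm v).
  apply: tl_le; apply: ler_pM => //; rewrite ?ler0n ?enorm_ge0//.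
  by rewrite -natrX ler_nat ltnW// ltn_expl.
rewrite !mulrA; apply: ler_pM; rewrite ?tail_ge0 ?invr_ge0 ?exprn_ge0 ?norm1_ge0//.
  apply: le_trans shr _; rewrite -mulrA ler_pM2l//; exact: le_trans tl_s tphi.
rewrite lef_pV2 ?posrE ?exprn_gt0// ?(lt_le_trans s0)//.
by apply: lerXn2r; rewrite ?nnegrE ?enorm_ge0 ?norm1_ge0.
Qed.

End walk_bound.

(** * Test functions and the spectral measure *)

Section euclidean_tests.
Variables (R : realType) (d : nat).
Local Notation E := ((d.+1).-tuple R).

Lemma tnth_vsub (x y : E) i : tnth (vsub x y) i = tnth x i - tnth y i.
Proof. by rewrite tnth_mktuple. Qed.

Lemma measurable_vec_norm1 : measurable_fun setT (fun e : E => norm1 e).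
Proof.
apply: measurable_sum => i; apply: measurableT_comp => //; exact: measurable_tnth.
Qed.

Lemma measurable_enorm : measurable_fun setT (fun e : E => enorm e).
Proof.
apply: (@measurableT_comp _ _ _ _ _ _ (@Num.sqrt R)).
  exact: continuous_measurable_fun (@sqrt_continuous R).
by apply: measurable_sum => i; apply: measurable_funM; exact: measurable_tnth.
Qed.

Lemma vcontinuous_coord (f : R -> R) i : continuous f -> vcontinuous (fun e : E => f (tnth e i)).
Proof.
move=> cf x e e0.
have := cf (tnth x i) => /cvgrPdist_lt /(_ e e0) [del /= del0 h].
exists del => // y xy; rewrite distrC; apply: h => /=.
by rewrite distrC -tnth_vsub; exact: le_lt_trans (coord_le_enorm _ _) xy.
Qed.

Lemma norm1_dist (x y : E) : `|norm1 y - norm1 x| <= norm1 (vsub y x).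
Proof.
rewrite /norm1 -sumrB; apply: le_trans (ler_norm_sum _ _ _) _; apply: ler_sum => i _.
by rewrite tnth_vsub; exact: ler_dist_dist.
Qed.

(* A continuous substitute for the indicator of [norm1 e >= 2 K]. *)
Definition clip (K : R) (e : E) : R := Num.min 1 (Num.max 0 (norm1 e / K - 1)).

Lemma clip_itv K e : 0 <= clip K e <= 1.
Proof. by rewrite /clip le_min ler01 le_max lexx ge_min lexx. Qed.

Lemma clip_bounded K : vbounded (clip K).
Proof. by exists 1 => e; have /andP[h1 h2] := clip_itv K e; rewrite ger0_norm. Qed.

Lemma clip_lip K (x y : E) : 0 < K -> `|clip K y - clip K x| <= norm1 (vsub y x) / K.
Proof.
move=> K0; apply: (@le_trans _ _ `|(norm1 y / K - 1) - (norm1 x / K - 1)|).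
  rewrite /clip; move: (norm1 y / K - 1) (norm1 x / K - 1) => a b.
  have lip (f : R -> R) : (forall u v, u <= v -> f u <= f v /\ f v <= f u + (v - u)) ->
      forall a b, `|f a - f b| <= `|a - b|.
    move=> hf p q; have [pq|pq] := leP p q.
      by have [h1 h2] := hf _ _ pq; rewrite distrC (distrC p) !ger0_norm ?subr_ge0//; lra.
    by have [h1 h2] := hf _ _ (ltW pq); rewrite !ger0_norm ?subr_ge0// ?(ltW pq)//; lra.
  apply: le_trans (lip (Num.min 1) _ _ _) (lip (Num.max 0) _ _ _) => u v uv.
    rewrite /Num.min; case: (ltP 1 u) => u1; case: (ltP 1 v) => v1; split; lra.
  rewrite /Num.max; case: (ltP 0 u) => u1; case: (ltP 0 v) => v1; split; lra.
rewrite opprB addrA subrK -mulrBl normrM normfV (gtr0_norm K0) ler_wpM2r ?invr_ge0 ?(ltW K0)//.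
exact: norm1_dist.
Qed.

Lemma clip_vcontinuous K : 0 < K -> vcontinuous (clip K).
Proof.
move=> K0 x e e0; have D0 : 0 < d.+1%:R :> R by rewrite ltr0n.
exists (e * K / d.+1%:R); first by rewrite divr_gt0// mulr_gt0.
move=> y xy; apply: le_lt_trans (clip_lip _ _ K0) _.
rewrite ltr_pdivrMr//; apply: le_lt_trans (norm1_le_enorm _) _.
by rewrite mulrC -ltr_pdivlMr.
Qed.

Lemma measurable_clip K : measurable_fun setT (clip K).
Proof.
apply: measurable_minr => //; apply: measurable_maxr => //.
apply: measurable_funB => //; apply: measurable_funM => //; exact: measurable_vec_norm1.
Qed.

Lemma clip_tight (m : probability E R) e : 0 < e ->
  exists2 K, 0 < K & (\int[m]_x (clip K x)%:E <= e%:E)%E.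
Proof.
move=> e0.
pose F k : set E := [set x | k.+1%:R <= norm1 x].
have mF k : measurable (F k) by apply: mset_le => //; exact: measurable_vec_norm1.
have F0 : \bigcap_k F k = set0.
  apply/seteqP; split => // x /= h.
  have := h (Num.truncn (norm1 x)) I; rewrite /F /= leNgt.
  by have /andP[_ ->] := truncn_itv (norm1_ge0 x).
have : m \o F @ \oo --> m (\bigcap_k F k).
  apply: nonincreasing_cvg_mu => //; first by rewrite -ge0_fin_numE// fin_num_measure.
  - by rewrite F0.
  - move=> i j ij; apply/subsetPset => x; rewrite /F /=; apply: le_trans.
    by rewrite ler_nat ltnS.
rewrite F0 measure0 => /fine_cvg /cvgrPdist_le /(_ e e0) [k _ /(_ k (leqnn k))] /=.
rewrite sub0r normrN ger0_norm ?fine_ge0// => mk.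
exists k.+1%:R; first by rewrite ltr0n.
apply: (@le_trans _ _ (m (F k))); last by rewrite -[m _]fineK ?fin_num_measure// lee_fin.
rewrite (_ : m (F k) = (\int[m]_x (\1_(F k) x)%:E)%E); last by rewrite integral_indic// setIT.
apply: ge0_le_integral => //.
- by move=> x _; rewrite lee_fin; have /andP[] := clip_itv k.+1%:R x.
- by apply/measurable_EFinP; exact: measurable_clip.
- by apply/measurable_EFinP; exact: measurable_indic.
- move=> x _; rewrite lee_fin indicE; case: (boolP (x \in F k)) => [_|].
    by have /andP[] := clip_itv k.+1%:R x.
  rewrite notin_setE /F /= => /negP; rewrite -ltNge => h.
  rewrite /clip ge_min ge_max lexx /= subr_le0 ler_pdivrMr ?ltr0n// mul1r (ltW h) orbT//.
Qed.

(** The integrand is positive on a set of positive measure. Finiteness, from coordinates at most 1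
    on the sphere, matters as well, because the real integral of an infinite value is 0. *)
Lemma spherical_moment_gt0 (alpha : R) (sig : {measure set E -> \bar R}) i : 0 < alpha ->
  (sig setT < +oo)%E -> sig (~` [set s | enorm s = 1]) = 0%E ->
  (0 < sig [set s | enorm s = 1%R /\ (0 < tnth s i)%R])%E ->
  0 < \int[sig]_s `|tnth s i| `^ alpha.
Proof.
move=> al0 fs sph pos.
have mt : measurable_fun setT (fun s : E => `|tnth s i| `^ alpha).
  apply: (measurableT_comp (measurable_powR _)); apply: measurableT_comp => //; exact: measurable_tnth.
have msph : measurable ([set s | enorm s = 1] : set E).
  rewrite (_ : [set s | _] = (fun e : E => enorm e) @^-1` [set 1]) //.
  by rewrite -[X in measurable X]setTI; apply: measurable_enorm.
have mpos : measurable ([set s | enorm s = 1 /\ 0 < tnth s i] : set E).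
  by apply: mset_and => //; apply: mset_lt => //; exact: measurable_tnth.
have mEt : measurable_fun setT (fun s : E => (`|tnth s i| `^ alpha)%:E) by exact/measurable_EFinP.
have t0 (s : E) : (0 <= (`|tnth s i| `^ alpha)%:E)%E by rewrite lee_fin powR_ge0.
rewrite /Rintegral; apply: fine_gt0; apply/andP; split.
  rewrite lt0e; apply/andP; split; last by apply: integral_ge0 => s _; exact: t0.
  apply/negP => /eqP h.
  have : ae_eq sig setT (fun s : E => (`|tnth s i| `^ alpha)%:E) (cst 0%E).
    apply/ae_eq_integral_abs => //; rewrite -[RHS]h; apply: eq_integral => s _.
    by rewrite gee0_abs.
  move=> [N [mN N0 hN]].
  have : (sig [set s | enorm s = 1%R /\ (0 < tnth s i)%R] <= sig N)%E.
    apply: le_measure; rewrite ?inE// => s [_ s0]; apply: hN => /= /(_ I) [] /eqP.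
    by rewrite powR_eq0 normr_eq0 gt_eqF.
  by rewrite N0 leNgt pos.
apply: (@le_lt_trans _ _ (sig setT)) => //.
rewrite (ge0_negligible_integral (measurableC msph))// setTD setCK.
apply: (@le_trans _ _ (\int[sig]_(s in [set s : E | enorm s = 1%R]) cst 1%E s)%E).
  apply: ge0_le_integral => //; first exact: measurable_funTS.
  move=> s s1; rewrite lee_fin (_ : 1 = 1 `^ alpha); last by rewrite powR1.
  apply: ge0_ler_powR; rewrite ?nnegrE ?(ltW al0)//.
  by apply: le_trans (coord_le_enorm _ _) _; rewrite s1.
rewrite integral_cst// mul1e; apply: le_measure; rewrite ?inE//.
Qed.

End euclidean_tests.

(** * The law of the sequence of steps *)

Section path_law.
Variables (R : realType) (d : nat) (d0 : measure_display) (T : measurableType d0)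
  (P : probability T R) (X : nat -> T -> (d.+1).-tuple R).
Local Notation E := ((d.+1).-tuple R).
Local Notation OmT := (@Om _ E predT).
Hypothesis X_iid : iid_vectors P X.

Definition steps (x : T) : OmT := fun k => X k x.

Lemma measurable_step k : measurable_fun setT (X k).
Proof. by case: X_iid. Qed.

Lemma measurable_steps : measurable_fun setT steps.
Proof. by apply: measurable_into_Om => k _; exact: measurable_step. Qed.

HB.instance Definition _ := isMeasurableFun.Build _ _ _ _ steps measurable_steps.
HB.instance Definition _ k := isMeasurableFun.Build _ _ _ _ (X k) (measurable_step k).

Definition path_law : probability OmT R := distribution P steps.
Definition step_law : probability E R := distribution P (X 0%N).

Lemma path_lawE A : path_law A = P (steps @^-1` A).
Proof. by []. Qed.

Lemma path_law_iid : iid_law path_law step_law.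
Proof.
move=> n A mA; rewrite path_lawE.
have [_ hid hind] := X_iid.
rewrite (_ : steps @^-1` _ = \bigcap_(k in [set k | k \in iota 0 n]) (X k @^-1` A k)); last first.
  apply/seteqP; split => [x h k /=|x h k kn _].
    by rewrite mem_iota add0n => /andP[_ kn]; exact: h.
  by apply: (h k); rewrite /= mem_iota add0n.
rewrite hind ?iota_uniq// -[in iota _ _](subn0 n) -/(index_iota 0 n) big_mkord.
rewrite -prodEFin; apply: eq_bigr => k _; rewrite hid// fineK//.
exact: fin_num_measure.
Qed.

Lemma tnth_S n x i : tnth (S X n x) i = inc i 0 n (steps x).
Proof.
rewrite /S /inc big_mkord.
apply: (big_morph (fun e : E => tnth e i)) => [e f|]; by rewrite tnth_mktuple.
Qed.

Lemma S1_inc n x : S1 X n x = inc ord0 0 n (steps x).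
Proof. exact: tnth_S. Qed.

Lemma norm1_S n x : norm1 (S X n x) = ninc 0 n (steps x).
Proof. by apply: eq_bigr => i _; rewrite tnth_S. Qed.

Lemma measurable_S n : measurable_fun setT (S X n).
Proof.
apply/measurable_fun_tnthP => i.
rewrite (_ : _ \o _ = (fun w : OmT => inc i 0 n w) \o steps); last first.
  by apply/funext => x /=; exact: tnth_S.
by apply: measurableT_comp measurable_steps; exact: measurable_inc.
Qed.

Lemma Rintegral_path (f : OmT -> R) C : measurable_fun setT f -> (forall w, `|f w| <= C) ->
  \int[path_law]_w f w = fine (\int[P]_x (f (steps x))%:E)%E.
Proof.
move=> mf fC; rewrite /Rintegral integral_distribution//; first exact/measurable_EFinP.
apply: (@le_integrable _ _ _ P setT measurableT _ (cst C%:E)).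
- by apply/measurable_EFinP; apply: measurableT_comp measurable_steps.
- by move=> x _ /=; rewrite lee_fin (le_trans (fC _))// ler_norm.
- by apply: finite_measure_integrable_cst.
Qed.

Variable alpha : R.
Hypotheses (alpha_gt0 : 0 < alpha) (stable : multi_stable_domain P X alpha).

(** Along the first coordinate vector the limit has characteristic function of modulus exp(-A) with
    A > 0, by the spectral mass where the first coordinate is positive; skewness and shift affect
    only the phase. Tightness comes from weak convergence tested on [clip]. *)
Lemma norming_sequence : exists c : nat -> R, [/\ forall n, 0 < c n,
  exists2 kappa, 0 < kappa & exists n0, forall n, (n0 <= n)%N ->
     (\int[path_law]_w cos (inc ord0 0 n w / c n)) ^+ 2 +
     (\int[path_law]_w sin (inc ord0 0 n w / c n)) ^+ 2 <= 1 - kappa &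
  forall e, 0 < e -> exists K n0, forall n, (n0 <= n)%N ->
     Pr path_law [set w | K * c n <= ninc 0 n w] <= e].
Proof.
have [c [c0 [m [sig [b [[fs sph char] pos _ cv]]]]]] := stable.
exists c; split => //.
- pose e1 : E := [tuple ((i : nat) == 0%N)%:R | i < d.+1].
  have dot1 s : vdot e1 s = tnth s ord0.
    rewrite /vdot (bigD1 ord0)//= big1 ?addr0 ?tnth_mktuple ?mul1r// => i i0.
    by rewrite tnth_mktuple (_ : ((i : nat) == 0%N) = false) ?mul0r//; apply/negbTE.
  have A0 : 0 < stab_A alpha sig e1.
    rewrite /stab_A (_ : (fun s => _) = fun s : E => `|tnth s ord0| `^ alpha).
      exact: spherical_moment_gt0.
    by apply/funext => s; rewrite dot1.
  pose A := stab_A alpha sig e1; pose B := stab_B alpha sig b e1.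
  have [hcos hsin] := char e1.
  have lim (f : R -> R) (l : R) : continuous f -> (forall r, `|f r| <= 1) ->
      (\int[m]_x (f (vdot e1 x))%:E = l%:E)%E ->
      \int[path_law]_w f (inc ord0 0 n w / c n) @[n --> \oo] --> l.
    move=> cf f1 hl.
    have := cv (fun e => f (tnth e ord0)) (vcontinuous_coord ord0 cf).
    have -> : (\int[m]_x (f (tnth x ord0))%:E = l%:E)%E.
      by rewrite -hl; apply: eq_integral => x _; rewrite dot1.
    move=> /(_ _)/fine_cvg h.
    rewrite (_ : (fun n => _) = fine \o (fun n => \int[P]_w (f (tnth (vscale (c n)^-1 (S X n w)) ord0))%:E)%E).
      by apply: h; exists 1.
    apply/funext => n /=; rewrite (@Rintegral_path _ 1)//; last first.
      apply: (measurableT_comp (continuous_measurable_fun cf)).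
      by apply: measurable_funM => //; exact: measurable_inc.
    congr fine; apply: eq_integral => x _.
    by rewrite tnth_mktuple tnth_S mulrC.
  have lc := lim _ _ (@continuous_cos R) (@cos_max R) hcos.
  have ls := lim _ _ (@continuous_sin R) (@sin_max R) hsin.
  pose L := expR (- A) * cos B * (expR (- A) * cos B) + expR (- A) * sin B * (expR (- A) * sin B).
  have cvL : (\int[path_law]_w cos (inc ord0 0 n w / c n)) * (\int[path_law]_w cos (inc ord0 0 n w / c n)) +
      (\int[path_law]_w sin (inc ord0 0 n w / c n)) * (\int[path_law]_w sin (inc ord0 0 n w / c n))
      @[n --> \oo] --> L by apply: cvgD; apply: cvgM.
  have L1 : L < 1.
    have -> : L = expR (- A) ^+ 2.
      by rewrite /L -[RHS]mulr1 -(cos2Dsin2 B); ring.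
    by rewrite expr_lt1// ?expR_ge0// expR_lt1 oppr_lt0.
  have k0 : 0 < (1 - L) / 2 by rewrite divr_gt0// subr_gt0.
  have /cvgrPdist_le /(_ _ k0) [n0 _ hn] := cvL.
  exists ((1 - L) / 2) => //; exists n0 => n nn0.
  have := hn n nn0; rewrite /= ler_norml lerNl opprB lerBlDl => /andP[h _]; rewrite !expr2.
  by apply: le_trans h _; clearbody L; lra.
- move=> e e0; have e20 : 0 < e / 2 by rewrite divr_gt0.
  have [K K0 hK] := clip_tight m e20.
  have := cv (clip K) (clip_vcontinuous K0) (@clip_bounded R d K).
  have [l lE] : exists l, (\int[m]_x (clip K x)%:E = l%:E)%E.
    exists (fine (\int[m]_x (clip K x)%:E)%E); rewrite fineK// ge0_fin_numE.
      by apply: le_lt_trans hK _; rewrite ltry.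
    by apply: integral_ge0 => x _; rewrite lee_fin; have /andP[] := clip_itv K x.
  rewrite lE lee_fin in hK *; move=> /fine_cvg /cvgrPdist_le /(_ _ e20) [n0 _ hn].
  exists (2 * K), n0 => n nn0.
  have := hn n nn0; rewrite /= ler_norml => /andP[h _].
  have mcl : measurable_fun setT (fun x => clip K (vscale (c n)^-1 (S X n x))).
    apply: (measurableT_comp (measurable_clip K)); apply/measurable_fun_tnthP => i.
    rewrite (_ : _ \o _ = (fun x => (c n)^-1 * tnth (S X n x) i)); last first.
      by apply/funext => x /=; rewrite tnth_mktuple.
    apply: measurable_funM => //.
    by apply: (measurableT_comp (measurable_tnth i)); exact: measurable_S.
  apply: (@le_trans _ _ (fine (\int[P]_x (clip K (vscale (c n)^-1 (S X n x)))%:E)%E)); last first.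
    by move: h; set a := fine _; lra.
  pose A : set OmT := [set w | 2 * K * c n <= ninc 0 n w].
  have mA : measurable A by apply: mset_le => //; exact: measurable_ninc.
  have mA' : measurable (steps @^-1` A).
    by rewrite -[X in measurable X]setTI; apply: measurable_steps.
  have I0 : (0 <= \int[P]_x (clip K (vscale (c n)^-1 (S X n x)))%:E)%E.
    by apply: integral_ge0 => x _; rewrite lee_fin; have /andP[] := clip_itv K (vscale (c n)^-1 (S X n x)).
  apply: fine_le; rewrite ?fin_num_measure//.
    rewrite ge0_fin_numE//; apply: (@le_lt_trans _ _ (\int[P]_x cst 1%E x)%E).
      apply: ge0_le_integral => //.
      - by move=> x _; rewrite lee_fin; have /andP[] := clip_itv K (vscale (c n)^-1 (S X n x)).
      - exact/measurable_EFinP.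
      - by move=> x _; rewrite lee_fin; have /andP[] := clip_itv K (vscale (c n)^-1 (S X n x)).
    by rewrite integral_cst// mul1e [X in (X < _)%E](_ : _ = 1%E) ?ltry//; exact: probability_setT.
  rewrite (_ : path_law _ = (\int[P]_x (\1_(steps @^-1` A) x)%:E)%E); last first.
    by rewrite integral_indic// setIT.
  apply: ge0_le_integral => //.
  - by apply/measurable_EFinP; exact: measurable_indic.
  - exact/measurable_EFinP.
  - move=> x _; rewrite lee_fin indicE; case: (boolP (x \in _)) => [|_]; last first.
      by have /andP[] := clip_itv K (vscale (c n)^-1 (S X n x)).
    rewrite inE /A /= => h2; rewrite /clip le_min lexx /= le_max; apply/orP; right.
    have -> : norm1 (vscale (c n)^-1 (S X n x)) = ninc 0 n (steps x) / c n.
      rewrite -norm1_S /norm1 mulr_suml; apply: eq_bigr => i _.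
      by rewrite tnth_mktuple normrM normfV (gtr0_norm (c0 n)) mulrC.
    rewrite -(@lerD2r _ 1) subrK ler_pdivlMr// ler_pdivlMr//.
Qed.

End path_law.

(** * Comparison with the renewal functions H and V *)

Section renewal_functions.
Variables (R : realType) (d : nat) (d0 : measure_display) (T : measurableType d0)
  (P : probability T R) (X : nat -> T -> (d.+1).-tuple R).
Local Notation E := ((d.+1).-tuple R).
Hypothesis X_iid : iid_vectors P X.
Let mu := path_law X_iid.

Lemma ladder_minus_lad x : ladder_minus X x =1 lad true (steps X x).
Proof. by move=> m; rewrite /ladder_minus /lad S1_inc /cmp /= leNgt. Qed.

Lemma ladder_plus_lad x : ladder_plus X x =1 lad false (steps X x).
Proof. by move=> m; rewrite /ladder_plus /lad S1_inc /cmp /= oppr_ge0 -ltNge. Qed.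

Lemma chi_minus_chi x : chi_minus X x = chi true (steps X x).
Proof.
rewrite /chi_minus /chi; case: pselect => h; case: pselect => h'.
- rewrite S1_inc; congr (- inc _ _ _ _); apply: eq_ex_minn; exact: ladder_minus_lad.
- by exfalso; apply: h'; have [m hm] := h; exists m; rewrite -ladder_minus_lad.
- by exfalso; apply: h; have [m hm] := h'; exists m; rewrite ladder_minus_lad.
- by [].
Qed.

Lemma chi_plus_chi x : chi_plus X x = chi false (steps X x).
Proof.
rewrite /chi_plus /chi; case: pselect => h; case: pselect => h'.
- rewrite S1_inc opprK; congr (inc _ _ _ _); apply: eq_ex_minn; exact: ladder_plus_lad.
- by exfalso; apply: h'; have [m hm] := h; exists m; rewrite -ladder_plus_lad.
- by exfalso; apply: h; have [m hm] := h'; exists m; rewrite ladder_plus_lad.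
- by [].
Qed.

Lemma Flad_path s k u : Flad mu s k.+1 u =
  (\int[P]_(x in steps X @^-1` lads s) Flad mu s k (u - chi s (steps X x)))%E.
Proof.
have [F0 mF] := Flad_ge0_measurable mu s k.
have mf : measurable_fun setT (fun w : @Om _ E predT => Flad mu s k (u - chi s w)).
  apply: (measurableT_comp mF); apply: measurable_funB => //; exact: measurable_chi.
rewrite /= -[LHS]/(\int[pushforward P (steps X)]_(w in lads s) Flad mu s k (u - chi s w))%E.
rewrite (@ge0_integral_pushforward _ _ T (@Om _ E predT) R (steps X) (measurable_steps X_iid))//.
- exact: measurable_lads.
- exact: measurable_funTS.
Qed.

Lemma Fminus_Flad k u : Fminus P X k u = Flad mu true k u.
Proof.
elim: k u => // k IH u; rewrite Flad_path /=.
have -> : [set w | exists m, ladder_minus X w m] = steps X @^-1` lads true.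
  by apply/seteqP; split => x [m hm]; exists m; move: hm; rewrite ladder_minus_lad.
by apply: eq_integral => x _; rewrite IH chi_minus_chi.
Qed.

Lemma Fplus_Flad k u : Fplus P X k u = Flad mu false k u.
Proof.
elim: k u => // k IH u; rewrite Flad_path /=.
have -> : [set w | exists m, ladder_plus X w m] = steps X @^-1` lads false.
  by apply/seteqP; split => x [m hm]; exists m; move: hm; rewrite ladder_plus_lad.
by apply: eq_integral => x _; rewrite IH chi_plus_chi.
Qed.

Lemma renewal_le_Vren u n : ((renewal mu true u n)%:E <= Vren P X u)%E.
Proof.
apply: le_trans (renewal_le_Flad (path_law_iid X_iid) true n u) _.
under eq_bigr do rewrite -Fminus_Flad.
rewrite -(big_mkord predT (fun k => Fminus P X k u)); apply: nneseries_lim_ge => k _ _.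
by rewrite Fminus_Flad; have [] := Flad_ge0_measurable mu true k.
Qed.

Lemma renewal_le_Hren u n : ((renewal mu false u n)%:E <= Hren P X u)%E.
Proof.
apply: le_trans (renewal_le_Flad (path_law_iid X_iid) false n u) _.
under eq_bigr do rewrite -Fplus_Flad.
rewrite -(big_mkord predT (fun k => Fplus P X k u)); apply: nneseries_lim_ge => k _ _.
by rewrite Fplus_Flad; have [] := Flad_ge0_measurable mu false k.
Qed.

Lemma steps_pn n x y : [set w | in_box (vadd x (S X n w)) y /\
    forall m, (1 <= m <= n)%N -> 0 < tnth x ord0 + S1 X m w] =
  steps X @^-1` [set w | box (tnth (vsub y x)) 0 n w /\ stay true (tnth x ord0) n w].
Proof.
apply/seteqP; split => w [h1 h2]; split.
- by move=> i; have := h1 i; rewrite !tnth_mktuple tnth_S; lra.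
- by move=> m hm; rewrite /hinc -S1_inc; exact: h2.
- by move=> i; have := h1 i; rewrite !tnth_mktuple tnth_S; lra.
- by move=> m hm; rewrite S1_inc; exact: h2.
Qed.

(** The endpoint has first coordinate below y_1 + 1, so the backward walk started at y_1 + 1 lies
    above the path itself, which is positive. This is the origin of the argument y_1 + 1; enlarging
    x_1 to x_1 + 1 only weakens the condition. *)
Lemma stay_bridge n (x y : E) w : 0 < tnth x ord0 ->
  box (tnth (vsub y x)) 0 n w -> stay true (tnth x ord0) n w ->
  bridge true (tnth x ord0 + 1) (tnth y ord0 + 1) (tnth (vsub y x)) n w.
Proof.
move=> x0 bw sw; split=> //; split => [j jn|j /andP[j0 jn]]; first by have := sw j jn; lra.
have /andP[_] := bw ord0; rewrite tnth_mktuple (@inc_cat _ _ _ 0 (n - j) n) ?leq_subr//.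
have : 0 < tnth x ord0 + inc ord0 0 (n - j) w.
  have [->|nj] := posnP (n - j); first by rewrite inc_nil addr0.
  by apply: sw; rewrite nj leq_subr.
rewrite /hinc /=; lra.
Qed.

End renewal_functions.

Lemma enorm_vsubC (R : realType) (d : nat) (x y : (d.+1).-tuple R) :
  enorm (vsub x y) = enorm (vsub y x).
Proof.
congr Num.sqrt; apply: eq_bigr => i _.
by rewrite !tnth_mktuple -mulrNN !opprB.
Qed.

Theorem theorem4 (R : realType) (d : nat) (d0 : measure_display)
  (T : measurableType d0) (P : probability T R)
  (X : nat -> T -> (d.+1).-tuple R) (alpha : R) (phi : R -> R) (a1 a2 : R) :
  standing_assumptions P X alpha ->
  alpha < 2 ->
  regularly_varying phi (- alpha) ->
  0 < a1 -> 0 < a2 ->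
  (forall x : (d.+1).-tuple R,
     (P [set w | in_box (X 0%N w) x] <= gfun d.+1 phi (enorm x))%E) ->
  (forall t : R, 0 < t ->
     ((a1 * phi t)%:E <= P [set w | (t < enorm (X 0%N w))%R])%E /\
     (P [set w | (t < enorm (X 0%N w))%R] <= (a2 * phi t)%:E)%E) ->
  exists2 C0 : R, 0 < C0 &
    forall (n : nat) (x y : (d.+1).-tuple R),
      (1 <= n)%N -> 0 < tnth x ord0 -> 0 < tnth y ord0 ->
      (pn P X n x y <=
         C0%:E * gfun d.+1 phi (enorm (vsub x y)) *
         Hren P X (tnth y ord0 + 1) * Vren P X (tnth x ord0 + 1))%E.
Proof.
move=> [[X_iid /andP[al0 _] dom _ _] [rho [/andP[rho0 rho1] cvrho]]] al2 phi_rv a10 a20 boxX tailX.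
have mu_iid := path_law_iid X_iid.
set mu := path_law X_iid in mu_iid.
have [c [c0 spread tight]] := norming_sequence X_iid al0 dom.
have D0 : 0 < d.+1%:R :> R by rewrite ltr0n.
have mX0 := measurable_step X_iid 0%N.
have mF t : measurable [set x | t < enorm (X 0%N x)].
  by apply: mset_lt => //; apply: (measurableT_comp (@measurable_enorm R d)).
have mN t : measurable [set x | t < norm1 (X 0%N x)].
  by apply: mset_lt => //; apply: (measurableT_comp (@measurable_vec_norm1 R d)).
have tailE t : tail mu t = fine (P [set x | t < norm1 (X 0%N x)]) by [].
have phi_tail t : 0 < t -> a1 * phi t <= tail mu t.
  move=> t0; have [h _] := tailX t t0.
  rewrite -lee_fin tailE fineK ?fin_num_measure//; apply: le_trans h _.
  apply: le_measure; rewrite ?inE// => x /= h; exact: lt_le_trans h (enorm_le_norm1 _).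
have tail_phi t : 0 < t -> tail mu t <= a2 * phi (t / d.+1%:R).
  move=> t0; have [|_ h] := tailX (t / d.+1%:R); first exact: divr_gt0.
  rewrite -lee_fin tailE fineK ?fin_num_measure//; apply: le_trans h.
  apply: le_measure; rewrite ?inE// => x /= h; rewrite ltr_pdivrMr// mulrC.
  exact: lt_le_trans h (norm1_le_enorm _).
have box_phi (x : (d.+1).-tuple R) : enorm x != 0 ->
    Pr mu (box (tnth x) 0 1) <= phi (enorm x) / enorm x ^+ d.+1.
  move=> x0; rewrite -lee_fin -Pr_fin; last exact: measurable_box.
  have := boxX x; rewrite /gfun (negbTE x0); apply: le_trans.
  rewrite le_eqVlt; apply/orP; left; apply/eqP; congr (P _).
  by apply/seteqP; split => w h i; have := h i; rewrite inc1.
have [rho2 rho20 [n0 Pr_cmp]] : exists2 rho2, 0 < rho2 & exists n0, forall s n, (n0 <= n)%N ->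
    rho2 <= Pr mu [set w | cmp s (hinc s 0 n w)].
  (* Within [e] of the limit [rho], both the event and its complement keep probability at least [e],
     which covers both values of [s]. *)
  pose e := Num.min rho (1 - rho) / 2.
  have m0 : 0 < Num.min rho (1 - rho) by rewrite lt_min rho0 subr_gt0.
  have e0 : 0 < e by rewrite divr_gt0.
  have m1 : Num.min rho (1 - rho) <= rho by rewrite ge_min lexx.
  have m2 : Num.min rho (1 - rho) <= 1 - rho by rewrite ge_min lexx orbT.
  move: cvrho => /fine_cvg /cvgrPdist_le /(_ e e0) [n0 _ hn].
  exists e => //; exists n0 => s n nn0.
  have := hn n nn0; rewrite /= (_ : [set w | 0 < S1 X n w] =
    steps X @^-1` [set w | 0 < inc ord0 0 n w]); last first.
    by apply/seteqP; split => w /=; rewrite S1_inc.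
  have mi : measurable ([set w | 0 < inc ord0 0 n w] : set (@Om _ ((d.+1).-tuple R) predT)).
    by apply: mset_lt => //; exact: measurable_inc.
  rewrite -[fine _]/(Pr mu [set w | 0 < inc ord0 0 n w]) ler_norml => /andP[h1 h2].
  case: s.
    rewrite /cmp /hinc; move: h1 h2; rewrite /e; lra.
  rewrite (_ : [set w | _] = ~` [set w | 0 < inc ord0 0 n w]); last first.
    apply/seteqP; split => w; rewrite /cmp /hinc /= oppr_ge0 leNgt; first by move/negP.
    by move=> h; apply/negP.
  by rewrite PrC//; move: h1 h2; rewrite /e; lra.
have [C C0 hC] := bridge_bound_phi mu_iid al0 al2 phi_rv a10 a20 phi_tail tail_phi box_phi
  c0 spread tight rho20 Pr_cmp.
exists C => // n x y n1 x0 y0.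
have u0 : 0 < tnth x ord0 + 1 by rewrite addr_gt0.
have z0 : 0 < tnth y ord0 + 1 by rewrite addr_gt0.
have Vle := renewal_le_Vren X_iid (tnth x ord0 + 1) n.
have Hle := renewal_le_Hren X_iid (tnth y ord0 + 1) n.
have V1 : (1 <= Vren P X (tnth x ord0 + 1))%E.
  by apply: le_trans Vle; rewrite lee_fin; exact: renewal_ge1.
have H1 : (1 <= Hren P X (tnth y ord0 + 1))%E.
  by apply: le_trans Hle; rewrite lee_fin; exact: renewal_ge1.
have H0 := lt_le_trans (@lte01 R) H1; have V0 := lt_le_trans (@lte01 R) V1.
(* At zero displacement [gfun] is infinite, and the right side is infinite since the other factors
   are positive. *)
rewrite enorm_vsubC; have [s0|s0] := eqVneq (enorm (vsub y x)) 0.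
  by rewrite /gfun s0 eqxx gt0_muley ?lte_fin// gt0_mulye// gt0_mulye// leey.
rewrite /gfun (negbTE s0) -EFinM.
have g0 : 0 < phi (enorm (vsub y x)) / enorm (vsub y x) ^+ d.+1.
  have s_gt0 : 0 < enorm (vsub y x) by rewrite lt_def s0 enorm_ge0.
  by rewrite divr_gt0 ?exprn_gt0//; case: phi_rv => _ h _; exact: h.
have Cg0 := ltW (mulr_gt0 C0 g0).
apply: (@le_trans _ _ (Pr mu (bridge true (tnth x ord0 + 1) (tnth y ord0 + 1)
    (tnth (vsub y x)) n))%:E).
  rewrite -Pr_fin; last exact: measurable_bridge.
  rewrite /pn steps_pn -[P _]/(mu _); apply: le_measure; rewrite ?inE.
  - by apply: mset_and; [exact: measurable_box|exact: measurable_stay].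
  - exact: measurable_bridge.
  - by move=> w [bw sw]; exact: stay_bridge.
apply: (@le_trans _ _ ((C * (phi (enorm (vsub y x)) / enorm (vsub y x) ^+ d.+1))%:E *
    (renewal mu false (tnth y ord0 + 1) n)%:E * (renewal mu true (tnth x ord0 + 1) n)%:E)%E).
  by rewrite -!EFinM lee_fin -mulrA [X in _ * X]mulrC; exact: hC.
have r0 s u : 0 < u -> (0 <= (renewal mu s u n)%:E)%E.
  by move=> u0'; rewrite lee_fin (le_trans ler01)// renewal_ge1.
apply: lee_pmul => //; last by apply: lee_pmul => //; exact: r0.
- by apply: mule_ge0; [rewrite lee_fin|exact: r0].
- exact: r0.
Qed.
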